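(* There exist universal constants $c,c'>0$ such that the following holds. Let $X\ne\{0\}$ be a Banach space and let $(T(t))_{t\ge0}$ be a strongly continuous semigroup on $X$ with $\|T(t)\|\le M$ for all $t\ge0$, where $M\ge1$. Suppose that there are a complex number $\zeta$ with $|\zeta|=1$ and $K\in(0,\infty)$ such that $$\|(\zeta I-T(t))x\|\ge\frac{\|x\|}{K}\qquad\text{for all }x\in X\text{ and all }t>0.$$ Then $(T(t))$ can be extended to a bounded holomorphic semigroup. In particular, with $\widetilde{C}:=M^2K>0$, the extension is defined and satisfies $$\|T(z)\|\le c'\,\widetilde{C}\bigl(1+\log(\widetilde{C})\bigr)$$ for every $z\in\mathbb{C}\setminus\{0\}$ with $|\arg(z)|\le c/\widetilde{C}$.
   Context: Banach spaces are over $\mathbb{C}$. A strongly continuous ($C_0$-) semigroup on $X$ is a family $(T(t))_{t\ge0}$ of bounded linear operators with $T(0)=I$, $T(t+s)=T(t)T(s)$ for $t,s\ge0$, and $\lim_{t\downarrow0}T(t)x=x$ for all $x\in X$. For $\alpha\in[0,\pi)$, $\Sigma_\alpha=\{z\in\mathbb{C}\setminus\{0\}:|\arg z|<\alpha\}$ and $\overline{\Sigma_\alpha}=\{z:|\arg z|\le\alpha\}$ (including $0$), with argument in $(-\pi,\pi)$. A bounded holomorphic semigroup (of angle $\delta$) is a family of bounded operators $(T(z))_{z\in\Sigma_\delta\cup\{0\}}$ with (i) $T(z_1+z_2)=T(z_1)T(z_2)$ for $z_1,z_2\in\Sigma_\delta$; (ii) $z\mapsto T(z)$ holomorphic in $\Sigma_\delta$;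 (iii) $T(z)x\to x$ as $z\to0$, $z\in\overline{\Sigma_{\delta'}}$, for all $x\in X$ and $0<\delta'<\delta$; (iv) $\|T(z)\|$ bounded on $\overline{\Sigma_{\delta'}}$ for every $0<\delta'<\delta$. *)

(* Defs.v *)
(* Stdlib reals with Coquelicot: a complex Banach space is a
   [CompleteNormedModule C_AbsRing], and [is_linear] means linear and bounded. *)
From Stdlib Require Import Reals Lra.
From Coquelicot Require Import Coquelicot.
Open Scope R_scope.

(* Operator norm with values in [Rbar], equal to [p_infty] when [A] is unbounded
   on the unit ball. *)
Definition op_norm {X : NormedModule C_AbsRing} (A : X -> X) : Rbar :=
  Lub_Rbar (fun r => exists x : X, norm x <= 1 /\ r = norm (A x)).

(* Principal argument, in (-PI, PI]; meaningful only for [z <> 0].  The value PI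
   on the negative real axis is never attained in a sector of half-angle < PI. *)
Definition Carg (z : C) : R :=
  if Rle_dec 0 (Im z) then acos (Re z / Cmod z) else - acos (Re z / Cmod z).

Lemma Carg_bound (z : C) : - PI <= Carg z <= PI.
Proof.
unfold Carg.
destruct (acos_bound (Re z / Cmod z)) as [H0 H1].
destruct (Rle_dec 0 (Im z)); lra.
Qed.

Lemma Carg_polar (z : C) :
  z <> RtoC 0 -> z = (Cmod z * cos (Carg z), Cmod z * sin (Carg z)).
Proof.
intros Hz.
assert (Hm : 0 < Cmod z) by now apply Cmod_gt_0.
assert (H2 := Cmod2_alt z).
set (m := Cmod z) in *.
assert (Hs : (Re z / m) ^ 2 + (Im z / m) ^ 2 = 1).
{ replace ((Re z / m) ^ 2 + (Im z / m) ^ 2)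
    with ((Re z ^ 2 + Im z ^ 2) / m ^ 2) by (field; lra).
  rewrite <- H2; field; lra. }
assert (Hb : -1 <= Re z / m <= 1) by (split; nra).
assert (Hsin : sin (acos (Re z / m)) = Rabs (Im z) / m).
{ rewrite sin_acos by assumption.
  replace (1 - (Re z / m)²) with ((Im z / m)²) by (unfold Rsqr; nra).
  rewrite sqrt_Rsqr_abs, Rabs_div, (Rabs_pos_eq m); lra. }
unfold Carg; fold m.
destruct z as [x y]; unfold Re, Im in *; simpl in *.
destruct (Rle_dec 0 y) as [Hy | Hy].
- rewrite cos_acos, Hsin, (Rabs_pos_eq y) by assumption.
  f_equal; field; lra.
- rewrite cos_neg, sin_neg, cos_acos, Hsin, (Rabs_left y) by (assumption || lra).
  f_equal; field; lra.
Qed.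

Definition sector (alpha : R) (z : C) : Prop :=
  z <> RtoC 0 /\ Rabs (Carg z) < alpha.

Definition closed_sector (alpha : R) (z : C) : Prop :=
  z = RtoC 0 \/ Rabs (Carg z) <= alpha.

Record C0_semigroup {X : CompleteNormedModule C_AbsRing} (T : R -> X -> X) : Prop := {
  C0_bounded : forall t, 0 <= t -> is_linear (T t);
  C0_id : forall x, T 0 x = x;
  C0_add : forall t s, 0 <= t -> 0 <= s -> forall x, T (t + s) x = T t (T s x);
  C0_cont : forall x, filterlim (fun t => T t x) (at_right 0) (locally x) }.

(* Complex differentiability in operator norm at every point of [D], for [D] open:
   the difference quotients converge in operator norm to a bounded operator. *)
Definition holomorphic_on {X : CompleteNormedModule C_AbsRing}
    (D : C -> Prop) (F : C -> X -> X) : Prop :=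
  forall z, D z ->
  exists L : X -> X, is_linear L /\
    forall eps : posreal,
      locally' z (fun w =>
        Rbar_le
          (op_norm (fun x =>
             minus (scal (/ (w - z))%C (minus (F w x) (F z x))) (L x)))
          eps).

(* The values of [S] outside the open sector and 0 are irrelevant.  The condition
   delta <= PI/2 makes the sector closed under addition, so that S (z1 + z2) makes
   sense.  The filter in [hol_cont] does not exclude z = 0, hence it forces
   S 0 = I. *)
Record bounded_holomorphic_semigroup {X : CompleteNormedModule C_AbsRing}
    (delta : R) (S : C -> X -> X) : Prop := {
  hol_angle : 0 < delta <= PI / 2;
  hol_bounded : forall z, sector delta z \/ z = RtoC 0 -> is_linear (S z);
  hol_add : forall z1 z2, sector delta z1 -> sector delta z2 ->
    forall x, S (z1 + z2)%C x = S z1 (S z2 x);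
  hol_holomorphic : holomorphic_on (sector delta) S;
  hol_cont : forall x delta', 0 < delta' < delta ->
    filterlim (fun z => S z x)
      (within (closed_sector delta') (locally (RtoC 0))) (locally x);
  hol_bound : forall delta', 0 < delta' < delta ->
    exists B : R, forall z, closed_sector delta' z -> Rbar_le (op_norm (S z)) B }.

(* Main.v *)
(** Passing to the equivalent norm [N x = sup_t ||T(t) x||] makes [T] a contraction
    semigroup without changing [K].  For a small step [h], let [V = (1 - r) + r T(h)]
    with [0 < r <= 1/2].  Choosing a power of [V] that rotates a given point of the unit
    circle close to [zeta], the hypothesis becomes [N((e^{i phi} - V) x) >= kappa |phi| N x]
    for all [|phi| <= pi], with [kappa] of order [1 / K]; away from [phi = 0] this already
    holds because averaging with the identity pushes the spectrum inside the unit circle.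

    A discrete Fourier transform of [j |-> V^j x], cut off by a binomial bump of order
    [m + 2], summed by parts with this bound, gives
    [N((V - 1)^m V^l x) <= C (m / kappa) (C m / (kappa l))^m N x].  Hence, by the binomial
    theorem, [(V + theta (V - 1))^n] is bounded by [C / kappa] as soon as
    [|theta| <= c kappa].  These operators are the Euler approximations
    [(1 + z A_h / n)^n], [A_h = (T(h) - 1) / h], for [z] in a sector of angle of order
    [kappa]; they converge strongly, and the limit is the holomorphic extension. *)
Require Import Defs.
From Stdlib Require Import Reals Lra Lia List Psatz Arith Compare_dec.
From Coquelicot Require Import Coquelicot.
Open Scope R_scope.
Set Bullet Behavior "Strict Subproofs".

(** * Linear combinations in a complex module *)

(** Averaging is forced: powers of a point far from [1], such as a root of unity, need never
    approach [zeta], so rotation only works near [1]. The free weight [r] also makes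
    [V = 1 + r h A_h] itself an Euler step, so that a step in a complex direction has the form
    [V + theta (V - 1)].

    The lower bound degenerates at [phi = 0], so low frequencies cannot be inverted; there the
    smallness comes from [(V - 1)^m] itself, and the number of such frequencies, of order
    [m / kappa], is the factor in front. The two orders of the bump beyond [m] make the other
    frequencies summable like [1 / k^2]. The growth [m^m] is compensated by the [m!] in the binomial
    coefficient, which leaves a geometric series in [theta / kappa] and so fixes the angle.

    Up to the final limit everything is a finite sum: difference quotients stand for the generator
    and dyadic means for integrals. The bound obtained is a multiple of [M K]; the logarithmic
    factor enters only through a positive lower bound, available because a nonzero [X] forces
    [K >= 1/2]. *)

Inductive lincomb : Type :=
| LVar (n : nat)
| LZero
| LPlus (e f : lincomb)
| LOpp (e : lincomb)
| LScal (c : C) (e : lincomb).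

(* Monomorphic copies of the operations of [X]: the generic ones reach [X] along
   several convertible but syntactically different structure paths. *)
Section Operations.
Context {X : NormedModule C_AbsRing}.

Definition vzero : X := zero.
Definition vplus (x y : X) : X := plus x y.
Definition vopp (x : X) : X := opp x.
Definition vminus (x y : X) : X := minus x y.
Definition vscal (c : C) (x : X) : X := scal c x.
Definition vsum (u : nat -> X) (n : nat) : X := sum_n u n.

Fixpoint lc_eval (env : nat -> X) (e : lincomb) : X :=
  match e with
  | LVar n => env n
  | LZero => vzero
  | LPlus e f => vplus (lc_eval env e) (lc_eval env f)
  | LOpp e => vopp (lc_eval env e)
  | LScal c e => vscal c (lc_eval env e)
  end.

Fixpoint lc_coef (e : lincomb) (i : nat) : C :=
  match e with
  | LVar n => if Nat.eqb n i then RtoC 1 else RtoC 0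
  | LZero => RtoC 0
  | LPlus e f => (lc_coef e i + lc_coef f i)%C
  | LOpp e => (- lc_coef e i)%C
  | LScal c e => (c * lc_coef e i)%C
  end.

Fixpoint lc_bounded (e : lincomb) (N : nat) : bool :=
  match e with
  | LVar n => Nat.leb n N
  | LZero => true
  | LPlus e f => andb (lc_bounded e N) (lc_bounded f N)
  | LOpp e => lc_bounded e N
  | LScal c e => lc_bounded e N
  end.

Lemma vsum_0 (u : nat -> X) : vsum u 0 = u 0%nat.
Proof. exact (sum_O u). Qed.

Lemma vsum_S (u : nat -> X) n : vsum u (S n) = vplus (vsum u n) (u (S n)).
Proof. exact (sum_Sn u n). Qed.

Lemma scal_zero_C (x : X) : scal (RtoC 0) x = zero.
Proof. exact (scal_zero_l (K := C_Ring) x). Qed.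

Lemma scal_one_C (x : X) : scal (RtoC 1) x = x.
Proof. exact (scal_one (K := C_Ring) x). Qed.

Lemma scal_plus_C (a b : C) (x : X) : scal (a + b)%C x = plus (scal a x) (scal b x).
Proof. exact (scal_distr_r (K := C_Ring) a b x). Qed.

Lemma scal_mult_C (a b : C) (x : X) : scal (a * b)%C x = scal a (scal b x).
Proof. symmetry. exact (scal_assoc (K := C_Ring) a b x). Qed.

Lemma scal_opp_C (a : C) (x : X) : scal (- a)%C x = opp (scal a x).
Proof. exact (scal_opp_l (K := C_Ring) a x). Qed.

Lemma lc_eval_coef (env : nat -> X) (e : lincomb) (N : nat) :
  lc_bounded e N = true ->
  lc_eval env e = sum_n (fun i => scal (lc_coef e i) (env i)) N.
Proof.
induction e as [n | | e IHe f IHf | e IHe | c e IHe]; simpl; intros H;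
  unfold vzero, vplus, vopp, vscal.
- apply Nat.leb_le in H.
  induction N as [|N IHN].
  + assert (n = 0)%nat by lia; subst n. rewrite sum_O; simpl. now rewrite scal_one_C.
  + rewrite sum_Sn. destruct (Nat.eq_dec n (S N)) as [-> | Hn].
    * rewrite Nat.eqb_refl, scal_one_C.
      rewrite (sum_n_ext_loc _ (fun _ => zero)).
      -- unfold sum_n; rewrite sum_n_m_const_zero, plus_zero_l; reflexivity.
      -- intros k Hk. replace (S N =? k)%nat with false by (symmetry; apply Nat.eqb_neq; lia).
         apply scal_zero_C.
    * replace (n =? S N)%nat with false by (symmetry; apply Nat.eqb_neq; lia).
      rewrite scal_zero_C, plus_zero_r. apply IHN; lia.
- rewrite (sum_n_ext _ (fun _ => zero)).
  + unfold sum_n; rewrite sum_n_m_const_zero; reflexivity.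
  + intros; apply scal_zero_C.
- apply andb_prop in H. rewrite IHe, IHf by tauto. rewrite <- sum_n_plus.
  apply sum_n_ext; intros; now rewrite scal_plus_C.
- rewrite IHe by assumption.
  transitivity (scal (- RtoC 1)%C (sum_n (fun i => scal (lc_coef e i) (env i)) N)).
  + now rewrite scal_opp_C, scal_one_C.
  + rewrite <- sum_n_scal_l. apply sum_n_ext; intros k.
    change (scal (- RtoC 1)%C (scal (lc_coef e k) (env k)) = scal (- lc_coef e k)%C (env k)).
    rewrite <- scal_mult_C. f_equal. ring.
- rewrite IHe by assumption. rewrite <- sum_n_scal_l.
  apply sum_n_ext; intros k. now rewrite scal_mult_C.
Qed.

(** A recursive conjunction rather than a bounded quantifier, so that it computes to the finite list
    of coefficient identities handed to [ring]. *)
Fixpoint lc_agree (e f : lincomb) (N : nat) : Prop :=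
  match N with
  | O => lc_coef e 0 = lc_coef f 0
  | S N' => lc_coef e N = lc_coef f N /\ lc_agree e f N'
  end.

Lemma lc_correct (env : nat -> X) (e f : lincomb) (N : nat) :
  lc_bounded e N = true -> lc_bounded f N = true -> lc_agree e f N ->
  lc_eval env e = lc_eval env f.
Proof.
intros He Hf H. rewrite (lc_eval_coef env e N He), (lc_eval_coef env f N Hf).
clear He Hf. induction N as [|N IH]; simpl in H.
- rewrite !sum_O. now rewrite H.
- rewrite !sum_Sn. destruct H as [H1 H2]. now rewrite H1, IH.
Qed.

End Operations.

Ltac lc_index x l :=
  match l with
  | x :: _ => constr:(O)
  | _ :: ?l' => let n := lc_index x l' in constr:(S n)
  end.

Ltac lc_add x l :=
  match l with
  | context [ x :: _ ] => l
  | _ => constr:(x :: l)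
  end.

Ltac lc_atoms e l :=
  lazymatch e with
  | vplus ?a ?b => let l' := lc_atoms a l in lc_atoms b l'
  | vminus ?a ?b => let l' := lc_atoms a l in lc_atoms b l'
  | vopp ?a => lc_atoms a l
  | vscal _ ?a => lc_atoms a l
  | vzero => l
  | _ => lc_add e l
  end.

Ltac lc_reify e l :=
  lazymatch e with
  | vplus ?a ?b => let a' := lc_reify a l in let b' := lc_reify b l in constr:(LPlus a' b')
  | vminus ?a ?b => let a' := lc_reify a l in let b' := lc_reify b l in constr:(LPlus a' (LOpp b'))
  | vopp ?a => let a' := lc_reify a l in constr:(LOpp a')
  | vscal ?c ?a => let a' := lc_reify a l in constr:(LScal c a')
  | vzero => constr:(LZero)
  | _ => let n := lc_index e l in constr:(LVar n)
  end.

(* Reduces an identity between linear combinations to the identities between the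
   coefficients, and tries [ring] on these. *)
Ltac module_eq :=
  lazymatch goal with
  | |- @eq ?T ?a ?b =>
    let l := lc_atoms a (@nil T) in
    let l := lc_atoms b l in
    let l := lazymatch l with nil => constr:((vzero : T) :: nil) | _ => l end in
    let a' := lc_reify a l in
    let b' := lc_reify b l in
    let n := eval compute in (pred (length l)) in
    change (lc_eval (fun i => List.nth i l vzero) a' = lc_eval (fun i => List.nth i l vzero) b');
    apply (lc_correct _ a' b' n);
    [ reflexivity | reflexivity
    | cbv [lc_agree lc_coef Nat.eqb]; repeat split; try ring ]
  end.

(** * Binomial coefficients *)

(* Unlike [Binomial.C], this vanishes for [n < k]. *)
Fixpoint bin (n k : nat) : R :=
  match n, k with
  | _, O => 1
  | O, S _ => 0
  | S n', S k' => bin n' k' + bin n' k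
  end.

Lemma bin_0_r (n : nat) : bin n 0 = 1.
Proof. now destruct n. Qed.

Lemma bin_S_S (n k : nat) : bin (S n) (S k) = bin n k + bin n (S k).
Proof. reflexivity. Qed.

Lemma bin_ge_0 (n k : nat) : 0 <= bin n k.
Proof.
revert k; induction n as [|n IH]; intros [|k]; simpl; try lra.
generalize (IH k), (IH (S k)); lra.
Qed.

Lemma bin_gt (n k : nat) : (n < k)%nat -> bin n k = 0.
Proof.
revert k; induction n as [|n IH]; intros [|k] H; try lia; [reflexivity|].
rewrite bin_S_S, !IH by lia. ring.
Qed.

Lemma bin_pos (n k : nat) : (k <= n)%nat -> 0 < bin n k.
Proof.
revert k; induction n as [|n IH]; intros [|k] H; try (simpl; lra); try lia.
rewrite bin_S_S. generalize (IH k ltac:(lia)), (bin_ge_0 n (S k)); lra.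
Qed.

Lemma bin_absorb (n k : nat) : INR (S k) * bin (S n) (S k) = INR (S n) * bin n k.
Proof.
revert k; induction n as [|n IH]; intros [|k].
- simpl; ring.
- rewrite bin_S_S, !bin_gt by lia. ring.
- rewrite bin_S_S, bin_0_r. generalize (IH 0%nat).
  rewrite bin_0_r. rewrite !S_INR. simpl INR. lra.
- rewrite bin_S_S, Rmult_plus_distr_l, IH.
  generalize (IH k). rewrite (bin_S_S n k), !S_INR. lra.
Qed.

Lemma bin_falling (n k : nat) : INR (S k) * bin n (S k) = (INR n - INR k) * bin n k.
Proof.
generalize (bin_absorb n k). rewrite bin_S_S, !S_INR. lra.
Qed.

Lemma bin_hockey_stick (n b : nat) : sum_n (fun i => bin (n - i) b) n = bin (S n) (S b).
Proof.
induction n as [|n IH].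
- rewrite sum_O; simpl. destruct b; ring.
- unfold sum_n in *. rewrite sum_Sn_m by lia. rewrite <- sum_n_m_S.
  change (sum_n_m (fun k => bin (S n - S k) b) 0 n) with (sum_n_m (fun k => bin (n - k) b) 0 n).
  rewrite IH. change (bin (S n - 0) b + bin (S n) (S b) = bin (S (S n)) (S b)).
  rewrite Nat.sub_0_r. now rewrite (bin_S_S (S n) b).
Qed.

(** The upper-index form of Vandermonde's identity. It gives the total mass of the bump
    [j |-> bin j a * bin (n - j) b] used for smoothing. *)
Lemma bin_vandermonde (n a b : nat) :
  sum_n (fun j => bin j a * bin (n - j) b) n = bin (S n) (S (a + b)).
Proof.
revert a; induction n as [|n IH]; intros a.
- rewrite sum_O, Nat.sub_diag. destruct a, b; simpl; ring.
- destruct a as [|a].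
  + change (0 + b)%nat with b. rewrite <- (bin_hockey_stick (S n) b). apply sum_n_ext; intros j.
    rewrite bin_0_r; apply Rmult_1_l.
  + unfold sum_n. rewrite sum_Sn_m by lia. rewrite <- sum_n_m_S.
    rewrite (sum_n_m_ext _ (fun j => plus (bin j a * bin (n - j) b) (bin j (S a) * bin (n - j) b))).
    2:{ intros j. rewrite bin_S_S.
        change (S n - S j)%nat with (n - j)%nat.
        change plus with Rplus. simpl. ring. }
    rewrite sum_n_m_plus. fold (sum_n (fun j => bin j a * bin (n - j) b) n).
    fold (sum_n (fun j => bin j (S a) * bin (n - j) b) n).
    rewrite !IH. change plus with Rplus. rewrite (bin_S_S (S n)).
    simpl (S a + b)%nat. rewrite (bin_gt 0 (S a)) by lia. simpl; ring.
Qed.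

(** Log-concavity in the upper index: up to a common factor, passing from [k] to [k + 1] multiplies
    the two sides by [u^2 - i^2] and [u^2], with [u = l - k]. *)
Lemma bin_middle (l i k : nat) :
  (i <= l)%nat -> bin (l - i) k * bin (l + i) k <= bin l k * bin l k.
Proof.
intros Hi; induction k as [|k IH].
- rewrite !bin_0_r; lra.
- destruct (le_lt_dec (l - i) k) as [H|H].
  { rewrite (bin_gt (l - i)) by lia. rewrite Rmult_0_l. apply Rmult_le_pos; apply bin_ge_0. }
  apply Rmult_le_reg_l with (INR (S k) * INR (S k)).
  { apply Rmult_lt_0_compat; apply lt_0_INR; lia. }
  replace (INR (S k) * INR (S k) * (bin (l - i) (S k) * bin (l + i) (S k)))
    with ((INR (S k) * bin (l - i) (S k)) * (INR (S k) * bin (l + i) (S k))) by ring.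
  replace (INR (S k) * INR (S k) * (bin l (S k) * bin l (S k)))
    with ((INR (S k) * bin l (S k)) * (INR (S k) * bin l (S k))) by ring.
  rewrite !bin_falling, plus_INR, minus_INR by lia.
  assert (H1 : INR i + INR k < INR l).
  { rewrite <- plus_INR. apply lt_INR; lia. }
  generalize (pos_INR i), (pos_INR k); intros Hi0 Hk0.
  set (u := INR l - INR k).
  replace ((INR l - INR i - INR k) * bin (l - i) k * ((INR l + INR i - INR k) * bin (l + i) k))
    with ((u * u - INR i * INR i) * (bin (l - i) k * bin (l + i) k)) by (unfold u; ring).
  replace (u * bin l k * (u * bin l k)) with ((u * u) * (bin l k * bin l k)) by ring.
  assert (INR i < u) by (unfold u; lra).
  apply Rmult_le_compat; try nra.
  apply Rmult_le_pos; apply bin_ge_0.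
Qed.

Lemma sum_n_le (u v : nat -> R) (n : nat) :
  (forall k, (k <= n)%nat -> u k <= v k) -> sum_n u n <= sum_n v n.
Proof.
induction n as [|n IH]; intros H.
- rewrite !sum_O; apply H; lia.
- rewrite !sum_Sn. apply Rplus_le_compat; [apply IH; intros; apply H; lia | apply H; lia].
Qed.

(** The mass of a symmetric bump is at most its number of points times its central value. In the
    Fourier inversion the mass therefore cancels against the central value, and no power of [l] is
    lost. *)
Lemma bin_odd_le (l k : nat) :
  bin (S (2 * l)) (S (2 * k)) <= INR (S (2 * l)) * (bin l k * bin l k).
Proof.
replace (2 * k)%nat with (k + k)%nat by lia.
rewrite <- bin_vandermonde.
replace (INR (S (2 * l)) * (bin l k * bin l k)) with (sum_n (fun _ => bin l k * bin l k) (2 * l))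
  by (rewrite sum_n_const; reflexivity).
apply sum_n_le; intros j Hj.
destruct (le_lt_dec j l).
- replace j with (l - (l - j))%nat at 1 by lia.
  replace (2 * l - j)%nat with (l + (l - j))%nat by lia. apply bin_middle; lia.
- rewrite Rmult_comm.
  replace j with (l + (j - l))%nat at 2 by lia.
  replace (2 * l - j)%nat with (l - (j - l))%nat by lia. apply bin_middle; lia.
Qed.

Lemma bin_le_pow (n m : nat) : INR (fact m) * bin n m <= INR n ^ m.
Proof.
induction m as [|m IH].
- rewrite bin_0_r; simpl; lra.
- change (fact (S m)) with (S m * fact m)%nat. rewrite mult_INR.
  replace (INR (S m) * INR (fact m) * bin n (S m))
    with (INR (fact m) * (INR (S m) * bin n (S m))) by ring.
  rewrite bin_falling. simpl pow.
  replace (INR (fact m) * ((INR n - INR m) * bin n m))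
    with ((INR n - INR m) * (INR (fact m) * bin n m)) by ring.
  apply Rle_trans with (INR n * (INR (fact m) * bin n m)).
  + apply Rmult_le_compat_r.
    * apply Rmult_le_pos; [apply pos_INR | apply bin_ge_0].
    * generalize (pos_INR m); lra.
  + apply Rmult_le_compat_l; [apply pos_INR | exact IH].
Qed.

(** * Points of the unit circle *)

Definition cis (t : R) : C := (cos t, sin t).

Lemma cis_plus (a b : R) : cis (a + b) = (cis a * cis b)%C.
Proof. unfold cis, Cmult; simpl. rewrite cos_plus, sin_plus. f_equal; ring. Qed.

Lemma cis_0 : cis 0 = RtoC 1.
Proof. unfold cis. now rewrite cos_0, sin_0. Qed.

Lemma Cmod_cis (t : R) : Cmod (cis t) = 1.
Proof.
unfold Cmod, cis; simpl. transitivity (sqrt 1); [f_equal | apply sqrt_1].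
generalize (sin2_cos2 t); unfold Rsqr; lra.
Qed.

Lemma cis_pow (t : R) (n : nat) : (cis t ^ n)%C = cis (INR n * t).
Proof.
induction n as [|n IH].
- simpl. now rewrite Rmult_0_l, cis_0.
- rewrite Cpow_S, IH, <- cis_plus, S_INR. f_equal; ring.
Qed.

Lemma Cmod_le_add (x y : R) : Cmod (x, y) <= Rabs x + Rabs y.
Proof.
replace (x, y) with (RtoC x + RtoC y * Ci)%C.
- eapply Rle_trans; [apply Cmod_triangle|].
  rewrite Cmod_mult, !Cmod_R.
  replace (Cmod Ci) with 1; [lra|].
  unfold Cmod, Ci; simpl. transitivity (sqrt 1); [symmetry; apply sqrt_1 | f_equal; ring].
- unfold RtoC, Ci, Cplus, Cmult; simpl; f_equal; ring.
Qed.

Lemma Cmod_cis_minus_1 (t : R) : Cmod (cis t - RtoC 1) ^ 2 = 2 * (1 - cos t).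
Proof.
rewrite Cmod2_alt. unfold cis; simpl.
generalize (sin2_cos2 t); unfold Rsqr; nra.
Qed.

Lemma one_minus_cos (t : R) : 1 - cos t = 2 * sin (t / 2) ^ 2.
Proof.
replace t with (2 * (t / 2)) at 1 by field. rewrite cos_2a_sin. ring.
Qed.

Lemma Rabs_sin_le (t : R) : Rabs (sin t) <= Rabs t.
Proof.
assert (Hp : forall u, 0 <= u -> Rabs (sin u) <= u).
{ intros u Hu. destruct (Req_dec u 0) as [->|H0].
  - rewrite sin_0, Rabs_R0; lra.
  - destruct (Rle_dec u 1) as [H1|H1].
    + assert (sin u < u) by (apply sin_lt_x; lra).
      assert (0 <= sin u).
      { apply sin_ge_0; generalize PI_RGT_0, PI2_1; lra. }
      rewrite Rabs_pos_eq; lra.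
    + generalize (SIN_bound u); intros; apply Rabs_le; lra. }
destruct (Rle_dec 0 t).
- rewrite (Rabs_pos_eq t) by lra. now apply Hp.
- rewrite <- (Rabs_Ropp t), <- (Rabs_Ropp (sin t)), <- sin_neg.
  rewrite (Rabs_pos_eq (- t)) by lra. apply Hp; lra.
Qed.

Lemma Rabs_sqr_le (a b : R) : Rabs a <= Rabs b -> a ^ 2 <= b ^ 2.
Proof. intros H. rewrite <- (pow2_abs a), <- (pow2_abs b). generalize (Rabs_pos a); nra. Qed.

Lemma Cmod_cis_minus_1_le (t : R) : Cmod (cis t - RtoC 1) <= Rabs t.
Proof.
apply Rsqr_incr_0_var; [|apply Rabs_pos].
rewrite <- Rsqr_abs. rewrite !Rsqr_pow2, Cmod_cis_minus_1, one_minus_cos.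
generalize (Rabs_sqr_le _ _ (Rabs_sin_le (t / 2))). nra.
Qed.

Lemma Cmod_cis_minus (a b : R) : Cmod (cis a - cis b) <= Rabs (a - b).
Proof.
replace (cis a - cis b)%C with (cis b * (cis (a - b) - 1))%C.
- rewrite Cmod_mult, Cmod_cis, Rmult_1_l. apply Cmod_cis_minus_1_le.
- replace a with (b + (a - b)) at 2 by ring. rewrite cis_plus. ring.
Qed.

Lemma Rabs_sin_minus_id (t : R) : Rabs (sin t - t) <= t ^ 2 / 2.
Proof.
assert (Hp : forall u, 0 <= u -> Rabs (sin u - u) <= u ^ 2 / 2).
{ intros u Hu. destruct (Req_dec u 0) as [->|H0].
  { rewrite sin_0, Rminus_0_r, Rabs_R0; lra. }
  assert (sin u < u) by (apply sin_lt_x; lra).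
  rewrite Rabs_left by lra.
  destruct (Rle_dec u 3) as [H2|H2].
  - generalize (sin_bound u 0). unfold sin_approx, sin_term; simpl. intros Hb.
    destruct (Hb Hu) as [Hb1 _]; [generalize PI2_3_2; lra|].
    assert (0 <= (3 - u) * (u * u)) by (apply Rmult_le_pos; nra). nra.
  - generalize (SIN_bound u). nra. }
destruct (Rle_dec 0 t); [now apply Hp|].
rewrite <- Rabs_Ropp. replace (- (sin t - t)) with (sin (- t) - - t) by (rewrite sin_neg; ring).
replace (t ^ 2) with ((- t) ^ 2) by ring. apply Hp; lra.
Qed.

Lemma Cmod_cis_taylor (t : R) : Cmod (cis t - (1, t)) <= t ^ 2.
Proof.
replace (cis t - (1, t))%C with (cos t - 1, sin t - t)
  by (unfold cis, Cminus, Cplus, Copp; simpl; f_equal; ring).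
eapply Rle_trans; [apply Cmod_le_add|].
generalize (Rabs_sin_minus_id t). intros.
assert (Rabs (cos t - 1) <= t ^ 2 / 2); [|lra].
rewrite Rabs_minus_sym, one_minus_cos, Rabs_pos_eq by nra.
generalize (Rabs_sqr_le _ _ (Rabs_sin_le (t / 2))). nra.
Qed.

(** From [sin u >= u - u^3 / 6 >= u / 3] on [[0, 2]], used at [u = |t| / 2], which is at most
    [PI / 2]. *)
Lemma one_minus_cos_ge (t : R) : Rabs t <= PI -> t ^ 2 / 18 <= 1 - cos t.
Proof.
intros Ht.
assert (Hp : forall u, 0 <= u -> u <= 2 -> u / 3 <= sin u).
{ intros u Hu Hu2. generalize (sin_bound u 0). unfold sin_approx, sin_term; simpl. intros Hb.
  destruct (Hb Hu) as [Hb1 _]; [generalize PI2_3_2; lra|].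
  assert (0 <= (2 - u) * ((2 + u) * u)) by (apply Rmult_le_pos; nra). lra. }
rewrite one_minus_cos.
assert (Hs : Rabs (t / 2) / 3 <= Rabs (sin (t / 2))).
{ unfold Rabs in Ht.
  destruct (Rle_dec 0 t) as [H0|H0].
  - destruct (Rcase_abs t); [lra|]. rewrite (Rabs_pos_eq (t / 2)) by lra.
    eapply Rle_trans; [|apply Rle_abs]. apply Hp; generalize PI_4; lra.
  - destruct (Rcase_abs t); [|lra]. rewrite (Rabs_left (t / 2)) by lra.
    rewrite <- Rabs_Ropp, <- sin_neg.
    eapply Rle_trans; [|apply Rle_abs]. apply Hp; generalize PI_4; lra. }
assert (Rabs (t / 2 / 3) <= Rabs (sin (t / 2))).
{ unfold Rdiv at 1. rewrite Rabs_mult, (Rabs_pos_eq (/ 3)) by lra. exact Hs. }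
generalize (Rabs_sqr_le _ _ H). nra.
Qed.

Lemma one_plus_pow_le_exp (u : R) (k : nat) : 0 <= u -> (1 + u) ^ k <= exp (INR k * u).
Proof.
intros Hu. induction k as [|k IH].
- simpl. rewrite Rmult_0_l, exp_0. lra.
- rewrite S_INR, Rmult_plus_distr_r, Rmult_1_l, exp_plus, Rmult_comm. simpl.
  rewrite Rmult_comm. rewrite (Rmult_comm (exp _)). 
  apply Rmult_le_compat; try lra.
  + apply pow_le; lra.
  + apply exp_ineq1_le.
Qed.

Lemma Cmod_pow_minus (a b : C) (q : R) (k : nat) :
  1 <= q -> Cmod a <= q -> Cmod b <= 1 ->
  Cmod (a ^ k - b ^ k) <= INR k * q ^ k * Cmod (a - b).
Proof.
intros Hq Ha Hb. induction k as [|k IH].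
- simpl. replace (1 - 1)%C with (RtoC 0) by ring. rewrite Cmod_0. lra.
- replace (a ^ S k - b ^ S k)%C with (a ^ k * (a - b) + b * (a ^ k - b ^ k))%C
    by (rewrite !Cpow_S; ring).
  eapply Rle_trans; [apply Cmod_triangle|]. rewrite !Cmod_mult, Cmod_pow, S_INR.
  assert (H1 : Cmod a ^ k <= q ^ k) by (apply pow_incr; split; [apply Cmod_ge_0 | easy]).
  assert (H2 : 1 <= q ^ k) by (now apply pow_R1_Rle).
  generalize (Cmod_ge_0 (a - b)) (Cmod_ge_0 (a ^ k - b ^ k)) (Cmod_ge_0 b) (pos_INR k). intros.
  apply Rle_trans with (q ^ k * Cmod (a - b) + INR k * q ^ k * Cmod (a - b)).
  + apply Rplus_le_compat; [nra|]. nra.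
  + simpl. apply Rle_trans with ((INR k + 1) * q ^ k * Cmod (a - b)); [lra|].
    apply Rmult_le_compat_r; [easy|]. apply Rmult_le_compat_l; [lra|]. nra.
Qed.

(** The angle is measured in the direction [s], so that a nonnegative number of steps in that
    direction reaches [z] within one turn. *)
Lemma unit_circle_angle (z : C) (s : R) :
  Cmod z = 1 -> s = 1 \/ s = -1 -> exists th, 0 <= th <= 2 * PI /\ z = cis (s * th).
Proof.
intros Hz Hs.
assert (Hz0 : z <> RtoC 0) by (intros ->; rewrite Cmod_0 in Hz; lra).
assert (Hp := Carg_polar z Hz0). rewrite Hz, !Rmult_1_l in Hp.
generalize (Carg_bound z) PI_RGT_0; intros Hb HPI.
destruct (Rle_dec 0 (s * Carg z)) as [H|H].
- exists (s * Carg z). split; [destruct Hs; subst s; lra|].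
  replace (s * (s * Carg z)) with (Carg z) by (destruct Hs; subst s; ring). exact Hp.
- exists (s * Carg z + 2 * PI). split; [destruct Hs; subst s; lra|].
  destruct Hs; subst s.
  + replace (1 * (1 * Carg z + 2 * PI)) with (Carg z + 2 * PI) by ring.
    unfold cis. now rewrite cos_plus, sin_plus, cos_2PI, sin_2PI, !Rmult_1_r, !Rmult_0_r,
      Rminus_0_r, Rplus_0_r.
  + replace (-1 * (-1 * Carg z + 2 * PI)) with (Carg z - 2 * PI) by ring.
    unfold cis. now rewrite cos_minus, sin_minus, cos_2PI, sin_2PI, !Rmult_1_r, !Rmult_0_r,
      Rminus_0_r, Rplus_0_r.
Qed.

(** * Linear maps and seminorms *)

Record linear_map {X : NormedModule C_AbsRing} (A : X -> X) : Prop := {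
  lin_plus : forall x y, A (vplus x y) = vplus (A x) (A y);
  lin_scal : forall c x, A (vscal c x) = vscal c (A x) }.

Record seminorm {X : NormedModule C_AbsRing} (N : X -> R) : Prop := {
  sn_triangle : forall x y, N (vplus x y) <= N x + N y;
  sn_scal : forall c x, N (vscal c x) = Cmod c * N x }.

Definition contraction {X : NormedModule C_AbsRing} (N : X -> R) (A : X -> X) : Prop :=
  forall x, N (A x) <= N x.

Section Linear.
Context {X : NormedModule C_AbsRing}.
Implicit Types (A B : X -> X) (x y : X).

Lemma lin_zero A : linear_map A -> A vzero = vzero.
Proof.
intros H. transitivity (A (vscal (RtoC 0) vzero)).
- f_equal. module_eq.
- rewrite (lin_scal A H). module_eq.
Qed.

Lemma lin_opp A x : linear_map A -> A (vopp x) = vopp (A x).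
Proof.
intros H. transitivity (A (vscal (- RtoC 1)%C x)).
- f_equal. module_eq.
- rewrite (lin_scal A H). module_eq.
Qed.

Lemma lin_minus A x y : linear_map A -> A (vminus x y) = vminus (A x) (A y).
Proof.
intros H. transitivity (A (vplus x (vopp y))).
- reflexivity.
- rewrite (lin_plus A H), lin_opp by assumption. reflexivity.
Qed.

Lemma lin_sum A (u : nat -> X) n :
  linear_map A -> A (vsum u n) = vsum (fun k => A (u k)) n.
Proof.
intros H; induction n as [|n IH].
- now rewrite !vsum_0.
- rewrite !vsum_S. now rewrite (lin_plus A H), IH.
Qed.

Lemma lin_comb A B (a b : C) :
  linear_map A -> linear_map B -> linear_map (fun x => vplus (vscal a (A x)) (vscal b (B x))).
Proof.
intros HA HB; split; intros.
- rewrite (lin_plus A HA), (lin_plus B HB). module_eq.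
- rewrite (lin_scal A HA), (lin_scal B HB). module_eq.
Qed.

Lemma lin_id : linear_map (fun x : X => x).
Proof. now split. Qed.

Lemma lin_comp A B : linear_map A -> linear_map B -> linear_map (fun x => A (B x)).
Proof.
intros HA HB; split; intros.
- now rewrite (lin_plus B HB), (lin_plus A HA).
- now rewrite (lin_scal B HB), (lin_scal A HA).
Qed.

Lemma lin_iter A n : linear_map A -> linear_map (Nat.iter n A).
Proof.
intros H; induction n as [|n IH]; [apply lin_id|]. exact (lin_comp A _ H IH).
Qed.

Lemma iter_comm A B n x :
  (forall y, A (B y) = B (A y)) -> Nat.iter n A (B x) = B (Nat.iter n A x).
Proof. intros H; induction n as [|n IH]; simpl; [easy|]. now rewrite IH, H. Qed.

Lemma iter_S_r A n x : Nat.iter n A (A x) = A (Nat.iter n A x).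
Proof. apply iter_comm; reflexivity. Qed.

Context {N : X -> R} (HN : seminorm N).

Lemma sn_zero : N vzero = 0.
Proof. transitivity (N (vscal (RtoC 0) vzero)).
- f_equal. module_eq.
- rewrite (sn_scal N HN), Cmod_0. ring. Qed.

Lemma sn_opp x : N (vopp x) = N x.
Proof.
transitivity (N (vscal (- RtoC 1)%C x)).
- f_equal. module_eq.
- rewrite (sn_scal N HN), Cmod_opp, Cmod_1. ring.
Qed.

Lemma sn_ge_0 x : 0 <= N x.
Proof.
generalize (sn_triangle N HN x (vopp x)).
replace (vplus x (vopp x)) with (vzero : X) by module_eq.
rewrite sn_zero, sn_opp. lra.
Qed.

Lemma sn_minus x y : N (vminus x y) <= N x + N y.
Proof.
replace (vminus x y) with (vplus x (vopp y)) by module_eq.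
rewrite <- (sn_opp y). apply (sn_triangle N HN).
Qed.

Lemma sn_minus_sym x y : N (vminus x y) = N (vminus y x).
Proof. rewrite <- (sn_opp (vminus y x)). f_equal. module_eq. Qed.

Lemma sn_minus_trans x y z : N (vminus x z) <= N (vminus x y) + N (vminus y z).
Proof.
replace (vminus x z) with (vplus (vminus x y) (vminus y z)) by module_eq.
apply (sn_triangle N HN).
Qed.

Lemma sn_le_minus x y : N x <= N y + N (vminus x y).
Proof.
replace x with (vplus y (vminus x y)) at 1 by module_eq. apply (sn_triangle N HN).
Qed.

Lemma sn_sum (u : nat -> X) n : N (vsum u n) <= sum_n (fun k => N (u k)) n.
Proof.
induction n as [|n IH].
- rewrite vsum_0, sum_O; lra.
- rewrite vsum_S, sum_Sn. eapply Rle_trans; [apply (sn_triangle N HN)|].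
  apply Rplus_le_compat_r, IH.
Qed.

Lemma contraction_iter A n : contraction N A -> contraction N (Nat.iter n A).
Proof.
intros H x. induction n as [|n IH]; simpl; [lra|]. eapply Rle_trans; [apply H|apply IH].
Qed.

(** Bounds [(w^k - A^k) x] by its factor [(w - A) x], so that a lower bound for the former passes to
    the latter. The point [w] may lie slightly outside the unit circle, hence [q]. *)
Lemma sn_pow_minus A (w : C) (q : R) k x :
  linear_map A -> contraction N A -> 1 <= q -> Cmod w <= q ->
  N (vminus (vscal (w ^ k)%C x) (Nat.iter k A x)) <= INR k * q ^ k * N (vminus (vscal w x) (A x)).
Proof.
intros HA Hc Hq Hw. revert x; induction k as [|k IH]; intros x.
- simpl. replace (vminus (vscal (RtoC 1) x) x) with (vzero : X) by module_eq.
  rewrite sn_zero. lra.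
- replace (vminus (vscal (w ^ S k)%C x) (Nat.iter (S k) A x))
    with (vplus (vscal (w ^ k)%C (vminus (vscal w x) (A x)))
               (vminus (vscal (w ^ k)%C (A x)) (Nat.iter k A (A x)))).
  2:{ rewrite iter_S_r. simpl Nat.iter. rewrite Cpow_S. module_eq. }
  eapply Rle_trans; [apply (sn_triangle N HN)|].
  eapply Rle_trans; [apply Rplus_le_compat_l, IH|].
  assert (H1 : N (vminus (vscal w (A x)) (A (A x))) <= N (vminus (vscal w x) (A x))).
  { rewrite <- (lin_scal A HA), <- lin_minus by assumption. apply Hc. }
  rewrite (sn_scal N HN), Cmod_pow, S_INR.
  assert (H2 : Cmod w ^ k <= q ^ k) by (apply pow_incr; split; [apply Cmod_ge_0 | easy]).
  assert (H3 : 1 <= q ^ k) by (now apply pow_R1_Rle).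
  generalize (sn_ge_0 (vminus (vscal w x) (A x))) (pos_INR k). intros H4 H5.
  apply Rle_trans with ((INR k + 1) * q ^ k * N (vminus (vscal w x) (A x))).
  + assert (INR k * q ^ k * N (vminus (vscal w (A x)) (A (A x)))
            <= INR k * q ^ k * N (vminus (vscal w x) (A x))).
    { apply Rmult_le_compat_l; [|easy]. apply Rmult_le_pos; lra. }
    nra.
  + simpl. apply Rmult_le_compat_r; [easy|]. apply Rmult_le_compat_l; [lra|]. nra.
Qed.

End Linear.

(** * Lower bounds on the unit circle for an averaged contraction *)

Section LowerBound.
Context {X : NormedModule C_AbsRing} {N : X -> R} (HN : seminorm N).
Context {U : X -> X} (HU : linear_map U) (HcU : contraction N U).

Lemma lower_bound_trivial (w : C) (x : X) :
  (Cmod w - 1) * N x <= N (vminus (vscal w x) (U x)).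
Proof.
generalize (sn_le_minus HN (vscal w x) (U x)) (HcU x). rewrite (sn_scal N HN). lra.
Qed.

(* If [w ^ k] is close to [zeta] for some [k] of order [1 / y], then the bound for
   [zeta - U ^ k] yields one for its factor [w - U]. *)
Lemma lower_bound_small_angle (zeta w : C) (K y s : R) (x : X) :
  0 < K -> / 2 <= K -> Cmod zeta = 1 -> s = 1 \/ s = -1 ->
  (forall k z, (1 <= k)%nat -> N z / K <= N (vminus (vscal zeta z) (Nat.iter k U z))) ->
  0 < y -> y <= / (110 * K) ->
  Cmod (w - cis (s * y)) <= 2 * y ^ 2 ->
  y / (54 * K) * N x <= N (vminus (vscal w x) (U x)).
Proof.
intros HK HK2 Hz Hs Hlow Hy0 Hy Hw.
destruct (unit_circle_angle zeta s Hz Hs) as (th & Hth & Hzeta).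
assert (HyK : y * (110 * K) <= 1).
{ apply Rmult_le_reg_r with (/ (110 * K)).
  - apply Rinv_0_lt_compat; lra.
  - rewrite Rmult_assoc, Rinv_r, Rmult_1_r, Rmult_1_l by lra. exact Hy. }
assert (Hy55 : 55 * y <= 1) by nra.
(* Rounding up to [k0 + 1] keeps the exponent positive even for [th = 0], as the hypothesis
   requires, and [k * y] overshoots [th] by at most [y]. *)
destruct (nfloor_ex (th / y)) as [k0 Hk0].
{ apply Rle_div_r; lra. }
set (k := S k0).
assert (Hk1 : th <= INR k * y <= th + y).
{ unfold k. rewrite S_INR. destruct Hk0 as [Ha Hb].
  apply Rle_div_r in Ha; [|lra]. apply Rlt_div_l in Hb; [|lra]. lra. }
assert (Hk9 : INR k * y <= 9) by (generalize PI_4; lra).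
set (q := 1 + 2 * y ^ 2).
assert (Hq : 1 <= q) by (unfold q; nra).
assert (Hwq : Cmod w <= q).
{ replace w with (cis (s * y) + (w - cis (s * y)))%C by ring.
  eapply Rle_trans; [apply Cmod_triangle|]. rewrite Cmod_cis. unfold q; lra. }
assert (Hqk : q ^ k <= 3).
{ unfold q. eapply Rle_trans; [apply one_plus_pow_le_exp; nra|].
  eapply Rle_trans; [|apply exp_le_3].
  destruct (Rle_lt_or_eq_dec (INR k * (2 * y ^ 2)) 1) as [H|H]; [nra| |].
  - left; now apply exp_increasing.
  - rewrite H; lra. }
assert (Hq0 : 0 <= q ^ k) by (apply pow_le; lra).
(* The part [54 y] is [k * q^k * 2 y^2] with [k y <= 9] and [q^k <= 3]; the last [y] is the rounding
   error. The threshold [1 / (110 K)] keeps the sum below [1 / (2 K)], half of the given lower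
   bound. *)
assert (Hpow : Cmod (w ^ k - zeta) <= 55 * y).
{ replace (w ^ k - zeta)%C with ((w ^ k - cis (s * y) ^ k) + (cis (s * y) ^ k - zeta))%C by ring.
  eapply Rle_trans; [apply Cmod_triangle|].
  replace (55 * y) with (54 * y + y) by ring. apply Rplus_le_compat.
  - eapply Rle_trans; [apply (Cmod_pow_minus _ _ q)|]; try assumption.
    { rewrite Cmod_cis; lra. }
    apply Rle_trans with (INR k * 3 * (2 * y ^ 2)).
    + apply Rmult_le_compat; try easy.
      * apply Rmult_le_pos; [apply pos_INR | easy].
      * apply Cmod_ge_0.
      * apply Rmult_le_compat_l; [apply pos_INR | easy].
    + nra.
  - rewrite cis_pow, Hzeta. eapply Rle_trans; [apply Cmod_cis_minus|].
    replace (INR k * (s * y) - s * th) with (s * (INR k * y - th)) by ring.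
    rewrite Rabs_mult, (Rabs_pos_eq (INR k * y - th)) by lra.
    replace (Rabs s) with 1; [lra|].
    destruct Hs; subst s; unfold Rabs; destruct Rcase_abs; lra. }
assert (H55 : 55 * y <= / (2 * K)).
{ apply Rmult_le_reg_r with (2 * K); [lra|]. rewrite Rinv_l by lra. lra. }
assert (Hx := sn_ge_0 HN x).
assert (Hlow' : N x / (2 * K) <= N (vminus (vscal (w ^ k)%C x) (Nat.iter k U x))).
{ generalize (Hlow k x ltac:(unfold k; lia)).
  generalize (sn_minus_trans HN (vscal zeta x) (vscal (w ^ k)%C x) (Nat.iter k U x)).
  replace (vminus (vscal zeta x) (vscal (w ^ k)%C x)) with (vscal (zeta - w ^ k)%C x) by module_eq.
  rewrite (sn_scal N HN). replace (Cmod (zeta - w ^ k)) with (Cmod (w ^ k - zeta)).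
  2:{ rewrite <- Cmod_opp; f_equal; ring. }
  assert (Cmod (w ^ k - zeta) * N x <= / (2 * K) * N x) by (apply Rmult_le_compat_r; lra).
  replace (N x / K) with (2 * (/ (2 * K) * N x)) by (field; lra).
  replace (N x / (2 * K)) with (/ (2 * K) * N x) by (field; lra). lra. }
generalize (sn_pow_minus HN U w q k x HU HcU Hq Hwq); intros Hup.
set (d := N (vminus (vscal w x) (U x))) in *.
assert (Hd : 0 <= d) by apply (sn_ge_0 HN).
assert (H3 : N x / (2 * K) <= INR k * 3 * d).
{ eapply Rle_trans; [exact Hlow'|]. eapply Rle_trans; [exact Hup|].
  apply Rmult_le_compat_r; [easy|]. apply Rmult_le_compat_l; [apply pos_INR | easy]. }
replace (y / (54 * K) * N x) with (y / 27 * (N x / (2 * K))) by (field; lra).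
apply Rle_trans with (y / 27 * (INR k * 3 * d)).
- apply Rmult_le_compat_l; lra.
- replace (y / 27 * (INR k * 3 * d)) with ((INR k * y) / 9 * d) by field. nra.
Qed.

(** The point runs over the circle of radius [1 / r] that encloses the unit circle and touches it at
    [1]. Its squared modulus is [1 + 2 (1 - r) (1 - cos phi) / r^2], and [2 (1 - r) >= 1]. *)
Lemma Cmod_averaged_angle (phi r : R) :
  0 < r <= / 2 -> Rabs phi <= PI ->
  1 + (Rabs phi / r) ^ 2 / 18 <= Cmod (1 + (cis phi - 1) / r) ^ 2.
Proof.
intros Hr Hphi.
rewrite Cmod2_alt.
assert (E : (1 + (cis phi - 1) / r)%C = (1 + (cos phi - 1) / r, sin phi / r)).
{ unfold Cdiv. replace (/ RtoC r)%C with (RtoC (/ r)) by (apply RtoC_inv; lra).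
  unfold cis, Cplus, Cminus, Cmult, Copp, RtoC; simpl. f_equal; field; lra. }
rewrite E; simpl Re; simpl Im. unfold fst, snd.
assert (H1 := one_minus_cos_ge phi Hphi).
assert (H2 : sin phi ^ 2 = 1 - cos phi ^ 2).
{ generalize (sin2_cos2 phi); unfold Rsqr; intros; nra. }
replace ((sin phi / r) ^ 2) with ((1 - cos phi ^ 2) / r ^ 2) by (rewrite <- H2; field; lra).
replace ((1 + (cos phi - 1) / r) ^ 2 + (1 - cos phi ^ 2) / r ^ 2)
  with (1 + (1 - cos phi) / r ^ 2 * (2 * (1 - r))) by (field; lra).
replace ((Rabs phi / r) ^ 2 / 18) with ((phi ^ 2 / 18) / r ^ 2)
  by (rewrite <- (pow2_abs phi); field; lra).
assert (Hr2 : 0 < / r ^ 2) by (apply Rinv_0_lt_compat; nra).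
apply Rplus_le_compat_l. unfold Rdiv.
apply Rle_trans with ((1 - cos phi) * / r ^ 2).
- apply Rmult_le_compat_r; [lra|]. unfold Rdiv in H1. exact H1.
- assert (0 <= (1 - cos phi) * / r ^ 2) by (apply Rmult_le_pos; nra). nra.
Qed.

(** Since [cis phi - V = r (w - U)] with [w = 1 + (cis phi - 1) / r], the question concerns [U] at
    [w]. For small [y = |phi| / r] the point [w] is close to [cis (phi / r)] and rotation applies;
    otherwise [Cmod w - 1] is large enough for the contraction property alone. At the threshold
    [1 / (110 K)] the second case needs the constant [18 * 110 * 3 = 5940], which [12000] covers. *)
Lemma lower_bound (zeta : C) (K phi r : R) (x : X) :
  / 2 <= K -> Cmod zeta = 1 ->
  (forall k z, (1 <= k)%nat -> N z / K <= N (vminus (vscal zeta z) (Nat.iter k U z))) ->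
  0 < r <= / 2 -> Rabs phi <= PI ->
  / (12000 * K) * Rabs phi * N x
    <= N (vminus (vscal (cis phi) x) (vplus (vscal (1 - r)%C x) (vscal (RtoC r) (U x)))).
Proof.
intros HK Hz Hlow Hr Hphi.
set (w := (1 + (cis phi - 1) / r)%C).
assert (Hr0 : RtoC r <> RtoC 0) by (intros H; apply RtoC_inj in H; lra).
replace (vminus (vscal (cis phi) x) (vplus (vscal (1 - r)%C x) (vscal (RtoC r) (U x))))
  with (vscal (RtoC r) (vminus (vscal w x) (U x))).
2:{ unfold w. module_eq. field. exact Hr0. }
rewrite (sn_scal N HN), Cmod_R, (Rabs_pos_eq r) by lra.
assert (Hx := sn_ge_0 HN x).
set (y := Rabs phi / r).
assert (Hy : 0 <= y) by (apply Rdiv_le_0_compat; [apply Rabs_pos | lra]).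
assert (Hyr : Rabs phi = r * y) by (unfold y; field; lra).
assert (Hmain : y / (12000 * K) * N x <= N (vminus (vscal w x) (U x))).
2:{ rewrite Hyr. replace (/ (12000 * K) * (r * y) * N x) with (r * (y / (12000 * K) * N x))
      by (field; lra). apply Rmult_le_compat_l; lra. }
assert (HKi : 0 < / K <= 2).
{ split; [apply Rinv_0_lt_compat; lra|]. rewrite <- (Rinv_inv 2). apply Rinv_le_contravar; lra. }
assert (Hi : / (110 * K) = / K / 110) by (field; lra).
destruct (Rle_dec y (/ (110 * K))) as [Hsmall|Hlarge].
- destruct (Req_dec y 0) as [H0|H0].
  { rewrite H0. unfold Rdiv. rewrite !Rmult_0_l. apply (sn_ge_0 HN). }
  apply Rle_trans with (y / (54 * K) * N x).
  { apply Rmult_le_compat_r; [easy|]. unfold Rdiv. apply Rmult_le_compat_l; [easy|].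
    apply Rinv_le_contravar; lra. }
  set (s := if Rle_dec 0 phi then 1 else -1).
  assert (Hsy : s * y = phi / r).
  { unfold s, y. destruct (Rle_dec 0 phi).
    - rewrite Rabs_pos_eq by easy. ring.
    - rewrite Rabs_left by lra. field; lra. }
  apply lower_bound_small_angle with (zeta := zeta) (s := s); try assumption; try lra.
  { unfold s; destruct (Rle_dec 0 phi); lra. }
  rewrite Hsy.
  (* Both points equal [1 + i phi / r] to first order; the errors are at most [phi^2 / r <= y^2] and
     [y^2]. *)
  replace (w - cis (phi / r))%C with ((cis phi - (1, phi)) / r - (cis (phi / r) - (1, (phi / r)%R)))%C.
  2:{ unfold w. replace (1, phi)%R with (1 + RtoC phi * Ci)%C
        by (unfold RtoC, Ci, Cplus, Cmult; simpl; f_equal; ring).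
      replace (1, phi / r)%R with (1 + RtoC phi / r * Ci)%C
        by (rewrite <- RtoC_div by lra; unfold RtoC, Ci, Cplus, Cmult; simpl; f_equal; ring).
      field. exact Hr0. }
  eapply Rle_trans; [apply Cmod_triangle|]. rewrite Cmod_opp, Cmod_div, Cmod_R by easy.
  rewrite (Rabs_pos_eq r) by lra.
  generalize (Cmod_cis_taylor phi) (Cmod_cis_taylor (phi / r)); intros T1 T2.
  assert (E1 : phi ^ 2 = r ^ 2 * y ^ 2) by (rewrite <- (pow2_abs phi), Hyr; ring).
  assert (E2 : (phi / r) ^ 2 = y ^ 2).
  { rewrite <- Hsy. unfold s; destruct (Rle_dec 0 phi); ring. }
  rewrite E2 in T2. rewrite E1 in T1.
  assert (Cmod (cis phi - (1, phi)) / r <= y ^ 2); [|lra].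
  apply Rle_div_l; [lra|]. nra.
- eapply Rle_trans; [|apply lower_bound_trivial].
  apply Rmult_le_compat_r; [easy|].
  assert (H2 := Cmod_averaged_angle phi r Hr Hphi). fold w y in H2.
  set (m := Cmod w) in *.
  assert (Hm0 : 0 <= m) by apply Cmod_ge_0.
  assert (Hm1 : 1 <= m) by nra.
  assert (Hm2 : m <= 1 + y).
  { unfold m, w. eapply Rle_trans; [apply Cmod_triangle|]. rewrite Cmod_1.
    apply Rplus_le_compat_l. rewrite Cmod_div, Cmod_R, (Rabs_pos_eq r) by (easy || lra).
    unfold y. apply Rmult_le_compat_r; [left; apply Rinv_0_lt_compat; lra|].
    apply Cmod_cis_minus_1_le. }
  replace (y / (12000 * K)) with (y * (/ K / 12000)) by (field; lra).
  rewrite Hi in Hlarge.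
  set (u := / K) in *.
  (* Here [m^2 - 1 = (m - 1) (m + 1)] and [m + 1 <= 2 + y]. *)
  assert (Hy2 : y * (y / 18) <= (m - 1) * (2 + y)) by nra.
  apply Rmult_le_reg_r with (2 + y); [lra|].
  eapply Rle_trans; [|exact Hy2].
  rewrite Rmult_assoc. apply Rmult_le_compat_l; [easy|].
  destruct (Rle_dec y 1); nra.
Qed.

End LowerBound.

(** * Discrete smoothing *)

Section Sums.
Context {X : NormedModule C_AbsRing}.
Implicit Types (u v : nat -> X).

Lemma vsum_ext u v n : (forall k, (k <= n)%nat -> u k = v k) -> vsum u n = vsum v n.
Proof. intros H. exact (sum_n_ext_loc u v n H). Qed.

Lemma vsum_plus u v n : vsum (fun k => vplus (u k) (v k)) n = vplus (vsum u n) (vsum v n).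
Proof. exact (sum_n_plus u v n). Qed.

Lemma vsum_scal (c : C) u n : vsum (fun k => vscal c (u k)) n = vscal c (vsum u n).
Proof. exact (sum_n_scal_l (K := C_Ring) c u n). Qed.

Lemma vsum_minus u v n : vsum (fun k => vminus (u k) (v k)) n = vminus (vsum u n) (vsum v n).
Proof.
induction n as [|n IH].
- now rewrite !vsum_0.
- rewrite !vsum_S, IH. module_eq.
Qed.

Lemma vsum_switch (u : nat -> nat -> X) m n :
  vsum (fun i => vsum (u i) n) m = vsum (fun j => vsum (fun i => u i j) m) n.
Proof. exact (sum_n_switch u m n). Qed.

Lemma vsum_abel (c : nat -> C) (e : nat -> X) n :
  vsum (fun j => vscal (c j) (vminus (e j) (e (S j)))) (S n)
  = vplus (vminus (vscal (c 0%nat) (e 0%nat)) (vscal (c (S n)) (e (S (S n)))))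
          (vsum (fun i => vscal (c (S i) - c i)%C (e (S i))) n).
Proof.
induction n as [|n IH].
- rewrite vsum_S, !vsum_0. module_eq.
- rewrite vsum_S, IH, vsum_S. module_eq.
Qed.

Lemma vsum_only u l n :
  (l <= n)%nat -> (forall k, (k <= n)%nat -> k <> l -> u k = vzero) -> vsum u n = u l.
Proof.
intros Hl H. induction n as [|n IH].
- rewrite vsum_0. f_equal; lia.
- rewrite vsum_S. destruct (Nat.eq_dec l (S n)) as [->|Hn].
  + rewrite (vsum_ext u (fun _ => vscal (RtoC 0) vzero)).
    * rewrite vsum_scal. module_eq.
    * intros k Hk. rewrite H by lia. module_eq.
  + rewrite IH by (try lia; intros; apply H; lia). rewrite (H (S n)) by lia. module_eq.
Qed.

Fixpoint csum (u : nat -> C) (n : nat) : C :=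
  match n with O => u O | S n' => (csum u n' + u n)%C end.

Lemma vscal_csum (c : nat -> C) (x : X) n :
  vscal (csum c n) x = vsum (fun k => vscal (c k) x) n.
Proof.
induction n as [|n IH]; simpl.
- now rewrite vsum_0.
- rewrite vsum_S, <- IH. module_eq.
Qed.

End Sums.

Lemma csum_S (u : nat -> C) n : csum u (S n) = (csum u n + u (S n))%C.
Proof. reflexivity. Qed.

Lemma cis_neg (t : R) : (cis (- t) * cis t)%C = RtoC 1.
Proof. rewrite <- cis_plus. replace (- t + t) with 0 by ring. apply cis_0. Qed.

Lemma cis_nat_2PI (n : nat) : cis (INR n * (2 * PI)) = RtoC 1.
Proof.
rewrite <- cis_pow. replace (cis (2 * PI)) with (RtoC 1).
- apply Cpow_1_l.
- unfold cis. now rewrite cos_2PI, sin_2PI.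
Qed.

Lemma csum_cis_pos (b : R) (l : nat) :
  (csum (fun k => cis (INR k * b)) l * (cis b - 1))%C = (cis (INR (S l) * b) - 1)%C.
Proof.
induction l as [|l IH].
- simpl csum; simpl INR. rewrite Rmult_0_l, cis_0, Rmult_1_l. ring.
- rewrite csum_S, Cmult_plus_distr_r, IH.
  rewrite (S_INR (S l)), Rmult_plus_distr_r, Rmult_1_l, cis_plus. ring.
Qed.

Lemma csum_cis_neg (b : R) (l : nat) :
  (csum (fun k => cis (- (INR (S k) * b))) l * (cis b - 1))%C = (1 - cis (- (INR (S l) * b)))%C.
Proof.
assert (Hk : forall k, (cis (- (INR (S k) * b)) * (cis b - 1))%C
                       = (cis (- (INR k * b)) - cis (- (INR (S k) * b)))%C).
{ intros k. replace (- (INR k * b)) with (- (INR (S k) * b) + b) by (rewrite S_INR; ring).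
  rewrite cis_plus. ring. }
induction l as [|l IH].
- change (csum (fun k => cis (- (INR (S k) * b))) 0) with (cis (- (INR 1 * b))).
  rewrite Hk. simpl INR. rewrite Rmult_0_l, Ropp_0, cis_0. reflexivity.
- rewrite csum_S, Cmult_plus_distr_r, IH, Hk. ring.
Qed.

(* The Dirichlet kernel of order [l + 1] at the points [2 pi d / (2 l + 3)]. *)
Lemma dirichlet_zero (d : R) (l n : nat) :
  d = INR n \/ d = - INR n -> (1 <= n <= S l)%nat ->
  let b := d * (2 * PI / INR (S (2 * S l))) in
  (csum (fun k => cis (INR k * b)) (S l) + csum (fun k => cis (- (INR (S k) * b))) l)%C = RtoC 0.
Proof.
intros Hd Hn b. set (L := INR (S (2 * S l))).
assert (HL : 0 < L) by (apply lt_0_INR; lia).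
assert (Hn1 : 1 <= INR n) by (apply (le_INR 1); lia).
assert (HnL : 2 * INR n <= L).
{ unfold L. replace 2 with (INR 2) by (simpl; ring). rewrite <- mult_INR. apply le_INR; lia. }
assert (HPI := PI_RGT_0).
assert (Hb0 : b <> 0).
{ unfold b. fold L. apply Rmult_integral_contrapositive. split; [destruct Hd; lra|].
  apply Rmult_integral_contrapositive. split; [lra|]. apply Rinv_neq_0_compat; lra. }
assert (Hb : Rabs b <= PI).
{ unfold b. fold L. rewrite Rabs_mult. replace (Rabs d) with (INR n).
  2:{ destruct Hd as [-> | ->]; [|rewrite Rabs_Ropp]; rewrite Rabs_pos_eq; lra. }
  rewrite Rabs_pos_eq by (apply Rdiv_le_0_compat; lra).
  replace (INR n * (2 * PI / L)) with (2 * INR n * PI / L) by (field; lra).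
  apply Rle_div_l; nra. }
(* The geometric sums telescope after multiplication by [cis b - 1], which is nonzero because
   [0 < |b| <= PI]. *)
assert (Hne : (cis b - 1)%C <> RtoC 0).
{ intros H. assert (H1 := Cmod_cis_minus_1 b). rewrite H, Cmod_0 in H1.
  generalize (one_minus_cos_ge b Hb). assert (0 < b ^ 2) by nra. lra. }
assert (HLb : cis (L * b) = RtoC 1).
{ unfold b. fold L. replace (L * (d * (2 * PI / L))) with (d * (2 * PI)) by (field; lra).
  destruct Hd as [-> | ->]; [apply cis_nat_2PI|].
  rewrite <- (cis_neg (INR n * (2 * PI))), cis_nat_2PI, Cmult_1_r. f_equal; ring. }
assert (HLl : L = INR (S (S l)) + INR (S l)).
{ unfold L. rewrite <- plus_INR. f_equal; lia. }
set (s := (csum _ _ + csum _ _)%C).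
assert (Hs : (s * (cis b - 1))%C = RtoC 0).
{ unfold s. rewrite Cmult_plus_distr_r, csum_cis_pos, csum_cis_neg.
  replace (INR (S (S l)) * b) with (L * b + - (INR (S l) * b)) by (rewrite HLl; ring).
  rewrite cis_plus, HLb. ring. }
destruct (Ceq_dec s 0) as [E|E]; [exact E|].
exfalso. apply (Cmult_neq_0 _ _ E Hne Hs).
Qed.

(** A difference of the bump lowers both indices of its mass [bin (S n) (S s)]; when the order is at
    most the fraction [rho] of the length, this gains a factor [rho]. *)
Lemma bin_ratio (rho : R) (n s : nat) :
  INR (S s) <= rho * INR (S n) -> bin n s <= rho * bin (S n) (S s).
Proof.
intros H. apply Rmult_le_reg_l with (INR (S n)); [apply lt_0_INR; lia|].
rewrite <- bin_absorb. generalize (bin_ge_0 (S n) (S s)). intros.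
replace (INR (S n) * (rho * bin (S n) (S s))) with (rho * INR (S n) * bin (S n) (S s)) by ring.
now apply Rmult_le_compat_r.
Qed.

Section Smoothing.
Context {X : NormedModule C_AbsRing} {N : X -> R} (HN : seminorm N).
Context {V : X -> X} (HV : linear_map V) (HcV : contraction N V).

Definition diff1 (x : X) : X := vminus (V x) x.

Lemma lin_diff1 : linear_map diff1.
Proof.
unfold diff1; split; intros.
- rewrite (lin_plus V HV). module_eq.
- rewrite (lin_scal V HV). module_eq.
Qed.

Lemma diff1_comm x : diff1 (V x) = V (diff1 x).
Proof. unfold diff1. now rewrite (lin_minus V). Qed.

(* A Fourier coefficient of [j |-> V ^ j x] cut off by a discrete bump vanishing to
   order [a] at [0] and to order [b] at [n]; it is homogenized by [w ^ n]. *)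
Definition bump_coef (w : C) (n a b : nat) (x : X) : X :=
  vsum (fun j => vscal (RtoC (bin j a * bin (n - j) b) * w ^ (n - j))%C (Nat.iter j V x)) n.

Section OneFrequency.
Context (w : C) (Hw : Cmod w = 1).
Local Notation J := (bump_coef w).

(* Summation by parts; the boundary terms vanish because the bump does. *)
Lemma bump_coef_step n a b x :
  vminus (vscal w (J (S n) (S a) (S b) x)) (V (J (S n) (S a) (S b) x))
  = vscal w (V (vminus (J n a (S b) x) (J n (S a) b x))).
Proof.
unfold bump_coef.
rewrite (lin_sum V _ _ HV), <- vsum_scal, <- vsum_minus.
set (c := fun j => RtoC (bin j (S a) * bin (S n - j) (S b))).
set (e := fun j => vscal (w ^ (S (S n) - j))%C (Nat.iter j V x)).
rewrite (vsum_ext _ (fun j => vscal (c j) (vminus (e j) (e (S j))))).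
2:{ intros k Hk. unfold c, e. rewrite (lin_scal V HV).
    replace (S (S n) - S k)%nat with (S n - k)%nat by lia.
    replace (S (S n) - k)%nat with (S (S n - k))%nat by lia.
    rewrite Cpow_S. simpl Nat.iter. module_eq. }
rewrite vsum_abel.
replace (c 0%nat) with (RtoC 0) by (unfold c; simpl bin; f_equal; ring).
replace (c (S n)) with (RtoC 0).
2:{ unfold c. rewrite Nat.sub_diag. simpl bin. f_equal; ring. }
rewrite <- vsum_minus, (lin_sum V _ _ HV), <- vsum_scal.
rewrite (vsum_ext (fun i => vscal (c (S i) - c i)%C (e (S i)))
  (fun j => vscal w (V (vminus
     (vscal (RtoC (bin j a * bin (n - j) (S b)) * w ^ (n - j))%C (Nat.iter j V x))
     (vscal (RtoC (bin j (S a) * bin (n - j) b) * w ^ (n - j))%C (Nat.iter j V x)))))).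
- module_eq.
- intros k Hk. rewrite (lin_minus V) by assumption. rewrite !(lin_scal V HV). unfold c, e.
  replace (S n - S k)%nat with (n - k)%nat by lia.
  replace (S n - k)%nat with (S (n - k)) by lia.
  replace (S (S n) - S k)%nat with (S (n - k)) by lia.
  rewrite Cpow_S, !bin_S_S, !RtoC_mult, !RtoC_plus. simpl Nat.iter. module_eq.
Qed.

Lemma bump_coef_bound n a b x : N (J n a b x) <= bin (S n) (S (a + b)) * N x.
Proof.
unfold bump_coef. eapply Rle_trans; [apply (sn_sum HN)|].
rewrite <- bin_vandermonde.
apply Rle_trans with (sum_n (fun j => bin j a * bin (n - j) b * N x) n).
- apply sum_n_le; intros k Hk.
  rewrite (sn_scal N HN), Cmod_mult, Cmod_R, Cmod_pow, Hw, pow1, Rmult_1_r.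
  assert (0 <= bin k a * bin (n - k) b) by (apply Rmult_le_pos; apply bin_ge_0).
  rewrite Rabs_pos_eq by easy. apply Rmult_le_compat_l; [easy|].
  now apply contraction_iter.
- right. exact (sum_n_mult_r (K := R_Ring) (N x) (fun j => bin j a * bin (n - j) b) n).
Qed.

(** Writes [V - 1 = (w - 1) - (w - V)]; summation by parts turns the second part into differences of
    the bump. *)
Lemma diff1_bump_coef m n a b x :
  N (Nat.iter (S m) diff1 (J (S n) (S a) (S b) x))
  <= Cmod (w - 1) * N (Nat.iter m diff1 (J (S n) (S a) (S b) x))
     + N (Nat.iter m diff1 (J n a (S b) x)) + N (Nat.iter m diff1 (J n (S a) b x)).
Proof.
simpl Nat.iter. rewrite <- iter_S_r.
assert (HD := lin_iter diff1 m lin_diff1).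
replace (diff1 (J (S n) (S a) (S b) x))
  with (vminus (vscal (w - 1)%C (J (S n) (S a) (S b) x))
               (vscal w (V (vminus (J n a (S b) x) (J n (S a) b x))))).
2:{ rewrite <- bump_coef_step. unfold diff1. module_eq. }
rewrite (lin_minus _ _ _ HD), !(lin_scal _ HD).
rewrite (iter_comm diff1 V m) by apply diff1_comm.
eapply Rle_trans; [apply (sn_minus HN)|].
rewrite !(sn_scal N HN), Hw, Rmult_1_l, Rplus_assoc. apply Rplus_le_compat_l.
eapply Rle_trans; [apply HcV|]. rewrite (lin_minus _ _ _ HD). apply (sn_minus HN).
Qed.

Context {rho : R} (Hrho : 0 < rho <= 1).

Lemma density_step n s : INR (S s) <= rho * INR (S n) -> INR s <= rho * INR n.
Proof. rewrite !S_INR. lra. Qed.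

Lemma density_pos n s : (1 <= s)%nat -> INR (S s) <= rho * INR (S n) -> exists n', n = S n'.
Proof.
intros Hs H. destruct n as [|n]; [exfalso|now exists n].
apply density_step in H. simpl in H. apply (le_INR 1) in Hs. simpl in Hs. lra.
Qed.

(** No inversion of [w - V] takes place: each factor [V - 1] either costs [Cmod (w - 1)] or yields
    two differenced bumps, each smaller by the factor [rho]. Orders [a] and [b] of at least [m] keep
    the boundary terms zero throughout. *)
Lemma bump_coef_low m n a b x :
  (m <= a)%nat -> (m <= b)%nat -> INR (S (a + b)) <= rho * INR (S n) ->
  N (Nat.iter m diff1 (J n a b x))
  <= (Cmod (w - 1) + 2 * rho) ^ m * (bin (S n) (S (a + b)) * N x).
Proof.
revert n a b; induction m as [|m IH]; intros n a b Ha Hb Hd.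
- simpl. rewrite Rmult_1_l. apply bump_coef_bound.
- destruct a as [|a]; [lia|]. destruct b as [|b]; [lia|].
  destruct (density_pos n (S a + S b) ltac:(lia) Hd) as [n' ->].
  eapply Rle_trans; [apply diff1_bump_coef|].
  assert (Hd' := density_step _ _ Hd).
  replace (S a + S b)%nat with (S (a + S b)) in * by lia.
  generalize (IH (S n') (S a) (S b) ltac:(lia) ltac:(lia)).
  generalize (IH n' a (S b) ltac:(lia) ltac:(lia) Hd').
  generalize (IH n' (S a) b ltac:(lia) ltac:(lia)).
  replace (S a + b)%nat with (a + S b)%nat by lia.
  replace (S a + S b)%nat with (S (a + S b)) by lia.
  intros H1 H2 H3. specialize (H1 Hd'). specialize (H3 Hd).
  assert (Hr := bin_ratio rho _ _ Hd).
  set (q := Cmod (w - 1) + 2 * rho) in *.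
  assert (Hq : 0 <= q ^ m).
  { apply pow_le. unfold q. generalize (Cmod_ge_0 (w - 1)); lra. }
  assert (Hx := sn_ge_0 HN x).
  assert (H4 : q ^ m * (bin (S n') (S (a + S b)) * N x)
               <= q ^ m * (rho * (bin (S (S n')) (S (S (a + S b))) * N x))).
  { apply Rmult_le_compat_l; [easy|]. rewrite <- Rmult_assoc. now apply Rmult_le_compat_r. }
  assert (H5 : Cmod (w - 1) * N (Nat.iter m diff1 (J (S n') (S a) (S b) x))
    <= Cmod (w - 1) * (q ^ m * (bin (S (S n')) (S (S (a + S b))) * N x))).
  { apply Rmult_le_compat_l; [apply Cmod_ge_0|easy]. }
  replace (q ^ S m) with ((Cmod (w - 1) + 2 * rho) * q ^ m) by (unfold q; simpl; ring).
  lra.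
Qed.

Context {kappa phi : R} (Hk : 0 < kappa) (Hphi : 0 < phi).
Context (Hlow : forall y, kappa * phi * N y <= N (vminus (vscal w y) (V y))).

(** Each of the [d] inversions of [w - V] costs [1 / (kappa * phi)] and leaves two differenced
    bumps, each smaller by the factor [rho]. *)
Lemma bump_coef_decay d n a b x :
  (d <= a)%nat -> (d <= b)%nat -> INR (S (a + b)) <= rho * INR (S n) ->
  N (J n a b x) <= (2 * rho / (kappa * phi)) ^ d * (bin (S n) (S (a + b)) * N x).
Proof.
revert n a b; induction d as [|d IH]; intros n a b Ha Hb Hd.
- simpl. rewrite Rmult_1_l. apply bump_coef_bound.
- destruct a as [|a]; [lia|]. destruct b as [|b]; [lia|].
  destruct (density_pos n (S a + S b) ltac:(lia) Hd) as [n' ->].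
  assert (Hd' := density_step _ _ Hd).
  generalize (Hlow (J (S n') (S a) (S b) x)). rewrite bump_coef_step.
  rewrite (sn_scal N HN), Hw, Rmult_1_l. intros H0.
  replace (S a + S b)%nat with (S (a + S b)) in * by lia.
  generalize (IH n' a (S b) ltac:(lia) ltac:(lia) Hd').
  generalize (IH n' (S a) b ltac:(lia) ltac:(lia)).
  replace (S a + b)%nat with (a + S b)%nat by lia.
  intros H1 H2. specialize (H1 Hd').
  assert (Hr := bin_ratio rho _ _ Hd).
  assert (Hkp : 0 < kappa * phi) by nra.
  set (q := 2 * rho / (kappa * phi)) in *.
  assert (Hq : 0 <= q ^ d).
  { apply pow_le. unfold q. apply Rdiv_le_0_compat; lra. }
  assert (Hx := sn_ge_0 HN x).
  assert (H4 : q ^ d * (bin (S n') (S (a + S b)) * N x)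
               <= q ^ d * (rho * (bin (S (S n')) (S (S (a + S b))) * N x))).
  { apply Rmult_le_compat_l; [easy|]. rewrite <- Rmult_assoc. now apply Rmult_le_compat_r. }
  apply Rmult_le_reg_l with (kappa * phi); [easy|].
  eapply Rle_trans; [exact H0|]. eapply Rle_trans; [apply HcV|].
  eapply Rle_trans; [apply (sn_minus HN)|].
  replace (kappa * phi * (q ^ S d * (bin (S (S n')) (S (S (a + S b))) * N x)))
    with (2 * (q ^ d * (rho * (bin (S (S n')) (S (S (a + S b))) * N x)))).
  2:{ simpl pow. unfold q at 2. field. lra. }
  lra.
Qed.

Context (Hw1 : Cmod (w - 1) <= phi).

(** A factor [V - 1] either costs [phi] and keeps all [d] inversions available, or uses up one order
    of the bump. The second case gains [2 * rho], which is [kappa * phi] times the decay factor that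
    it gives up; together they give [phi * (1 + kappa)]. *)
Lemma bump_coef_high m d n a b x :
  (m <= d)%nat -> (d <= a)%nat -> (d <= b)%nat -> INR (S (a + b)) <= rho * INR (S n) ->
  N (Nat.iter m diff1 (J n a b x))
  <= (phi * (1 + kappa)) ^ m * (2 * rho / (kappa * phi)) ^ d * (bin (S n) (S (a + b)) * N x).
Proof.
revert d n a b; induction m as [|m IH]; intros d n a b Hm Ha Hb Hd.
- simpl. rewrite Rmult_1_l. now apply bump_coef_decay.
- destruct d as [|d]; [lia|].
  destruct a as [|a]; [lia|]. destruct b as [|b]; [lia|].
  destruct (density_pos n (S a + S b) ltac:(lia) Hd) as [n' ->].
  eapply Rle_trans; [apply diff1_bump_coef|].
  assert (Hd' := density_step _ _ Hd).
  generalize (IH (S d) (S n') (S a) (S b) ltac:(lia) ltac:(lia) ltac:(lia) Hd).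
  replace (S a + S b)%nat with (S (a + S b)) in * by lia.
  generalize (IH d n' a (S b) ltac:(lia) ltac:(lia) ltac:(lia) Hd').
  generalize (IH d n' (S a) b ltac:(lia) ltac:(lia) ltac:(lia)).
  replace (S a + b)%nat with (a + S b)%nat by lia.
  intros H1 H2 H3. specialize (H1 Hd').
  assert (Hr := bin_ratio rho _ _ Hd).
  assert (Hkp : 0 < kappa * phi) by nra.
  set (q := 2 * rho / (kappa * phi)) in *.
  set (p := (phi * (1 + kappa)) ^ m) in *.
  assert (Hq : 0 <= q ^ d).
  { apply pow_le. unfold q. apply Rdiv_le_0_compat; lra. }
  assert (Hp : 0 <= p) by (apply pow_le; nra).
  assert (Hx := sn_ge_0 HN x).
  assert (H4 : p * q ^ d * (bin (S n') (S (a + S b)) * N x)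
               <= p * q ^ d * (rho * (bin (S (S n')) (S (S (a + S b))) * N x))).
  { apply Rmult_le_compat_l; [now apply Rmult_le_pos|].
    rewrite <- Rmult_assoc. now apply Rmult_le_compat_r. }
  assert (H5 : Cmod (w - 1) * N (Nat.iter m diff1 (J (S n') (S a) (S b) x))
    <= phi * (p * q ^ S d * (bin (S (S n')) (S (S (a + S b))) * N x))).
  { apply Rmult_le_compat; try easy; [apply Cmod_ge_0|apply (sn_ge_0 HN)]. }
  replace ((phi * (1 + kappa)) ^ S m * q ^ S d * (bin (S (S n')) (S (S (a + S b))) * N x))
    with (phi * (p * q ^ S d * (bin (S (S n')) (S (S (a + S b))) * N x))
      + 2 * (p * q ^ d * (rho * (bin (S (S n')) (S (S (a + S b))) * N x)))).
  2:{ unfold p. simpl pow. unfold q at 1 4. field. lra. }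
  lra.
Qed.

End OneFrequency.

(* Inversion of the Fourier transform on [Z / (2 l + 3)] at the middle index [l + 1];
   the frequencies are grouped as [0, ..., l + 1] and [-1, ..., -(l + 1)]. *)
Lemma bump_coef_inversion l a x :
  let h := 2 * PI / INR (S (2 * S l)) in
  vscal (RtoC (INR (S (2 * S l)) * (bin (S l) a * bin (S l) a))) (Nat.iter (S l) V x)
  = vplus
      (vsum (fun k => vscal (cis (- (INR (S l) * (INR k * h))))
         (bump_coef (cis (INR k * h)) (2 * S l) a a x)) (S l))
      (vsum (fun k => vscal (cis (INR (S l) * (INR (S k) * h)))
         (bump_coef (cis (- (INR (S k) * h))) (2 * S l) a a x)) l).
Proof.
intros h. unfold bump_coef.
set (g := fun j => RtoC (bin j a * bin (2 * S l - j) a)).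
set (d := fun j => INR (S l) - INR j).
set (n := (2 * S l)%nat) in *.
transitivity (vsum (fun j => vscal (g j * (csum (fun k => cis (INR k * (d j * h))) (S l)
       + csum (fun k => cis (- (INR (S k) * (d j * h)))) l))%C (Nat.iter j V x)) n).
- rewrite (vsum_only _ (S l)).
  + f_equal. unfold g, d.
    replace (n - S l)%nat with (S l) by lia.
    assert (H1 : forall u m, (forall k, u k = RtoC 1) -> csum u m = RtoC (INR (S m))).
    { intros u m Hu. induction m as [|m IH]; [apply Hu|].
      change (csum u m + u (S m) = RtoC (INR (S (S m))))%C.
      rewrite IH, Hu, <- RtoC_plus. now rewrite <- S_INR. }
    rewrite !H1.
    * rewrite <- RtoC_plus, <- plus_INR, <- RtoC_mult.
      replace (S n) with (S (S l) + S l)%nat by lia. f_equal; ring.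
    * intros k. replace (- (INR (S k) * ((INR (S l) - INR (S l)) * h))) with 0 by ring.
      apply cis_0.
    * intros k. replace (INR k * ((INR (S l) - INR (S l)) * h)) with 0 by ring. apply cis_0.
  + lia.
  + intros k Hk Hkl. unfold h.
    set (m := if le_lt_dec k (S l) then (S l - k)%nat else (k - S l)%nat).
    unfold n. rewrite (dirichlet_zero (d k) l m).
    * module_eq.
    * unfold d, m. destruct (le_lt_dec k (S l)).
      -- left. now rewrite minus_INR.
      -- right. rewrite minus_INR by lia. ring.
    * unfold m. destruct (le_lt_dec k (S l)); lia.
(* The twist turns the homogenizing exponent [n - j] into the offset [d j] of [j] from the middle
   index. *)
- assert (E1 : forall j t, (j <= n)%nat ->
     (cis (- (INR (S l) * t)) * (g j * cis t ^ (n - j)) = g j * cis (d j * t))%C).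
  { intros j t Hj. rewrite cis_pow, minus_INR by easy.
    replace (d j * t) with (- (INR (S l) * t) + (INR n - INR j) * t).
    - rewrite cis_plus. ring.
    - unfold d, n. rewrite mult_INR. simpl (INR 2). ring. }
  transitivity (vplus
    (vsum (fun j => vsum (fun k => vscal (g j * cis (INR k * (d j * h)))%C (Nat.iter j V x)) (S l)) n)
    (vsum (fun j => vsum (fun k => vscal (g j * cis (- (INR (S k) * (d j * h))))%C (Nat.iter j V x)) l) n)).
  + rewrite <- vsum_plus. apply vsum_ext; intros j Hj.
    rewrite (vsum_ext (fun k => vscal (g j * cis (INR k * (d j * h)))%C (Nat.iter j V x))
      (fun k => vscal (g j) (vscal (cis (INR k * (d j * h))) (Nat.iter j V x)))) by (intros; module_eq).
    rewrite (vsum_ext (fun k => vscal (g j * cis (- (INR (S k) * (d j * h))))%C (Nat.iter j V x))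
      (fun k => vscal (g j) (vscal (cis (- (INR (S k) * (d j * h)))) (Nat.iter j V x)))) by (intros; module_eq).
    rewrite !vsum_scal, <- !vscal_csum. module_eq.
  + rewrite (vsum_switch (fun j k => vscal (g j * cis (INR k * (d j * h)))%C (Nat.iter j V x))).
    rewrite (vsum_switch (fun j k => vscal (g j * cis (- (INR (S k) * (d j * h))))%C (Nat.iter j V x))).
    f_equal; apply vsum_ext; intros k Hk; rewrite <- vsum_scal; apply vsum_ext; intros j Hj.
    * replace (INR k * (d j * h)) with (d j * (INR k * h)) by ring. rewrite <- E1 by easy. unfold g. module_eq.
    * replace (- (INR (S k) * (d j * h))) with (d j * (- (INR (S k) * h))) by ring.
      rewrite <- E1 by easy.
      replace (- (INR (S l) * - (INR (S k) * h))) with (INR (S l) * (INR (S k) * h)) by ring.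
      unfold g. module_eq.
Qed.

End Smoothing.

Lemma sum_n_scal_R (c : R) (u : nat -> R) n : sum_n (fun k => c * u k) n = c * sum_n u n.
Proof. exact (sum_n_scal_l (K := R_Ring) c u n). Qed.

Lemma sum_n_S_R (u : nat -> R) n : sum_n u (S n) = sum_n u n + u (S n).
Proof. exact (sum_Sn u n). Qed.

(** The normalized size of the frequency [k]: the quadratic decay comes from the two extra orders of
    the bump and makes the sum over [k] of order [Q]. *)
Definition cutoff (Q k : nat) : R :=
  if le_lt_dec k Q then 1 else (INR Q / INR k) ^ 2.

Lemma cutoff_sum_pos (Q l : nat) : (1 <= Q)%nat ->
  sum_n (fun k => cutoff Q (S k)) l <= 2 * INR Q.
Proof.
intros HQ. assert (HQ' : 1 <= INR Q) by (now apply (le_INR 1)).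
(* The strengthened bound telescopes through [1 / k^2 <= 1 / (k - 1) - 1 / k]; its two branches
   agree at [S l = Q]. *)
enough (H : sum_n (fun k => cutoff Q (S k)) l
  <= if le_lt_dec (S l) Q then INR (S l) else 2 * INR Q - INR Q ^ 2 / INR (S l)).
{ eapply Rle_trans; [exact H|]. destruct le_lt_dec as [h|h].
  - apply le_INR in h. lra.
  - assert (0 <= INR Q ^ 2 / INR (S l)); [|lra].
    apply Rdiv_le_0_compat; [nra | apply lt_0_INR; lia]. }
induction l as [|l IH].
- rewrite sum_O. unfold cutoff. destruct le_lt_dec as [h|h]; [simpl; lra|lia].
- rewrite sum_n_S_R. eapply Rle_trans; [apply Rplus_le_compat_r, IH|].
  unfold cutoff. destruct (le_lt_dec (S (S l)) Q) as [h|h].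
  + destruct le_lt_dec; [|lia]. rewrite (S_INR (S l)). lra.
  + assert (H1 : 0 < INR (S l)) by (apply lt_0_INR; lia).
    rewrite (S_INR (S l)). set (u := INR (S l)) in *.
    assert (H2 : / u - / (u + 1) = / (u * (u + 1))) by (field; lra).
    assert (H3 : / ((u + 1) * (u + 1)) <= / (u * (u + 1))).
    { apply Rinv_le_contravar; nra. }
    replace ((INR Q / (u + 1)) ^ 2) with (INR Q ^ 2 * / ((u + 1) * (u + 1))) by (field; lra).
    assert (H4 : INR Q ^ 2 * / ((u + 1) * (u + 1)) <= INR Q ^ 2 * (/ u - / (u + 1))).
    { apply Rmult_le_compat_l; [nra | lra]. }
    destruct le_lt_dec as [h'|h']; [|unfold Rdiv; lra].
    assert (E : INR Q = u) by (unfold u; f_equal; lia).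
    rewrite E in *. replace (u ^ 2 * (/ u - / (u + 1))) with (u - u ^ 2 / (u + 1)) in H4 by (field; lra).
    lra.
Qed.

Lemma sum_n_shift_R (u : nat -> R) n : sum_n u (S n) = u 0%nat + sum_n (fun k => u (S k)) n.
Proof.
induction n as [|n IH].
- now rewrite sum_n_S_R, !sum_O.
- rewrite sum_n_S_R, IH, sum_n_S_R. apply Rplus_assoc.
Qed.

Lemma cutoff_sum (Q l : nat) : (1 <= Q)%nat -> sum_n (cutoff Q) (S l) <= 1 + 2 * INR Q.
Proof.
intros HQ. rewrite sum_n_shift_R.
apply Rplus_le_compat; [unfold cutoff; simpl; lra | now apply cutoff_sum_pos].
Qed.

Lemma pow_div_fact_le_exp (x : R) (m : nat) : 0 <= x -> x ^ m / INR (fact m) <= exp x.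
Proof.
intros Hx.
assert (H := exp_ge_taylor x m Hx). eapply Rle_trans; [|exact H].
destruct m as [|m].
- simpl. lra.
- rewrite tech5.
  assert (0 <= sum_f_R0 (fun k => x ^ k / INR (fact k)) m).
  { apply cond_pos_sum. intros k. apply Rdiv_le_0_compat; [now apply pow_le|apply INR_fact_lt_0]. }
  lra.
Qed.

(** * Decay of the operators [(V - 1)^m V^l] *)

Section PowerBound.
Context {X : NormedModule C_AbsRing} {N : X -> R} (HN : seminorm N).
Context {V : X -> X} (HV : linear_map V) (HcV : contraction N V).
Context {kappa : R} (Hk : 0 < kappa <= 1).
Context (Hlow : forall phi y, Rabs phi <= PI ->
  kappa * Rabs phi * N y <= N (vminus (vscal (cis phi) y) (V y))).
Local Notation W := (@diff1 X V).

Lemma diff1_iter_le m y : N (Nat.iter m W y) <= 2 ^ m * N y.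
Proof.
induction m as [|m IH]; simpl Nat.iter; [simpl; lra|].
assert (H : N (W (Nat.iter m W y)) <= 2 * N (Nat.iter m W y)).
{ unfold diff1 at 1. eapply Rle_trans; [apply (sn_minus HN)|].
  generalize (HcV (Nat.iter m W y)). lra. }
simpl pow. lra.
Qed.

(* The low-frequency bound is used for [k <= Q], the high-frequency one for [k > Q],
   with [Q] of order [m / kappa]. *)
Lemma bump_coef_cutoff m l Q k phi x :
  (m + 2 <= S l)%nat ->
  INR (2 * m + 5) / kappa <= INR Q <= INR (2 * m + 5) / kappa + 1 ->
  (k <= S l)%nat ->
  Rabs phi = INR k * (2 * PI / INR (S (2 * S l))) ->
  N (Nat.iter m W (@bump_coef X V (cis phi) (2 * S l) (m + 2) (m + 2) x))
  <= (15 * INR (2 * m + 5) / (kappa * INR (S (2 * S l)))) ^ m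
     * (bin (S (2 * S l)) (S (2 * (m + 2))) * N x) * cutoff Q k.
Proof.
intros Hml HQ Hkl Hphi.
set (s := INR (2 * m + 5)) in *. set (L := INR (S (2 * S l))) in *.
assert (Hs : 5 <= s).
{ unfold s. rewrite plus_INR. generalize (pos_INR (2 * m)). simpl (INR 5). lra. }
assert (HL : s <= L) by (unfold s, L; apply le_INR; lia).
assert (HkL : 2 * INR k <= L).
{ unfold L. replace 2 with (INR 2) by (simpl; ring). rewrite <- mult_INR. apply le_INR; lia. }
assert (HPI := PI_RGT_0). assert (HPI4 := PI_4).
assert (Hk0 := pos_INR k).
assert (Hphipi : Rabs phi <= PI).
{ rewrite Hphi. replace (INR k * (2 * PI / L)) with (2 * INR k * PI / L) by (field; lra).
  apply Rle_div_l; nra. }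
set (rho := s / L).
assert (Hrho : 0 < rho <= 1).
{ unfold rho; split; [apply Rdiv_lt_0_compat; lra | apply Rle_div_l; lra]. }
assert (Hd : INR (S ((m + 2) + (m + 2))) <= rho * INR (S (2 * S l))).
{ fold L. unfold rho. replace (s / L * L) with s by (field; lra).
  unfold s. right. f_equal. lia. }
assert (HkQ : rho * L = s) by (unfold rho; field; lra).
set (u := rho / kappa).
assert (Hu : rho <= u).
{ apply (Rle_div_r rho rho kappa); nra. }
assert (E15 : 15 * s / (kappa * L) = 15 * u) by (unfold u, rho; field; lra).
rewrite E15.
assert (Hx := sn_ge_0 HN x).
replace (2 * (m + 2))%nat with ((m + 2) + (m + 2))%nat by lia.
assert (HB : 0 <= bin (S (2 * S l)) (S ((m + 2) + (m + 2))) * N x).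
{ apply Rmult_le_pos; [apply bin_ge_0 | easy]. }
set (BB := bin (S (2 * S l)) (S ((m + 2) + (m + 2))) * N x) in *.
unfold cutoff. destruct (le_lt_dec k Q) as [H|H].
- rewrite Rmult_1_r.
  eapply Rle_trans.
  { apply (bump_coef_low HN HV HcV (cis phi) (Cmod_cis phi) Hrho m); [lia|lia|exact Hd]. }
  fold BB. apply Rmult_le_compat_r; [easy|]. apply pow_incr. split.
  { generalize (Cmod_ge_0 (cis phi - 1)); lra. }
  assert (H1 := Cmod_cis_minus_1_le phi). rewrite Hphi in H1.
  assert (H2 : INR k * (2 * PI / L) <= 10 * u); [|lra].
  assert (H3 : INR k <= s / kappa + 1) by (apply le_INR in H; lra).
  assert (H4 : 1 <= s / kappa / 5).
  { assert (s <= s / kappa) by (apply (Rle_div_r s s kappa); nra). lra. }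
  assert (H5 : s / kappa = u * L) by (unfold u; rewrite <- HkQ; field; lra).
  replace (INR k * (2 * PI / L)) with (INR k * (2 * PI) / L) by (field; lra).
  apply Rle_div_l; [lra|].
  apply Rle_trans with (6 / 5 * (u * L) * 8); [|nra].
  apply Rmult_le_compat; lra.
- assert (Hkp : 0 < INR k) by (apply lt_0_INR; lia).
  assert (Hphi0 : 0 < Rabs phi).
  { rewrite Hphi. apply Rmult_lt_0_compat; [easy|]. apply Rdiv_lt_0_compat; lra. }
  eapply Rle_trans.
  { apply (bump_coef_high HN HV HcV (cis phi) (Cmod_cis phi) Hrho (proj1 Hk) Hphi0
      (fun y => Hlow phi y Hphipi) (Cmod_cis_minus_1_le phi) m (m + 2)); [lia|lia|lia|exact Hd]. }
  fold BB.
  (* Of the [m + 2] decay factors, [m] combine with the factors of [V - 1] into a power free of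
     [phi]; the other two give the quadratic decay of [cutoff]. *)
  replace ((Rabs phi * (1 + kappa)) ^ m * (2 * rho / (kappa * Rabs phi)) ^ (m + 2) * BB)
    with ((2 * (1 + kappa) * u) ^ m * BB * (2 * u / Rabs phi) ^ 2).
  2:{ rewrite pow_add. rewrite <- (Rmult_assoc (_ ^ m) (_ ^ m)).
      rewrite <- Rpow_mult_distr.
      replace (Rabs phi * (1 + kappa) * (2 * rho / (kappa * Rabs phi))) with (2 * (1 + kappa) * u)
        by (unfold u; field; lra).
      replace (2 * rho / (kappa * Rabs phi)) with (2 * u / Rabs phi) by (unfold u; field; lra).
      ring. }
  apply Rmult_le_compat.
  + apply Rmult_le_pos; [apply pow_le; nra | easy].
  + apply pow2_ge_0.
  + apply Rmult_le_compat_r; [easy|]. apply pow_incr; nra.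
  + apply pow_incr. split; [apply Rdiv_le_0_compat; lra|].
    rewrite Hphi.
    replace (2 * u / (INR k * (2 * PI / L))) with (s / kappa / PI / INR k).
    2:{ unfold u. rewrite <- HkQ. field. lra. }
    apply Rmult_le_compat_r; [left; now apply Rinv_0_lt_compat|].
    apply Rle_trans with (s / kappa); [|lra].
    apply Rle_div_l; [easy|].
    assert (0 <= s / kappa) by (apply Rdiv_le_0_compat; lra).
    generalize PI2_1; intros; nra.
Qed.

(** Inversion recovers the vector multiplied by [L * b^2], with [b^2] the central value of the bump.
    Each frequency is bounded by the mass, at most [L * b^2] as well, so only the effective number
    of frequencies, at most [1 + 4 Q], survives. *)
Lemma power_decay m l x :
  N (Nat.iter m W (Nat.iter l V x))
  <= 9 * INR (2 * m + 5) / kappa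
     * (15 * INR (2 * m + 5) / (kappa * INR (S (2 * l)))) ^ m * N x.
Proof.
set (s := INR (2 * m + 5)).
assert (Hs : 5 <= s).
{ unfold s. rewrite plus_INR. generalize (pos_INR (2 * m)). simpl (INR 5). lra. }
assert (Hx := sn_ge_0 HN x).
assert (Hsk : s <= s / kappa) by (apply (Rle_div_r s s kappa); nra).
destruct (le_lt_dec (m + 2) l) as [Hl|Hl].
- destruct l as [|l]; [lia|].
  set (L := INR (S (2 * S l))).
  assert (HL0 : 0 < L) by (apply lt_0_INR; lia).
  destruct (nfloor_ex (s / kappa)) as [Q0 HQ0]; [lra|].
  set (Q := S Q0).
  assert (HQ : s / kappa <= INR Q <= s / kappa + 1) by (unfold Q; rewrite S_INR; lra).
  set (h := 2 * PI / L).
  assert (Hh : 0 < h) by (apply Rdiv_lt_0_compat; [generalize PI_RGT_0; lra | easy]).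
  set (D := 15 * s / (kappa * L)).
  assert (HD : 0 <= D ^ m).
  { apply pow_le. unfold D. apply Rdiv_le_0_compat; nra. }
  assert (HDm := lin_iter W m (lin_diff1 HV)).
  assert (Hinv := @bump_coef_inversion X V l (m + 2) x). cbv zeta in Hinv. fold L h in Hinv.
  apply (f_equal (fun y => N (Nat.iter m W y))) in Hinv. cbv beta in Hinv.
  rewrite (lin_scal _ HDm), (lin_plus _ HDm), !(lin_sum _ _ _ HDm), (sn_scal N HN) in Hinv.
  set (b := bin (S l) (m + 2)) in *.
  assert (Hb : 0 < b) by (apply bin_pos; lia).
  rewrite Cmod_R, Rabs_pos_eq in Hinv by (apply Rmult_le_pos; nra).
  set (BB := bin (S (2 * S l)) (S (2 * (m + 2))) * N x).
  assert (HBB : BB <= L * (b * b) * N x).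
  { unfold BB. apply Rmult_le_compat_r; [easy|]. apply bin_odd_le. }
  assert (HBB0 : 0 <= BB) by (apply Rmult_le_pos; [apply bin_ge_0 | easy]).
  assert (Hsum1 : N (vsum (fun k => Nat.iter m W (vscal (cis (- (INR (S l) * (INR k * h))))
         (bump_coef (V := V) (cis (INR k * h)) (2 * S l) (m + 2) (m + 2) x))) (S l))
     <= D ^ m * BB * (1 + 2 * INR Q)).
  { eapply Rle_trans; [apply (sn_sum HN)|].
    apply Rle_trans with (sum_n (fun k => D ^ m * BB * cutoff Q k) (S l)).
    - apply sum_n_le; intros k Hkl.
      rewrite (lin_scal _ HDm), (sn_scal N HN), Cmod_cis, Rmult_1_l.
      apply bump_coef_cutoff; try assumption.
      apply Rabs_pos_eq. apply Rmult_le_pos; [apply pos_INR|exact (Rlt_le _ _ Hh)].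
    - rewrite sum_n_scal_R. apply Rmult_le_compat_l; [now apply Rmult_le_pos|].
      apply cutoff_sum; unfold Q; lia. }
  assert (Hsum2 : N (vsum (fun k => Nat.iter m W (vscal (cis (INR (S l) * (INR (S k) * h)))
         (bump_coef (V := V) (cis (- (INR (S k) * h))) (2 * S l) (m + 2) (m + 2) x))) l)
     <= D ^ m * BB * (2 * INR Q)).
  { eapply Rle_trans; [apply (sn_sum HN)|].
    apply Rle_trans with (sum_n (fun k => D ^ m * BB * cutoff Q (S k)) l).
    - apply sum_n_le; intros k Hkl.
      rewrite (lin_scal _ HDm), (sn_scal N HN), Cmod_cis, Rmult_1_l.
      apply bump_coef_cutoff; try assumption; [lia|].
      rewrite Rabs_Ropp. apply Rabs_pos_eq. apply Rmult_le_pos; [apply pos_INR|exact (Rlt_le _ _ Hh)].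
    - rewrite sum_n_scal_R. apply Rmult_le_compat_l; [now apply Rmult_le_pos|].
      apply cutoff_sum_pos; unfold Q; lia. }
  assert (Htot := sn_triangle N HN
    (vsum (fun k => Nat.iter m W (vscal (cis (- (INR (S l) * (INR k * h))))
         (bump_coef (V := V) (cis (INR k * h)) (2 * S l) (m + 2) (m + 2) x))) (S l))
    (vsum (fun k => Nat.iter m W (vscal (cis (INR (S l) * (INR (S k) * h)))
         (bump_coef (V := V) (cis (- (INR (S k) * h))) (2 * S l) (m + 2) (m + 2) x))) l)).
  rewrite <- Hinv in Htot.
  apply Rmult_le_reg_l with (L * (b * b)); [repeat apply Rmult_lt_0_compat; easy|].
  eapply Rle_trans; [exact Htot|].
  apply Rle_trans with (D ^ m * BB * (9 * (s / kappa))).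
  + apply Rle_trans with (D ^ m * BB * (1 + 4 * INR Q)); [lra|].
    apply Rmult_le_compat_l; [now apply Rmult_le_pos | lra].
  + replace (L * (b * b) * (9 * s / kappa * D ^ m * N x))
      with (D ^ m * (L * (b * b) * N x) * (9 * (s / kappa))) by (field; lra).
    apply Rmult_le_compat_r; [lra|]. now apply Rmult_le_compat_l.
(* The bump of order [m + 2] does not fit here, but the base of the power is at least [2], so the
   trivial bound is enough. *)
- eapply Rle_trans; [apply diff1_iter_le|].
  assert (H2 : 2 ^ m <= (15 * s / (kappa * INR (S (2 * l)))) ^ m).
  { apply pow_incr. split; [lra|].
    assert (0 < INR (S (2 * l))) by (apply lt_0_INR; lia).
    assert (INR (S (2 * l)) <= s) by (unfold s; apply le_INR; lia).
    apply Rle_div_r; nra. }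
  generalize (contraction_iter V l HcV x); intros H3.
  assert (H4 : 0 <= 2 ^ m) by (apply pow_le; lra).
  set (q := (15 * s / (kappa * INR (S (2 * l)))) ^ m) in *.
  apply Rle_trans with (q * N x).
  { apply Rmult_le_compat; try easy. apply (sn_ge_0 HN). }
  apply Rmult_le_compat_r; [easy|].
  replace (9 * s / kappa * q) with (9 * (s / kappa) * q) by (field; lra). nra.
Qed.

End PowerBound.

Lemma vsum_shift {X : NormedModule C_AbsRing} (u : nat -> X) n :
  vsum u (S n) = vplus (u 0%nat) (vsum (fun k => u (S k)) n).
Proof.
induction n as [|n IH].
- now rewrite vsum_S, !vsum_0.
- rewrite vsum_S, IH, vsum_S. module_eq.
Qed.

Lemma geometric_sum_le (q : R) n : 0 <= q <= / 2 -> sum_n (fun k => q ^ k) n <= 2.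
Proof.
intros Hq. enough (H : sum_n (fun k => q ^ k) n <= 2 - q ^ n).
{ assert (0 <= q ^ n) by (apply pow_le; lra). lra. }
induction n as [|n IH].
- rewrite sum_O; simpl; lra.
- rewrite sum_n_S_R. assert (0 <= q ^ n) by (apply pow_le; lra). simpl pow in *. nra.
Qed.

Lemma bin_1_r n : bin n 1 = INR n.
Proof.
induction n as [|n IH]; [reflexivity|].
rewrite bin_S_S, bin_0_r, IH, S_INR. ring.
Qed.

(** * Powers of the sheared operator [V + theta (V - 1)] *)

Section Binomial.
Context {X : NormedModule C_AbsRing} {N : X -> R} (HN : seminorm N).
Context {V : X -> X} (HV : linear_map V) (HcV : contraction N V).
Local Notation W := (@diff1 X V).

Definition shear (th : C) (x : X) : X := vplus (V x) (vscal th (W x)).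

Lemma lin_shear th : linear_map (shear th).
Proof.
unfold shear, diff1; split; intros.
- rewrite (lin_plus V HV). module_eq.
- rewrite (lin_scal V HV). module_eq.
Qed.

Definition shear_term (th : C) n x m : X :=
  vscal (RtoC (bin n m) * th ^ m)%C (Nat.iter m W (Nat.iter (n - m) V x)).

Lemma shear_binomial th n x : Nat.iter n (shear th) x = vsum (shear_term th n x) n.
Proof.
induction n as [|n IH].
- rewrite vsum_0. unfold shear_term. simpl. module_eq.
- simpl Nat.iter. rewrite IH, (lin_sum _ _ _ (lin_shear th)).
  set (u := fun m => vscal (RtoC (bin n m) * th ^ m)%C (Nat.iter m W (Nat.iter (S n - m) V x))).
  assert (Hu : vsum u n = vsum u (S n)).
  { rewrite vsum_S. unfold u at 3. rewrite bin_gt by lia. module_eq. }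
  rewrite (vsum_ext _ (fun i => vplus (u i)
    (vscal (RtoC (bin n i) * th ^ (S i))%C (Nat.iter (S i) W (Nat.iter (n - i) V x))))).
  + rewrite vsum_plus, Hu, !vsum_shift.
    rewrite (vsum_ext (fun k => shear_term th (S n) x (S k)) (fun i => vplus (u (S i))
      (vscal (RtoC (bin n i) * th ^ (S i))%C (Nat.iter (S i) W (Nat.iter (n - i) V x))))).
    * rewrite vsum_plus. unfold shear_term, u. rewrite !bin_0_r. module_eq.
    * intros k Hk. unfold u, shear_term. rewrite bin_S_S, RtoC_plus.
      change (S n - S k)%nat with (n - k)%nat. module_eq.
  + intros k Hk. unfold u, shear_term, shear.
    rewrite (lin_scal V HV), (lin_scal W (lin_diff1 HV)).
    rewrite <- (iter_comm W V k) by apply (diff1_comm HV).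
    replace (S n - k)%nat with (S (n - k)) by lia. rewrite Cpow_S. simpl Nat.iter. module_eq.
Qed.

Context {kappa : R} (Hk : 0 < kappa <= 1).
Context (Hlow : forall phi y, Rabs phi <= PI ->
  kappa * Rabs phi * N y <= N (vminus (vscal (cis phi) y) (V y))).

(** Either [2 (n - m) + 1 >= n], so that the decay of [V^(n - m)] is already of order [1 / n], or
    [m] exceeds [n / 2] and the trivial bound [2^m] is good enough. *)
Lemma power_decay_complement n m x : (m <= n)%nat -> (1 <= n)%nat ->
  N (Nat.iter m W (Nat.iter (n - m) V x))
  <= 9 * INR (2 * m + 5) / kappa * (15 * INR (2 * m + 5) / (kappa * INR n)) ^ m * N x.
Proof.
intros Hm Hn.
set (s := INR (2 * m + 5)).
assert (Hs : 5 <= s).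
{ unfold s. rewrite plus_INR. generalize (pos_INR (2 * m)). simpl (INR 5). lra. }
assert (Hx := sn_ge_0 HN x).
assert (Hn0 : 1 <= INR n) by (now apply (le_INR 1)).
assert (Hsk : s <= s / kappa) by (apply (Rle_div_r s s kappa); nra).
destruct (le_lt_dec n (S (2 * (n - m)))) as [H|H].
- eapply Rle_trans; [apply (power_decay HN HV HcV Hk Hlow)|]. fold s.
  apply Rmult_le_compat_r; [easy|].
  apply le_INR in H.
  apply Rmult_le_compat_l; [apply Rdiv_le_0_compat; lra|].
  apply pow_incr. split.
  + apply Rdiv_le_0_compat; nra.
  + unfold Rdiv. apply Rmult_le_compat_l; [lra|]. apply Rinv_le_contravar; nra.
- assert (H1 : INR n <= s) by (unfold s; apply le_INR; lia).
  eapply Rle_trans; [apply (diff1_iter_le HN HcV)|].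
  assert (H2 : 2 ^ m <= (15 * s / (kappa * INR n)) ^ m).
  { apply pow_incr. split; [lra|]. apply (Rle_div_r 2 (15 * s) (kappa * INR n)); nra. }
  generalize (contraction_iter V (n - m) HcV x); intros H3.
  assert (H4 : 0 <= 2 ^ m) by (apply pow_le; lra).
  set (q := (15 * s / (kappa * INR n)) ^ m) in *.
  apply Rle_trans with (q * N x).
  { apply Rmult_le_compat; try easy. apply (sn_ge_0 HN). }
  apply Rmult_le_compat_r; [easy|].
  replace (9 * s / kappa * q) with (9 * (s / kappa) * q) by (field; lra). nra.
Qed.

Lemma affine_le_pow2 m : INR (2 * m + 5) <= 5 * 2 ^ m.
Proof.
induction m as [|m IH]; [simpl; lra|].
replace (2 * S m + 5)%nat with (2 * m + 5 + 2)%nat by lia.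
rewrite plus_INR. simpl (INR 2). simpl pow.
assert (1 <= 2 ^ m) by (apply pow_R1_Rle; lra). lra.
Qed.

(** With [s = 2 m + 5], the estimates [bin n m <= n^m / m!], [s^m / m! <= exp s <= 3^s = 243 * 9^m]
    and [s <= 5 * 2^m] leave a geometric term; [10935 = 9 * 5 * 243] and [270 = 15 * 2 * 9]. The
    powers of [n] cancel. *)
Lemma shear_term_bound th n m x : (m <= n)%nat -> (1 <= n)%nat ->
  N (shear_term th n x m) <= 10935 / kappa * (270 * Cmod th / kappa) ^ m * N x.
Proof.
intros Hm Hn. unfold shear_term.
rewrite (sn_scal N HN), Cmod_mult, Cmod_R, Cmod_pow, Rabs_pos_eq by apply bin_ge_0.
assert (Hx := sn_ge_0 HN x).
assert (Hn0 : 0 < INR n) by (apply lt_0_INR; lia).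
assert (Ht := Cmod_ge_0 th).
set (s := INR (2 * m + 5)).
assert (Hs : 0 <= s) by apply pos_INR.
assert (Hf := INR_fact_lt_0 m).
apply Rle_trans with (INR n ^ m / INR (fact m) * Cmod th ^ m
   * (9 * s / kappa * (15 * s / (kappa * INR n)) ^ m * N x)).
{ apply Rmult_le_compat.
  - apply Rmult_le_pos; [apply bin_ge_0 | now apply pow_le].
  - apply (sn_ge_0 HN).
  - apply Rmult_le_compat_r; [now apply pow_le|].
    apply (Rle_div_r (bin n m) (INR n ^ m) (INR (fact m))); [easy|].
    rewrite Rmult_comm. apply bin_le_pow.
  - now apply power_decay_complement. }
replace (INR n ^ m / INR (fact m) * Cmod th ^ m
   * (9 * s / kappa * (15 * s / (kappa * INR n)) ^ m * N x))
  with (9 / kappa * s * (s ^ m / INR (fact m)) * (15 * Cmod th / kappa) ^ m * N x).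
2:{ replace (15 * s / (kappa * INR n)) with (s * (15 / kappa) * / INR n) by (field; lra).
    replace (15 * Cmod th / kappa) with ((15 / kappa) * Cmod th) by (field; lra).
    rewrite !Rpow_mult_distr, (pow_inv (INR n)). field.
    repeat split; try lra. apply pow_nonzero; lra. }
apply Rmult_le_compat_r; [easy|].
assert (He : s ^ m / INR (fact m) <= 243 * 9 ^ m).
{ eapply Rle_trans; [now apply pow_div_fact_le_exp|].
  replace (243 * 9 ^ m) with (3 ^ (2 * m + 5)).
  2:{ rewrite pow_add, pow_mult. simpl (3 ^ 5). replace (3 ^ 2) with 9 by ring. ring. }
  unfold s. rewrite <- (Rmult_1_r (INR _)).
  assert (Hexp : forall k, exp (INR k * 1) <= 3 ^ k).
  { induction k as [|k IH].
    - simpl. rewrite Rmult_0_l, exp_0. lra.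
    - rewrite S_INR, Rmult_plus_distr_r, exp_plus, Rmult_1_l. simpl pow.
      rewrite (Rmult_comm 3). apply Rmult_le_compat; try (left; apply exp_pos); [easy|apply exp_le_3]. }
  apply Hexp. }
assert (Hsp : s <= 5 * 2 ^ m) by apply affine_le_pow2.
assert (H2 : 0 <= 2 ^ m) by (apply pow_le; lra).
assert (H9 : 0 <= 9 ^ m) by (apply pow_le; lra).
set (q := (15 * Cmod th / kappa) ^ m).
assert (Hq : 0 <= q) by (apply pow_le, Rdiv_le_0_compat; lra).
replace ((270 * Cmod th / kappa) ^ m) with (2 ^ m * 9 ^ m * q).
2:{ unfold q. rewrite <- !Rpow_mult_distr. f_equal. field; lra. }
replace (10935 / kappa * (2 ^ m * 9 ^ m * q))
  with (9 / kappa * (5 * 2 ^ m) * (243 * 9 ^ m) * q) by (field; lra).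
assert (0 <= 9 / kappa) by (apply Rdiv_le_0_compat; lra).
apply Rmult_le_compat_r; [easy|].
apply Rmult_le_compat.
- now apply Rmult_le_pos.
- apply Rdiv_le_0_compat; [now apply pow_le|easy].
- now apply Rmult_le_compat_l.
- easy.
Qed.

(** The constant [540 = 2 * 270] makes the ratio of the geometric series at most [1/2], hence
    [21870 = 2 * 10935]. *)
Lemma shear_power_bound th n x :
  540 * Cmod th <= kappa -> N (Nat.iter n (shear th) x) <= 21870 / kappa * N x.
Proof.
intros Hth. assert (Hx := sn_ge_0 HN x).
destruct n as [|n].
{ simpl. assert (1 <= 21870 / kappa); [|nra].
  apply (Rle_div_r 1 21870 kappa); lra. }
rewrite shear_binomial. eapply Rle_trans; [apply (sn_sum HN)|].
set (q := 270 * Cmod th / kappa).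
assert (Hq : 0 <= q <= / 2).
{ unfold q. split.
  - apply Rdiv_le_0_compat; [generalize (Cmod_ge_0 th)|]; lra.
  - apply (Rle_div_l (270 * Cmod th) (/ 2) kappa); lra. }
apply Rle_trans with (sum_n (fun m => 10935 / kappa * N x * q ^ m) (S n)).
- apply sum_n_le; intros m Hm. eapply Rle_trans; [apply shear_term_bound; lia|].
  fold q. right; ring.
- rewrite sum_n_scal_R. generalize (geometric_sum_le q (S n) Hq); intros Hg.
  replace (21870 / kappa * N x) with (10935 / kappa * N x * 2) by (field; lra).
  apply Rmult_le_compat_l; [|easy]. apply Rmult_le_pos; [apply Rdiv_le_0_compat; lra | easy].
Qed.

(** The remainder consists of the binomial terms of index at least [2]. Its bound does not depend on
    [n], so it survives the limit and yields complex differentiability. *)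
Lemma shear_power_taylor th n x :
  540 * Cmod th <= kappa ->
  N (vminus (Nat.iter (S n) (shear th) x)
       (vplus (Nat.iter (S n) V x) (vscal (INR (S n) * th)%C (W (Nat.iter n V x)))))
  <= 21870 / kappa * (270 * Cmod th / kappa) ^ 2 * N x.
Proof.
intros Hth. assert (Hx := sn_ge_0 HN x).
set (q := 270 * Cmod th / kappa).
assert (Hq : 0 <= q <= / 2).
{ unfold q. split.
  - apply Rdiv_le_0_compat; [generalize (Cmod_ge_0 th)|]; lra.
  - apply (Rle_div_l (270 * Cmod th) (/ 2) kappa); lra. }
assert (Hk1 : 0 <= 21870 / kappa) by (apply Rdiv_le_0_compat; lra).
rewrite shear_binomial.
assert (E0 : shear_term th (S n) x 0 = Nat.iter (S n) V x).
{ unfold shear_term. rewrite bin_0_r, Nat.sub_0_r. simpl Nat.iter. simpl Cpow. module_eq. }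
assert (E1 : shear_term th (S n) x 1 = vscal (INR (S n) * th)%C (W (Nat.iter n V x))).
{ unfold shear_term. rewrite bin_1_r. replace (S n - 1)%nat with n by lia.
  simpl Nat.iter. rewrite Cpow_1_r. reflexivity. }
destruct n as [|n].
- rewrite vsum_S, vsum_0, E0, E1.
  match goal with |- N ?y <= _ => replace y with (vzero : X) by module_eq end.
  rewrite (sn_zero HN). apply Rmult_le_pos; [|easy]. apply Rmult_le_pos; [easy|apply pow2_ge_0].
- rewrite !vsum_shift, E0, E1.
  match goal with |- N ?y <= _ =>
    replace y with (vsum (fun k => shear_term th (S (S n)) x (S (S k))) n) by module_eq end.
  eapply Rle_trans; [apply (sn_sum HN)|].
  apply Rle_trans with (sum_n (fun m => 10935 / kappa * q ^ 2 * N x * q ^ m) n).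
  + apply sum_n_le; intros m Hm. eapply Rle_trans; [apply shear_term_bound; lia|].
    fold q. right. simpl pow. ring.
  + rewrite sum_n_scal_R. generalize (geometric_sum_le q n Hq); intros Hg.
    replace (21870 / kappa * q ^ 2 * N x) with (10935 / kappa * q ^ 2 * N x * 2) by (field; lra).
    apply Rmult_le_compat_l; [|easy].
    apply Rmult_le_pos; [|easy]. apply Rmult_le_pos; [|apply pow2_ge_0].
    apply Rdiv_le_0_compat; lra.
Qed.

End Binomial.

(** * Limits of commuting operators *)

Section Telescoping.
Context {X : NormedModule C_AbsRing} {N : X -> R} (HN : seminorm N).

Lemma iter_mult (A : X -> X) n p x : Nat.iter (n * p) A x = Nat.iter n (Nat.iter p A) x.
Proof.
induction n as [|n IH]; [reflexivity|].
change (S n * p)%nat with (p + n * p)%nat. rewrite Nat.iter_add, IH. reflexivity.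
Qed.

Lemma iter_comp (A B : X -> X) n x : (forall y, A (B y) = B (A y)) ->
  Nat.iter n (fun y => A (B y)) x = Nat.iter n A (Nat.iter n B x).
Proof.
intros H. induction n as [|n IH]; [reflexivity|].
simpl Nat.iter. rewrite IH. f_equal.
rewrite <- (iter_comm A B n) by exact H. reflexivity.
Qed.

(** Writes [A^n - B^n] as the sum of the [A^k B^(n - 1 - k) (A - B)]. Uniform bounds on powers thus
    turn a one-step error into a convergence estimate; all comparisons of Euler schemes below rest
    on this. *)
Lemma power_minus_le (A B : X -> X) (a b : R) n x :
  linear_map A -> linear_map B -> (forall y, A (B y) = B (A y)) ->
  0 <= a -> 0 <= b ->
  (forall i y, N (Nat.iter i A y) <= a * N y) ->
  (forall i y, N (Nat.iter i B y) <= b * N y) ->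
  N (vminus (Nat.iter n A x) (Nat.iter n B x)) <= INR n * (a * b * N (vminus (A x) (B x))).
Proof.
intros HA HB Hc Ha Hb Na Nb.
set (d := N (vminus (A x) (B x))).
assert (H : forall k, (k <= n)%nat ->
  N (vminus (Nat.iter k A (Nat.iter (n - k) B x)) (Nat.iter n B x)) <= INR k * (a * b * d)).
{ induction k as [|k IH]; intros Hk.
  - simpl. rewrite Nat.sub_0_r.
    replace (vminus (Nat.iter n B x) (Nat.iter n B x)) with (vzero : X) by module_eq.
    rewrite (sn_zero HN). lra.
  - eapply Rle_trans; [apply (sn_minus_trans HN _ (Nat.iter k A (Nat.iter (n - k) B x)))|].
    rewrite S_INR, Rmult_plus_distr_r, Rmult_1_l, Rplus_comm.
    apply Rplus_le_compat; [apply IH; lia|].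
    replace (n - k)%nat with (S (n - S k)) by lia. set (m := (n - S k)%nat).
    assert (E : vminus (Nat.iter (S k) A (Nat.iter m B x)) (Nat.iter k A (Nat.iter (S m) B x))
      = Nat.iter k A (Nat.iter m B (vminus (A x) (B x)))).
    { rewrite (lin_minus _ _ _ (lin_iter B m HB)), (lin_minus _ _ _ (lin_iter A k HA)).
      rewrite (iter_comm B A m) by (intros; now rewrite Hc).
      rewrite (iter_S_r B m), (iter_S_r A k). reflexivity. }
    rewrite E. eapply Rle_trans; [apply Na|].
    rewrite Rmult_assoc. apply Rmult_le_compat_l; [easy|]. apply Nb. }
specialize (H n (Nat.le_refl n)). now rewrite Nat.sub_diag in H.
Qed.

End Telescoping.

Section Limits.
Context {X : NormedModule C_AbsRing} {N : X -> R} (HN : seminorm N).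

Definition tends (u : nat -> X) (l : X) : Prop :=
  forall eps, 0 < eps -> exists n0, forall n, (n0 <= n)%nat -> N (vminus (u n) l) < eps.

Definition sn_cauchy (u : nat -> X) : Prop :=
  forall eps, 0 < eps -> exists n0, forall i j,
    (n0 <= i)%nat -> (i <= j)%nat -> N (vminus (u i) (u j)) < eps.

Lemma tends_cauchy u l : tends u l -> sn_cauchy u.
Proof.
intros H eps He. destruct (H (eps / 2)) as [n0 H0]; [lra|].
exists n0; intros i j Hi Hj.
generalize (sn_minus_trans HN (u i) l (u j)) (H0 i Hi) (H0 j ltac:(lia)).
rewrite (sn_minus_sym HN l). lra.
Qed.

Lemma tends_bounded u l b :
  tends u l -> (exists n0, forall n, (n0 <= n)%nat -> N (u n) <= b) -> N l <= b.
Proof.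
intros H [n1 H1]. apply Rnot_lt_le; intros Hb.
destruct (H (N l - b)) as [n0 H0]; [lra|].
generalize (H0 (max n0 n1) ltac:(lia)) (H1 (max n0 n1) ltac:(lia)).
generalize (sn_le_minus HN l (u (max n0 n1))). rewrite (sn_minus_sym HN l). lra.
Qed.

Lemma tends_ext u v l : (exists n0, forall n, (n0 <= n)%nat -> u n = v n) -> tends u l -> tends v l.
Proof.
intros [n1 H1] H eps He. destruct (H eps He) as [n0 H0].
exists (max n0 n1); intros n Hn. rewrite <- H1 by lia. apply H0; lia.
Qed.

Lemma tends_const x : tends (fun _ => x) x.
Proof.
intros eps He. exists O; intros n _.
replace (vminus x x) with (vzero : X) by module_eq. now rewrite (sn_zero HN).
Qed.

Lemma tends_near u v l :
  (forall eps, 0 < eps -> exists n0, forall n, (n0 <= n)%nat -> N (vminus (v n) (u n)) < eps) ->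
  tends u l -> tends v l.
Proof.
intros H1 H eps He. destruct (H (eps / 2)) as [n0 H0]; [lra|].
destruct (H1 (eps / 2)) as [n1 H2]; [lra|].
exists (max n0 n1); intros n Hn.
generalize (sn_minus_trans HN (v n) (u n) l) (H0 n ltac:(lia)) (H2 n ltac:(lia)). lra.
Qed.

Lemma tends_plus u v l m : tends u l -> tends v m -> tends (fun n => vplus (u n) (v n)) (vplus l m).
Proof.
intros Hu Hv eps He.
destruct (Hu (eps / 2)) as [n0 H0]; [lra|]. destruct (Hv (eps / 2)) as [n1 H1]; [lra|].
exists (max n0 n1); intros n Hn.
replace (vminus (vplus (u n) (v n)) (vplus l m)) with (vplus (vminus (u n) l) (vminus (v n) m)) by module_eq.
generalize (sn_triangle N HN (vminus (u n) l) (vminus (v n) m)) (H0 n ltac:(lia)) (H1 n ltac:(lia)). lra.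
Qed.

Lemma tends_lin (A : X -> X) (a : R) u l :
  linear_map A -> (forall x, N (A x) <= a * N x) -> tends u l -> tends (fun n => A (u n)) (A l).
Proof.
intros HA Ha Hu eps He.
assert (Hb : 0 < Rabs a + 1) by (generalize (Rabs_pos a); lra).
destruct (Hu (eps / (Rabs a + 1))) as [n0 H0]; [now apply Rdiv_lt_0_compat|].
exists n0; intros n Hn. rewrite <- (lin_minus A) by easy.
eapply Rle_lt_trans; [apply Ha|].
specialize (H0 n Hn). apply (Rlt_div_r (N (vminus (u n) l)) eps (Rabs a + 1)) in H0; [|easy].
generalize (sn_ge_0 HN (vminus (u n) l)) (Rle_abs a). intros; nra.
Qed.

Lemma tends_scal c u l : tends u l -> tends (fun n => vscal c (u n)) (vscal c l).
Proof.
apply (tends_lin (fun x => vscal c x) (Cmod c)).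
- split; intros; module_eq.
- intros x. rewrite (sn_scal N HN). lra.
Qed.

Lemma tends_minus u v l m : tends u l -> tends v m -> tends (fun n => vminus (u n) (v n)) (vminus l m).
Proof.
intros Hu Hv.
replace (vminus l m) with (vplus l (vscal (- RtoC 1)%C m)) by module_eq.
apply (tends_ext (fun n => vplus (u n) (vscal (- RtoC 1)%C (v n)))).
- exists O; intros; module_eq.
- apply tends_plus; [easy|]. now apply tends_scal.
Qed.

Lemma tends_shift k u l : tends u l -> tends (fun n => u (k + n)%nat) l.
Proof.
intros H eps He. destruct (H eps He) as [n0 H0]. exists n0; intros; apply H0; lia.
Qed.

Lemma tends_unshift k u l : tends (fun n => u (k + n)%nat) l -> tends u l.
Proof.
intros H eps He. destruct (H eps He) as [n0 H0]. exists (k + n0)%nat; intros n Hn.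
replace n with (k + (n - k))%nat by lia. apply H0; lia.
Qed.

Context (Hsep : forall x, N x = 0 -> x = vzero).

Lemma tends_unique u l m : tends u l -> tends u m -> l = m.
Proof.
intros Hl Hm.
assert (H : N (vminus l m) <= 0).
{ apply (tends_bounded (fun n => vminus (u n) (u n))).
  - now apply tends_minus.
  - exists O; intros n _. replace (vminus (u n) (u n)) with (vzero : X) by module_eq.
    rewrite (sn_zero HN); lra. }
assert (E : vminus l m = vzero) by (apply Hsep; generalize (sn_ge_0 HN (vminus l m)); lra).
replace l with (vplus m (vminus l m)) by module_eq. rewrite E. module_eq.
Qed.

Lemma cauchy_of_dense (P : nat -> X -> X) (a : R) (D : X -> Prop) x :
  (forall j, linear_map (P j)) -> 0 <= a ->
  (exists j0, forall j y, (j0 <= j)%nat -> N (P j y) <= a * N y) ->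
  (forall y, D y -> sn_cauchy (fun j => P j y)) ->
  (forall eps, 0 < eps -> exists y, D y /\ N (vminus x y) < eps) ->
  sn_cauchy (fun j => P j x).
Proof.
intros HP Ha [j0 Hj0] HD Hdense eps He.
destruct (Hdense (eps / 3 / (a + 1))) as [y [Hy Hxy]]; [repeat apply Rdiv_lt_0_compat; lra|].
apply (Rlt_div_r (N (vminus x y)) (eps / 3) (a + 1)) in Hxy; [|lra].
destruct (HD y Hy (eps / 3)) as [n0 H0]; [lra|].
exists (max j0 n0); intros i j Hi Hij.
assert (HB : forall k, (j0 <= k)%nat -> N (vminus (P k x) (P k y)) < eps / 3).
{ intros k Hk. rewrite <- (lin_minus (P k)) by apply HP.
  eapply Rle_lt_trans; [now apply Hj0|]. generalize (sn_ge_0 HN (vminus x y)). nra. }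
generalize (sn_minus_trans HN (P i x) (P i y) (P j x)) (sn_minus_trans HN (P i y) (P j y) (P j x)).
generalize (HB i ltac:(lia)) (HB j ltac:(lia)) (H0 i j ltac:(lia) Hij).
rewrite (sn_minus_sym HN (P j y) (P j x)). lra.
Qed.

End Limits.

Arguments tends {X} N u l.
Arguments sn_cauchy {X} N u.

(** * Smooth vectors of a contraction semigroup *)

Record contraction_semigroup {X : NormedModule C_AbsRing} (N : X -> R) (T : R -> X -> X) : Prop := {
  cs_lin : forall t, 0 <= t -> linear_map (T t);
  cs_contraction : forall t, 0 <= t -> contraction N (T t);
  cs_id : forall x, T 0 x = x;
  cs_add : forall t s x, 0 <= t -> 0 <= s -> T (t + s) x = T t (T s x);
  cs_cont : forall x eps, 0 < eps ->
    exists d, 0 < d /\ forall t, 0 <= t < d -> N (vminus (T t x) x) < eps }.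

Lemma div_pow2_lt (t d : R) : 0 <= t -> 0 < d -> exists n0, forall n, (n0 <= n)%nat -> t / 2 ^ n < d.
Proof.
intros Ht Hd. destruct (nfloor_ex (t / d)) as [k Hk]; [now apply Rdiv_le_0_compat|].
exists (S k); intros n Hn.
assert (H2 : forall m, INR m <= 2 ^ m).
{ induction m as [|m IH]; [simpl; lra|]. rewrite S_INR. simpl pow.
  assert (1 <= 2 ^ m) by (apply pow_R1_Rle; lra). lra. }
assert (H3 : t / d < 2 ^ n).
{ apply le_INR in Hn. rewrite S_INR in Hn. generalize (H2 n). lra. }
apply (Rlt_div_l t d (2 ^ n)); [apply pow_lt; lra|].
apply (Rlt_div_l t (2 ^ n) d) in H3; [|easy]. lra.
Qed.

Section Averages.
Context {X : NormedModule C_AbsRing} {N : X -> R} (HN : seminorm N).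
Context {T : R -> X -> X} (HT : contraction_semigroup N T).

Lemma cs_comm t s x : 0 <= t -> 0 <= s -> T t (T s x) = T s (T t x).
Proof. intros Ht Hs. rewrite <- !(cs_add N T HT) by easy. f_equal; ring. Qed.

Lemma cs_iter t n x : 0 <= t -> Nat.iter n (T t) x = T (INR n * t) x.
Proof.
intros Ht. induction n as [|n IH].
- simpl. now rewrite Rmult_0_l, (cs_id N T HT).
- simpl Nat.iter. rewrite IH, <- (cs_add N T HT) by (try apply Rmult_le_pos; try apply pos_INR; easy).
  f_equal. rewrite S_INR. ring.
Qed.

(* The left Riemann sum of [(1 / t) int_0^t T s x ds] on [2 ^ j] equal intervals. *)
Fixpoint dyadic_mean (t : R) (j : nat) (x : X) : X :=
  match j with
  | O => x
  | S j' => vscal (RtoC (/ 2)) (vplus (dyadic_mean (t / 2) j' x) (T (t / 2) (dyadic_mean (t / 2) j' x)))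
  end.

Lemma lin_dyadic_mean t j : 0 <= t -> linear_map (dyadic_mean t j).
Proof.
revert t; induction j as [|j IH]; intros t Ht; [apply lin_id|].
assert (H := IH (t / 2) ltac:(lra)). assert (HTt := cs_lin N T HT (t / 2) ltac:(lra)).
split; intros; simpl.
- rewrite (lin_plus _ H), (lin_plus _ HTt). module_eq.
- rewrite (lin_scal _ H), (lin_scal _ HTt). module_eq.
Qed.

Lemma half_mean_le (a b : X) (e : R) :
  N a <= e -> N b <= e -> N (vscal (RtoC (/ 2)) (vplus a b)) <= e.
Proof.
intros Ha Hb. rewrite (sn_scal N HN), Cmod_R, Rabs_pos_eq by lra.
generalize (sn_triangle N HN a b). lra.
Qed.

Lemma dyadic_mean_comm t j s x : 0 <= t -> 0 <= s ->
  dyadic_mean t j (T s x) = T s (dyadic_mean t j x).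
Proof.
intros Ht Hs. revert t Ht; induction j as [|j IH]; intros t Ht; [reflexivity|].
simpl. rewrite IH by lra. assert (HTs := cs_lin N T HT s Hs).
rewrite (lin_scal _ HTs), (lin_plus _ HTs), (cs_comm s) by lra. reflexivity.
Qed.

Lemma dyadic_mean_near t j u x e : 0 <= t -> 0 <= u ->
  (forall s, u <= s <= u + t -> N (vminus (T s x) x) <= e) ->
  N (vminus (T u (dyadic_mean t j x)) x) <= e.
Proof.
revert t u; induction j as [|j IH]; intros t u Ht Hu He; simpl; [apply He; lra|].
assert (HTu := cs_lin N T HT u Hu).
rewrite (lin_scal _ HTu), (lin_plus _ HTu), <- (cs_add N T HT) by lra.
match goal with |- N ?y <= _ => replace y with
  (vscal (RtoC (/ 2)) (vplus (vminus (T u (dyadic_mean (t / 2) j x)) x)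
                             (vminus (T (u + t / 2) (dyadic_mean (t / 2) j x)) x))) end.
- apply half_mean_le; apply IH; try lra; intros s Hs; apply He; lra.
- module_eq; rewrite RtoC_inv by lra; field.
Qed.

Lemma dyadic_mean_cauchy t j k x e : 0 <= t ->
  (forall s, 0 <= s <= t / 2 ^ j -> N (vminus (T s x) x) <= e) ->
  N (vminus (dyadic_mean t (j + k) x) (dyadic_mean t j x)) <= e.
Proof.
revert t; induction j as [|j IH]; intros t Ht He.
- simpl. rewrite <- (cs_id N T HT (dyadic_mean t k x)). apply dyadic_mean_near; try lra.
  intros s Hs. apply He. simpl. lra.
- assert (HTt := cs_lin N T HT (t / 2) ltac:(lra)).
  assert (H : N (vminus (dyadic_mean (t / 2) (j + k) x) (dyadic_mean (t / 2) j x)) <= e).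
  { apply IH; [lra|]. intros s Hs. apply He. simpl pow.
    replace (t / (2 * 2 ^ j)) with (t / 2 / 2 ^ j); [easy|]. field. apply pow_nonzero; lra. }
  simpl.
  match goal with |- N ?y <= _ => replace y with
    (vscal (RtoC (/ 2)) (vplus
       (vminus (dyadic_mean (t / 2) (j + k) x) (dyadic_mean (t / 2) j x))
       (T (t / 2) (vminus (dyadic_mean (t / 2) (j + k) x) (dyadic_mean (t / 2) j x))))) end.
  + apply half_mean_le; [easy|]. eapply Rle_trans; [apply (cs_contraction N T HT); lra | easy].
  + rewrite (lin_minus _ _ _ HTt). module_eq.
Qed.

(** The discrete form of [(T h - 1) int_0^t T s x ds = int_0^h T s (T t - 1) x ds] for
    [h = t / 2^k]. *)
Lemma dyadic_mean_telescope t k j x : 0 <= t ->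
  vminus (T (t / 2 ^ k) (dyadic_mean t (k + j) x)) (dyadic_mean t (k + j) x)
  = vscal (RtoC (/ 2 ^ k)) (dyadic_mean (t / 2 ^ k) j (vminus (T t x) x)).
Proof.
revert t x; induction k as [|k IH]; intros t x Ht.
- simpl. replace (t / 1) with t by field. rewrite Rinv_1.
  rewrite (lin_minus _ _ _ (lin_dyadic_mean t j Ht)), dyadic_mean_comm by easy. module_eq.
- assert (Hk : 0 < 2 ^ k) by (apply pow_lt; lra).
  assert (Et : t / 2 ^ S k = t / 2 / 2 ^ k) by (simpl pow; field; lra).
  assert (Hp : 0 <= t / 2 / 2 ^ k) by (apply Rdiv_le_0_compat; lra).
  rewrite Et. simpl (S k + j)%nat. simpl dyadic_mean.
  assert (HTs := cs_lin N T HT (t / 2 / 2 ^ k) Hp).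
  assert (HTt := cs_lin N T HT (t / 2) ltac:(lra)).
  rewrite (lin_scal _ HTs), (lin_plus _ HTs), (cs_comm (t / 2 / 2 ^ k)) by lra.
  transitivity (vscal (RtoC (/ 2)) (vplus
     (vminus (T (t / 2 / 2 ^ k) (dyadic_mean (t / 2) (k + j) x)) (dyadic_mean (t / 2) (k + j) x))
     (T (t / 2) (vminus (T (t / 2 / 2 ^ k) (dyadic_mean (t / 2) (k + j) x)) (dyadic_mean (t / 2) (k + j) x))))).
  { rewrite (lin_minus _ _ _ HTt). module_eq. }
  rewrite !IH by lra.
  assert (HD := lin_dyadic_mean (t / 2 / 2 ^ k) j Hp).
  rewrite (lin_scal _ HTt), <- dyadic_mean_comm by lra.
  rewrite (lin_minus _ _ _ HTt), <- (cs_add N T HT) by lra.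
  replace (t / 2 + t / 2) with t by field.
  rewrite !(lin_minus _ _ _ HD).
  assert (Ei : RtoC (/ 2 ^ S k) = (RtoC (/ 2) * RtoC (/ 2 ^ k))%C).
  { rewrite <- RtoC_mult. f_equal. simpl pow. field. lra. }
  rewrite Ei. module_eq.
Qed.

Definition quot (s : R) (x : X) : X := vscal (RtoC (/ s)) (vminus (T s x) x).

(** A substitute for the domain of the generator, tested along dyadic steps only; the generator
    itself is never introduced. *)
Definition smooth (x : X) : Prop := sn_cauchy N (fun j => quot (/ 2 ^ j) x).

Context (Hsep : forall x, N x = 0 -> x = vzero).
Context {lim_seq : (nat -> X) -> X}.
Context (Hlim : forall u, sn_cauchy N u -> tends N u (lim_seq u)).

Lemma dyadic_mean_tends t x : 0 <= t -> tends N (fun j => dyadic_mean t j x) (lim_seq (fun j => dyadic_mean t j x)).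
Proof.
intros Ht. apply Hlim. intros eps He.
destruct (cs_cont N T HT x (eps / 2)) as (d & Hd & Hc); [lra|].
destruct (div_pow2_lt t d Ht Hd) as [n0 H0].
exists n0; intros i j Hi Hij.
rewrite (sn_minus_sym HN). replace j with (i + (j - i))%nat by lia.
apply Rle_lt_trans with (eps / 2); [|lra].
apply dyadic_mean_cauchy; [easy|]. intros s Hs. left. apply Hc.
specialize (H0 i Hi). lra.
Qed.

Lemma mean_near t x e : 0 <= t ->
  (forall s, 0 <= s <= t -> N (vminus (T s x) x) <= e) ->
  N (vminus (lim_seq (fun j => dyadic_mean t j x)) x) <= e.
Proof.
intros Ht He.
apply (tends_bounded HN (fun j => vminus (dyadic_mean t j x) x)).
- apply (tends_minus HN); [now apply dyadic_mean_tends | apply (tends_const HN)].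
- exists O; intros n _. rewrite <- (cs_id N T HT (dyadic_mean t n x)).
  apply dyadic_mean_near; try lra. intros s Hs. apply He; lra.
Qed.

Lemma quot_mean q k x :
  quot (/ 2 ^ (q + k)) (lim_seq (fun j => dyadic_mean (/ 2 ^ q) j x))
  = lim_seq (fun j => dyadic_mean (/ 2 ^ (q + k)) j (quot (/ 2 ^ q) x)).
Proof.
assert (Hq : 0 < 2 ^ q) by (apply pow_lt; lra).
assert (Hk : 0 < 2 ^ k) by (apply pow_lt; lra).
assert (Hqi : 0 < / 2 ^ q) by (now apply Rinv_0_lt_compat).
assert (E : / 2 ^ (q + k) = / 2 ^ q / 2 ^ k) by (rewrite pow_add; field; lra).
set (s := / 2 ^ (q + k)) in *.
assert (Hs : 0 <= s) by (rewrite E; apply Rdiv_le_0_compat; lra).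
assert (HTs := cs_lin N T HT s Hs).
apply (tends_unique HN Hsep (fun j => quot s (dyadic_mean (/ 2 ^ q) (k + j) x))).
- unfold quot. apply (tends_scal HN). 
  assert (Ht : tends N (fun j => dyadic_mean (/ 2 ^ q) (k + j) x) (lim_seq (fun j => dyadic_mean (/ 2 ^ q) j x))).
  { apply (tends_shift (N := N) k (fun j => dyadic_mean (/ 2 ^ q) j x)). apply dyadic_mean_tends; lra. }
  apply (tends_minus HN); [|exact Ht].
  apply (tends_lin HN (T s) 1); [easy| |exact Ht].
  intros y. rewrite Rmult_1_l. now apply (cs_contraction N T HT).
- apply (tends_ext (fun j => dyadic_mean s j (quot (/ 2 ^ q) x))).
  + exists O; intros j _. unfold quot at 2. rewrite E, dyadic_mean_telescope by lra. rewrite <- E.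
    unfold quot. rewrite (lin_scal _ (lin_dyadic_mean s j Hs)).
    replace (RtoC (/ s)) with (RtoC (/ / 2 ^ q) * RtoC (2 ^ k))%C.
    2:{ rewrite <- RtoC_mult. f_equal. rewrite E. field. lra. }
    rewrite <- (Cmult_1_r (RtoC (/ / 2 ^ q))) at 1.
    replace (RtoC 1) with (RtoC (2 ^ k) * RtoC (/ 2 ^ k))%C.
    2:{ rewrite <- RtoC_mult. f_equal. field. lra. }
    module_eq.
  + now apply dyadic_mean_tends.
Qed.

(** The difference quotients of the mean are means of [quot (/ 2 ^ q) x] over shrinking intervals,
    hence converge to this vector. *)
Lemma smooth_mean q x : smooth (lim_seq (fun j => dyadic_mean (/ 2 ^ q) j x)).
Proof.
apply (tends_cauchy HN _ (quot (/ 2 ^ q) x)). apply tends_unshift with q.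
intros eps He.
destruct (cs_cont N T HT (quot (/ 2 ^ q) x) (eps / 2)) as (d & Hd & Hc); [lra|].
destruct (div_pow2_lt 1 d ltac:(lra) Hd) as [n0 H0].
exists n0; intros k Hk. rewrite quot_mean.
assert (Hp : 0 < / 2 ^ (q + k)) by (apply Rinv_0_lt_compat, pow_lt; lra).
apply Rle_lt_trans with (eps / 2); [|lra]. apply mean_near; [lra|].
intros s Hs. left. apply Hc. specialize (H0 (q + k)%nat ltac:(lia)). lra.
Qed.

Lemma smooth_dense x eps : 0 < eps -> exists y, smooth y /\ N (vminus x y) < eps.
Proof.
intros He. destruct (cs_cont N T HT x (eps / 2)) as (d & Hd & Hc); [lra|].
destruct (div_pow2_lt 1 d ltac:(lra) Hd) as [q Hq]. specialize (Hq q (Nat.le_refl q)).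
exists (lim_seq (fun j => dyadic_mean (/ 2 ^ q) j x)). split; [apply smooth_mean|].
assert (Hp : 0 < / 2 ^ q) by (apply Rinv_0_lt_compat, pow_lt; lra).
rewrite (sn_minus_sym HN).
apply Rle_lt_trans with (eps / 2); [|lra]. apply mean_near; [lra|].
intros s Hs. left. apply Hc. lra.
Qed.

End Averages.

(** * Euler approximations of the extension *)

Lemma INR_pow8 j : INR (8 ^ j) = 8 ^ j.
Proof. rewrite pow_INR. f_equal. simpl; ring. Qed.

Lemma iter_ext {A : Type} (f g : A -> A) n x :
  (forall y, f y = g y) -> Nat.iter n f x = Nat.iter n g x.
Proof. intros H; induction n as [|n IH]; simpl; [easy|]. now rewrite IH, H. Qed.

Section Approximants.
Context {X : NormedModule C_AbsRing} {N : X -> R} (HN : seminorm N).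
Context {T : R -> X -> X} (HT : contraction_semigroup N T).
Context {kappa : R} (Hk : 0 < kappa <= 1).
Context (HL : forall s r phi y, 0 < s -> 0 < r <= / 2 -> Rabs phi <= PI ->
  kappa * Rabs phi * N y
  <= N (vminus (vscal (cis phi) y) (vplus (vscal (1 - r)%C y) (vscal (RtoC r) (T s y))))).
Context (Hsep : forall x, N x = 0 -> x = vzero).
Context {lim_seq : (nat -> X) -> X}.
Context (Hlim : forall u, sn_cauchy N u -> tends N u (lim_seq u)).
Local Notation Q := (@quot X T).
Local Notation C1 := (21870 / kappa).

(* A sector of half-angle [arctan (kappa / 540)], containing [0]. *)
Definition good (z : C) : Prop := 540 * Rabs (Im z) <= kappa * Re z.

Lemma good_Re z : good z -> 0 <= Re z.
Proof. unfold good. generalize (Rabs_pos (Im z)). intros; nra. Qed.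

Lemma good_plus z w : good z -> good w -> good (z + w)%C.
Proof.
unfold good. intros Hz Hw. simpl. unfold Re, Im in *.
generalize (Rabs_triang (snd z) (snd w)). lra.
Qed.

Lemma good_scal (a : R) z : 0 <= a -> good z -> good (RtoC a * z)%C.
Proof.
unfold good, Re, Im. intros Ha Hz. simpl.
replace (a * snd z + 0 * fst z) with (a * snd z) by ring.
replace (a * fst z - 0 * snd z) with (a * fst z) by ring.
rewrite Rabs_mult, (Rabs_pos_eq a) by easy. nra.
Qed.

Lemma Re_scal (a : R) z : Re (RtoC a * z)%C = a * Re z.
Proof. unfold Re; simpl; ring. Qed.

Lemma C1_ge_1 : 1 <= C1.
Proof. apply (Rle_div_r 1 21870 kappa); lra. Qed.

Definition euler (s : R) (c : C) (x : X) : X := vplus x (vscal c (Q s x)).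

Definition averaged (s r : R) (x : X) : X := vplus (vscal (1 - r)%C x) (vscal (RtoC r) (T s x)).

Lemma lin_quot s : 0 <= s -> linear_map (Q s).
Proof.
intros Hs. assert (H := cs_lin N T HT s Hs).
unfold quot; split; intros.
- rewrite (lin_plus _ H). module_eq.
- rewrite (lin_scal _ H). module_eq.
Qed.

Lemma lin_euler s c : 0 <= s -> linear_map (euler s c).
Proof.
intros Hs. assert (H := lin_quot s Hs).
unfold euler; split; intros.
- rewrite (lin_plus _ H). module_eq.
- rewrite (lin_scal _ H). module_eq.
Qed.

Lemma quot_comm s t x : 0 <= s -> 0 <= t -> Q s (T t x) = T t (Q s x).
Proof.
intros Hs Ht. assert (H := cs_lin N T HT t Ht). unfold quot.
rewrite (lin_scal _ H), (lin_minus _ _ _ H), (cs_comm HT s t) by easy. reflexivity.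
Qed.

Lemma quot_quot s t x : 0 <= s -> 0 <= t -> Q s (Q t x) = Q t (Q s x).
Proof.
intros Hs Ht. assert (H := lin_quot s Hs).
change (Q s (vscal (RtoC (/ t)) (vminus (T t x) x)) = Q t (Q s x)).
rewrite (lin_scal _ H), (lin_minus _ _ _ H), quot_comm by easy. reflexivity.
Qed.

Lemma euler_T s c t x : 0 <= s -> 0 <= t -> euler s c (T t x) = T t (euler s c x).
Proof.
intros Hs Ht. assert (H := cs_lin N T HT t Ht). unfold euler.
now rewrite quot_comm, (lin_plus _ H), (lin_scal _ H).
Qed.

Lemma euler_quot s c t x : 0 <= s -> 0 <= t -> euler s c (Q t x) = Q t (euler s c x).
Proof.
intros Hs Ht. assert (H := lin_quot t Ht). unfold euler.
now rewrite quot_quot, (lin_plus _ H), (lin_scal _ H).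
Qed.

Lemma euler_euler s c t d x : 0 <= s -> 0 <= t ->
  euler s c (euler t d x) = euler t d (euler s c x).
Proof.
intros Hs Ht. assert (H := lin_euler s c Hs).
change (euler s c (vplus x (vscal d (Q t x))) = euler t d (euler s c x)).
now rewrite (lin_plus _ H), (lin_scal _ H), euler_quot.
Qed.

Lemma quot_le s x : 0 < s -> N (Q s x) <= 2 / s * N x.
Proof.
intros Hs. unfold quot.
rewrite (sn_scal N HN), Cmod_R, Rabs_pos_eq by (left; now apply Rinv_0_lt_compat).
assert (H : N (vminus (T s x) x) <= 2 * N x).
{ generalize (sn_minus HN (T s x) x) (cs_contraction N T HT s (Rlt_le _ _ Hs) x). lra. }
replace (2 / s * N x) with (/ s * (2 * N x)) by (field; lra).
apply Rmult_le_compat_l; [left; now apply Rinv_0_lt_compat | easy].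
Qed.

Section Averaged.
Context {s r : R} (Hs : 0 < s) (Hr : 0 < r <= / 2).

Lemma lin_averaged : linear_map (averaged s r).
Proof.
assert (H := cs_lin N T HT s (Rlt_le _ _ Hs)). exact (lin_comb _ _ _ _ lin_id H).
Qed.

Lemma averaged_contraction : contraction N (averaged s r).
Proof.
intros x. unfold averaged. eapply Rle_trans; [apply (sn_triangle N HN)|].
rewrite !(sn_scal N HN). rewrite <- RtoC_minus, !Cmod_R, !Rabs_pos_eq by lra.
generalize (cs_contraction N T HT s (Rlt_le _ _ Hs) x) (sn_ge_0 HN x). intros; nra.
Qed.

Lemma averaged_lower phi y : Rabs phi <= PI ->
  kappa * Rabs phi * N y <= N (vminus (vscal (cis phi) y) (averaged s r y)).
Proof. intros Hphi. exact (HL s r phi y Hs Hr Hphi). Qed.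

Lemma euler_shear th x : euler s (RtoC (r * s) * (1 + th))%C x = shear (V := averaged s r) th x.
Proof.
unfold euler, shear, diff1, averaged, quot.
assert (Hs0 : RtoC s <> RtoC 0) by (intros E; apply RtoC_inj in E; lra).
module_eq; rewrite RtoC_mult, RtoC_inv by lra; field; easy.
Qed.

End Averaged.

(** With [r = Re c / s] and [th = i Im c / Re c] the step is the shear of an averaged operator:
    [2 Re c <= s] says [r <= 1/2], and [good c] says [540 |th| <= kappa]. For [Re c = 0], [good]
    forces [c = 0]. *)
Lemma euler_bound s c : 0 < s -> good c -> 2 * Re c <= s ->
  forall i y, N (Nat.iter i (euler s c) y) <= C1 * N y.
Proof.
intros Hs Hc Hcs i y.
assert (Hre := good_Re c Hc).
destruct (Req_dec (Re c) 0) as [H0|H0].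
- assert (E : c = RtoC 0).
  { unfold good in Hc. rewrite H0, Rmult_0_r in Hc.
    assert (Im c = 0).
    { destruct (Req_dec (Im c) 0) as [|Hi]; [easy|]. apply Rabs_pos_lt in Hi. lra. }
    unfold Re, Im in *. destruct c as [a b]; simpl in *. subst. reflexivity. }
  rewrite (iter_ext _ (fun z => z)).
  + replace (Nat.iter i (fun z : X => z) y) with y by (induction i; simpl; auto).
    generalize C1_ge_1 (sn_ge_0 HN y). intros; nra.
  + intros z. unfold euler. rewrite E. module_eq.
- set (r := Re c / s). set (th := (0, Im c / Re c) : C).
  assert (Hr : 0 < r <= / 2).
  { unfold r. split; [apply Rdiv_lt_0_compat; lra|]. apply (Rle_div_l (Re c) (/2) s); lra. }
  assert (Ec : c = (RtoC (r * s) * (1 + th))%C).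
  { replace (r * s) with (Re c) by (unfold r; field; lra).
    unfold th, Re, Im in *. destruct c as [a b]; simpl in *.
    unfold RtoC, Cmult, Cplus; simpl. f_equal; field; easy. }
  rewrite (iter_ext _ (shear (V := averaged s r) th)).
  2:{ intros z. rewrite Ec. now apply euler_shear. }
  apply (shear_power_bound HN (lin_averaged Hs) (averaged_contraction Hs Hr) Hk (averaged_lower Hs Hr)).
  unfold th. apply Rle_trans with (540 * (Rabs 0 + Rabs (Im c / Re c))).
  { apply Rmult_le_compat_l; [lra|apply Cmod_le_add]. }
  rewrite Rabs_R0, Rplus_0_l, Rabs_div, (Rabs_pos_eq (Re c)) by easy.
  replace (540 * (Rabs (Im c) / Re c)) with (540 * Rabs (Im c) / Re c) by (field; lra).
  apply (Rle_div_l (540 * Rabs (Im c)) kappa (Re c)); [lra|exact Hc].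
Qed.

(** One more step adds the error [(E^p - 1) y], with [E = euler s c] and [y = c Q x]; telescoping
    bounds it by [p] times the size of [c Q y], and summation over the steps gives the square of
    [p]. *)
Lemma euler_subdivide s c p x a :
  0 < s -> 0 <= a -> (forall i y, N (Nat.iter i (euler s c) y) <= a * N y) ->
  N (vminus (Nat.iter p (euler s c) x) (euler s (RtoC (INR p) * c)%C x))
  <= INR p ^ 2 * (a * (Cmod c * (2 / s)) ^ 2 * N x).
Proof.
intros Hs Ha Hb. assert (HE := lin_euler s c (Rlt_le _ _ Hs)).
set (d := N (vscal c (Q s (vscal c (Q s x))))).
assert (Hx := sn_ge_0 HN x).
assert (Hd : d <= (Cmod c * (2 / s)) ^ 2 * N x).
{ unfold d. rewrite (sn_scal N HN).
  assert (H1 := quot_le s (vscal c (Q s x)) Hs). rewrite (sn_scal N HN) in H1.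
  assert (H2 := quot_le s x Hs).
  assert (H3 : 0 <= 2 / s) by (apply Rdiv_le_0_compat; lra).
  assert (H4 := Cmod_ge_0 c).
  apply Rle_trans with (Cmod c * (2 / s * (Cmod c * (2 / s * N x)))); [|right; ring].
  apply Rmult_le_compat_l; [easy|]. eapply Rle_trans; [exact H1|].
  apply Rmult_le_compat_l; [easy|]. now apply Rmult_le_compat_l. }
assert (Hd0 : 0 <= d) by apply (sn_ge_0 HN).
apply Rle_trans with (INR p ^ 2 * (a * d)).
2:{ rewrite Rmult_assoc. apply Rmult_le_compat_l; [apply pow2_ge_0|]. now apply Rmult_le_compat_l. }
induction p as [|p IH].
- simpl Nat.iter. replace (vminus x (euler s (RtoC (INR 0) * c)%C x)) with (vzero : X).
  + rewrite (sn_zero HN). apply Rmult_le_pos; [apply pow2_ge_0|now apply Rmult_le_pos].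
  + unfold euler. simpl. module_eq.
- set (y := vscal c (Q s x)).
  assert (H1 : N (vminus (Nat.iter p (euler s c) y) (Nat.iter p (fun z => z) y)) <= INR p * (a * 1 * d)).
  { replace d with (N (vminus (euler s c y) y)).
    - apply (power_minus_le HN); try easy; try lra.
      intros i z. replace (Nat.iter i (fun z : X => z) z) with z by (induction i; simpl; auto). lra.
    - unfold d. f_equal. unfold euler, y. module_eq. }
  replace (Nat.iter p (fun z : X => z) y) with y in H1 by (clear; induction p; simpl; auto).
  replace (vminus (Nat.iter (S p) (euler s c) x) (euler s (RtoC (INR (S p)) * c)%C x))
    with (vplus (vminus (Nat.iter p (euler s c) x) (euler s (RtoC (INR p) * c)%C x))
                (vminus (Nat.iter p (euler s c) y) y)).
  2:{ simpl Nat.iter. rewrite <- iter_S_r.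
      change (euler s c x) with (vplus x y). rewrite (lin_plus _ (lin_iter _ p HE)).
      rewrite S_INR, RtoC_plus.
      generalize (Nat.iter p (euler s c) x) (Nat.iter p (euler s c) y). intros u v.
      unfold euler, y. module_eq. }
  eapply Rle_trans; [apply (sn_triangle N HN)|].
  rewrite S_INR. generalize (pos_INR p). intros.
  assert (0 <= a * d) by (now apply Rmult_le_pos). nra.
Qed.

(* With [h = 2 ^ - j] and [n = 8 ^ j], eventually [n >= 2 Re z / h], so that each factor
   is a [shear] of an [averaged] operator, while the error [n (|z| / (n h))^2] tends to [0]. *)
Definition approx (j : nat) (z : C) : X -> X :=
  Nat.iter (8 ^ j) (euler (/ 2 ^ j) (RtoC (/ 8 ^ j) * z)%C).

Lemma pow_pos_2 j : 0 < 2 ^ j. Proof. apply pow_lt; lra. Qed.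
Lemma pow_pos_8 j : 0 < 8 ^ j. Proof. apply pow_lt; lra. Qed.
Lemma inv_pow_pos_2 j : 0 < / 2 ^ j. Proof. apply Rinv_0_lt_compat, pow_pos_2. Qed.
Lemma inv_pow_pos_8 j : 0 < / 8 ^ j. Proof. apply Rinv_0_lt_compat, pow_pos_8. Qed.

Lemma pow_8_split j : 8 ^ j = 4 ^ j * 2 ^ j.
Proof. rewrite <- Rpow_mult_distr. f_equal. ring. Qed.

Lemma lin_approx j z : linear_map (approx j z).
Proof. apply lin_iter, lin_euler. left; apply inv_pow_pos_2. Qed.

Lemma small_steps z : exists j0, forall j, (j0 <= j)%nat -> 2 * Re z <= 4 ^ j.
Proof.
destruct (Pow_x_infinity 4 ltac:(rewrite Rabs_pos_eq; lra) (2 * Re z)) as [j0 H].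
exists j0; intros j Hj. generalize (H j Hj). rewrite Rabs_pos_eq by (apply pow_le; lra). lra.
Qed.

Lemma euler_step_bound i j z : (j <= i)%nat -> good z -> 2 * Re z <= 4 ^ j ->
  forall m y, N (Nat.iter m (euler (/ 2 ^ j) (RtoC (/ 8 ^ i) * z)%C) y) <= C1 * N y.
Proof.
intros Hij Hz Hj. apply euler_bound; [apply inv_pow_pos_2| |].
- apply good_scal; [left; apply inv_pow_pos_8 | easy].
- rewrite Re_scal.
  assert (H1 := pow_pos_2 j). assert (H2 := pow_pos_8 i). assert (H3 := pow_pos_8 j).
  assert (H4 : 8 ^ j <= 8 ^ i) by (apply Rle_pow; [lra|easy]).
  replace (2 * (/ 8 ^ i * Re z)) with (2 * Re z / 8 ^ i) by (field; lra).
  apply (Rle_div_l (2 * Re z) (/ 2 ^ j) (8 ^ i)); [easy|].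
  apply Rle_trans with (/ 2 ^ j * 8 ^ j).
  + rewrite pow_8_split. replace (/ 2 ^ j * (4 ^ j * 2 ^ j)) with (4 ^ j) by (field; lra). easy.
  + apply Rmult_le_compat_l; [left; apply inv_pow_pos_2 | easy].
Qed.

Lemma approx_bound j z y : good z -> 2 * Re z <= 4 ^ j -> N (approx j z y) <= C1 * N y.
Proof. intros Hz Hj. now apply euler_step_bound. Qed.

(** First the [8^j] steps are refined to [8^i] at fixed [h = 2^-j]: as the quotient has norm at most
    [2 / h], the error is of order [8^j (|z| 2^j / 8^j)^2 = |z|^2 / 2^j]. Then [h] is changed, at
    the cost of the difference of the two quotients. *)
Lemma approx_difference i j z x : (j <= i)%nat -> good z -> 2 * Re z <= 4 ^ j ->
  N (vminus (approx j z x) (approx i z x))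
  <= 4 * C1 ^ 3 * Cmod z ^ 2 * N x / 2 ^ j
     + C1 ^ 2 * Cmod z * N (vminus (Q (/ 2 ^ j) x) (Q (/ 2 ^ i) x)).
Proof.
intros Hij Hz Hj.
assert (H2 := pow_pos_2 j). assert (H2i := inv_pow_pos_2 j). assert (H2ii := inv_pow_pos_2 i).
assert (H8i := pow_pos_8 i). assert (H8j := pow_pos_8 j).
assert (HC := C1_ge_1). assert (HC0 : 0 <= C1) by lra.
assert (Hi : 2 * Re z <= 4 ^ i) by (apply Rle_trans with (4 ^ j); [easy | apply Rle_pow; [lra|easy]]).
set (c := (RtoC (/ 8 ^ i) * z)%C).
assert (Bc := euler_step_bound i j z Hij Hz Hj). fold c in Bc.
eapply Rle_trans; [apply (sn_minus_trans HN _ (Nat.iter (8 ^ i) (euler (/ 2 ^ j) c) x))|].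
apply Rplus_le_compat.
- replace (8 ^ i)%nat with (8 ^ j * 8 ^ (i - j))%nat by (rewrite <- Nat.pow_add_r; f_equal; lia).
  rewrite iter_mult. unfold approx. set (p := (8 ^ (i - j))%nat).
  eapply Rle_trans.
  { apply (power_minus_le HN _ _ C1 C1).
    - apply lin_euler; lra.
    - apply lin_iter, lin_euler; lra.
    - intros y. symmetry. apply iter_comm. intros w. apply euler_euler; lra.
    - easy.
    - easy.
    - now apply euler_step_bound.
    - intros m y. rewrite <- iter_mult. apply Bc. }
  rewrite INR_pow8, (sn_minus_sym HN).
  assert (Hp : INR p = 8 ^ i / 8 ^ j).
  { unfold p. rewrite INR_pow8. replace i with (j + (i - j))%nat at 2 by lia.
    rewrite pow_add. field. lra. }
  assert (Ec : (RtoC (/ 8 ^ j) * z)%C = (RtoC (INR p) * c)%C).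
  { unfold c. rewrite Cmult_assoc, <- RtoC_mult. do 2 f_equal. rewrite Hp. field. lra. }
  rewrite Ec.
  apply Rle_trans with (8 ^ j * (C1 * C1 * (INR p ^ 2 * (C1 * (Cmod c * (2 / / 2 ^ j)) ^ 2 * N x)))).
  { apply Rmult_le_compat_l; [lra|]. apply Rmult_le_compat_l; [nra|].
    now apply euler_subdivide. }
  right. unfold c. rewrite Cmod_mult, Cmod_R, Rabs_pos_eq by (left; apply inv_pow_pos_8).
  rewrite Hp.
  replace (8 ^ j * (C1 * C1 * ((8 ^ i / 8 ^ j) ^ 2 * (C1 * (/ 8 ^ i * Cmod z * (2 / / 2 ^ j)) ^ 2 * N x))))
    with (4 * C1 ^ 3 * Cmod z ^ 2 * N x * (2 ^ j) ^ 2 / 8 ^ j) by (field; lra).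
  rewrite pow_8_split. replace (4 ^ j) with ((2 ^ j) ^ 2).
  + field. lra.
  + rewrite <- pow_mult, Nat.mul_comm, pow_mult. f_equal. ring.
- unfold approx. fold c. eapply Rle_trans.
  { apply (power_minus_le HN _ _ C1 C1); try easy.
    - apply lin_euler; lra.
    - apply lin_euler; lra.
    - intros y. apply euler_euler; lra.
    - now apply euler_step_bound. }
  rewrite INR_pow8.
  replace (vminus (euler (/ 2 ^ j) c x) (euler (/ 2 ^ i) c x))
    with (vscal c (vminus (Q (/ 2 ^ j) x) (Q (/ 2 ^ i) x))) by (unfold euler; module_eq).
  rewrite (sn_scal N HN). unfold c. rewrite Cmod_mult, Cmod_R, Rabs_pos_eq by (left; apply inv_pow_pos_8).
  right. field. lra.
Qed.

Definition extension (z : C) (x : X) : X := lim_seq (fun j => approx j z x).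

Lemma approx_eventually_bound z : good z ->
  exists j0, forall j y, (j0 <= j)%nat -> N (approx j z y) <= C1 * N y.
Proof.
intros Hz. destruct (small_steps z) as [j0 H]. exists j0; intros j y Hj.
apply approx_bound; auto.
Qed.

Lemma approx_cauchy z x : good z -> smooth (N := N) (T := T) x -> sn_cauchy N (fun j => approx j z x).
Proof.
intros Hz Hx eps He.
destruct (small_steps z) as [j0 H0].
assert (HC := C1_ge_1). assert (Hz0 := Cmod_ge_0 z). assert (Hx0 := sn_ge_0 HN x).
destruct (div_pow2_lt (4 * C1 ^ 3 * Cmod z ^ 2 * N x) (eps / 2)) as [j1 H1]; [|lra|].
{ repeat apply Rmult_le_pos; try lra; try easy; try apply pow2_ge_0; apply pow_le; lra. }
set (b := C1 ^ 2 * Cmod z + 1).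
assert (Hb : 0 < b).
{ unfold b. assert (0 <= C1 ^ 2 * Cmod z); [|lra]. apply Rmult_le_pos; [apply pow2_ge_0|easy]. }
destruct (Hx (eps / 2 / b)) as [j2 H2]; [apply Rdiv_lt_0_compat; lra|].
exists (max j0 (max j1 j2)); intros j i Hj Hij.
eapply Rle_lt_trans; [apply approx_difference; [easy|easy|apply H0; lia]|].
specialize (H1 j ltac:(lia)). specialize (H2 j i ltac:(lia) Hij).
set (d := N (vminus (Q (/ 2 ^ j) x) (Q (/ 2 ^ i) x))) in *.
assert (Hd : 0 <= d) by apply (sn_ge_0 HN).
apply (Rlt_div_r d (eps / 2) b Hb) in H2. unfold b in H2. lra.
Qed.

Lemma approx_tends z x : good z -> tends N (fun j => approx j z x) (extension z x).
Proof.
intros Hz. apply Hlim.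
apply (cauchy_of_dense HN (fun j => approx j z) C1 (smooth (N := N) (T := T))).
- intros j. apply lin_approx.
- generalize C1_ge_1; lra.
- now apply approx_eventually_bound.
- intros y Hy. now apply approx_cauchy.
- intros eps He. exact (smooth_dense HN HT Hsep Hlim x eps He).
Qed.

Lemma extension_bound z x : good z -> N (extension z x) <= C1 * N x.
Proof.
intros Hz. apply (tends_bounded HN _ _ _ (approx_tends z x Hz)).
destruct (approx_eventually_bound z Hz) as [j0 H]. exists j0; intros; now apply H.
Qed.

Lemma lin_extension z : good z -> linear_map (extension z).
Proof.
intros Hz; split; intros.
- apply (tends_unique HN Hsep _ _ _ (approx_tends z _ Hz)).
  apply (tends_ext (fun j => vplus (approx j z x) (approx j z y))).
  + exists O; intros j _. now rewrite (lin_plus _ (lin_approx j z)).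
  + apply (tends_plus HN); now apply approx_tends.
- apply (tends_unique HN Hsep _ _ _ (approx_tends z _ Hz)).
  apply (tends_ext (fun j => vscal c (approx j z x))).
  + exists O; intros j _. now rewrite (lin_scal _ (lin_approx j z)).
  + apply (tends_scal HN); now apply approx_tends.
Qed.

Lemma extension_0 x : extension (RtoC 0) x = x.
Proof.
assert (H0 : good (RtoC 0)) by (unfold good; simpl; rewrite Rabs_R0; lra).
apply (tends_unique HN Hsep _ _ _ (approx_tends _ x H0)).
apply (tends_ext (fun _ => x)).
- exists O; intros j _. unfold approx.
  rewrite (iter_ext _ (fun y => y)).
  + induction (8 ^ j)%nat; simpl; auto.
  + intros y. unfold euler. module_eq.
- apply (tends_const HN).
Qed.

(** In one step the product and the sum differ by [cz cw Q^2], of order [4^j / 64^j]; over [8^j]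
    steps this adds up to order [2^-j]. *)
Lemma approx_add_difference j z w x : good z -> good w -> 2 * Re (z + w)%C <= 4 ^ j ->
  N (vminus (approx j z (approx j w x)) (approx j (z + w)%C x))
  <= 4 * C1 ^ 3 * Cmod z * Cmod w * N x / 2 ^ j.
Proof.
intros Hz Hw Hj.
assert (Hzr := good_Re z Hz). assert (Hwr := good_Re w Hw).
assert (Hjz : 2 * Re z <= 4 ^ j) by (simpl in Hj; unfold Re in *; lra).
assert (Hjw : 2 * Re w <= 4 ^ j) by (simpl in Hj; unfold Re in *; lra).
assert (H2 := pow_pos_2 j). assert (H2i := inv_pow_pos_2 j). assert (H8 := pow_pos_8 j).
assert (HC := C1_ge_1). assert (HC0 : 0 <= C1) by lra.
unfold approx. set (s := / 2 ^ j) in *.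
set (cz := (RtoC (/ 8 ^ j) * z)%C). set (cw := (RtoC (/ 8 ^ j) * w)%C).
assert (Hc : forall y, euler s cz (euler s cw y) = euler s cw (euler s cz y)).
{ intros y; apply euler_euler; lra. }
rewrite <- (iter_comp _ _ (8 ^ j) x Hc).
eapply Rle_trans.
{ apply (power_minus_le HN _ _ (C1 * C1) C1).
  - apply lin_comp; apply lin_euler; lra.
  - apply lin_euler; lra.
  - intros y. rewrite (euler_euler s cw), (euler_euler s cz) by lra. reflexivity.
  - nra.
  - easy.
  - intros i y. rewrite (iter_comp _ _ i y Hc), Rmult_assoc.
    eapply Rle_trans; [now apply euler_step_bound|].
    apply Rmult_le_compat_l; [easy|]. now apply euler_step_bound.
  - apply euler_step_bound; [easy|now apply good_plus|easy]. }
rewrite INR_pow8.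
replace (vminus (euler s cz (euler s cw x)) (euler s (RtoC (/ 8 ^ j) * (z + w))%C x))
  with (vscal (cz * cw)%C (Q s (Q s x))).
2:{ rewrite Cmult_plus_distr_l. fold cz cw.
    change (vscal (cz * cw)%C (Q s (Q s x))
      = vminus (vplus (euler s cw x) (vscal cz (Q s (vplus x (vscal cw (Q s x)))))) (euler s (cz + cw)%C x)).
    assert (Hq := lin_quot s (Rlt_le _ _ H2i)).
    rewrite (lin_plus _ Hq), (lin_scal _ Hq). unfold euler. module_eq. }
rewrite (sn_scal N HN).
assert (Hq1 := quot_le s (Q s x) H2i). assert (Hq2 := quot_le s x H2i).
assert (E2 : 2 / s = 2 * 2 ^ j) by (unfold s; field; lra).
rewrite E2 in *.
assert (Hq : N (Q s (Q s x)) <= 2 * 2 ^ j * (2 * 2 ^ j * N x)).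
{ eapply Rle_trans; [exact Hq1|]. apply Rmult_le_compat_l; lra. }
apply Rle_trans with (8 ^ j * (C1 * C1 * C1 * (Cmod (cz * cw) * (2 * 2 ^ j * (2 * 2 ^ j * N x))))).
{ apply Rmult_le_compat_l; [lra|]. apply Rmult_le_compat_l; [apply Rmult_le_pos; [apply Rmult_le_pos|]; exact HC0|].
  apply Rmult_le_compat_l; [apply Cmod_ge_0|easy]. }
right. unfold cz, cw. rewrite !Cmod_mult, !Cmod_R, Rabs_pos_eq by (left; apply inv_pow_pos_8).
replace (8 ^ j * (C1 * C1 * C1 * (/ 8 ^ j * Cmod z * (/ 8 ^ j * Cmod w) * (2 * 2 ^ j * (2 * 2 ^ j * N x)))))
  with (4 * C1 ^ 3 * Cmod z * Cmod w * N x * (2 ^ j) ^ 2 / 8 ^ j) by (field; lra).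
rewrite pow_8_split. replace (4 ^ j) with ((2 ^ j) ^ 2).
- field. lra.
- rewrite <- pow_mult, Nat.mul_comm, pow_mult. f_equal. ring.
Qed.

Lemma extension_add z w x : good z -> good w -> extension (z + w)%C x = extension z (extension w x).
Proof.
intros Hz Hw.
assert (Hzw := good_plus z w Hz Hw).
assert (HC := C1_ge_1). assert (Hz0 := Cmod_ge_0 z). assert (Hw0 := Cmod_ge_0 w).
assert (Hx0 := sn_ge_0 HN x).
apply (tends_unique HN Hsep (fun j => approx j z (extension w x))); [|now apply approx_tends].
apply (tends_near HN (fun j => approx j (z + w)%C x)); [|now apply approx_tends].
intros eps He.
destruct (small_steps (z + w)%C) as [j0 H0].
destruct (div_pow2_lt (4 * C1 ^ 3 * Cmod z * Cmod w * N x) (eps / 2)) as [j1 H1]; [|lra|].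
{ repeat apply Rmult_le_pos; try lra; try easy; apply pow_le; lra. }
destruct (approx_tends w x Hw (eps / 2 / C1)) as [j2 H2]; [apply Rdiv_lt_0_compat; lra|].
exists (max j0 (max j1 j2)); intros j Hj.
specialize (H0 j ltac:(lia)). specialize (H1 j ltac:(lia)). specialize (H2 j ltac:(lia)).
eapply Rle_lt_trans; [apply (sn_minus_trans HN _ (approx j z (approx j w x)))|].
assert (H3 := approx_add_difference j z w x Hz Hw H0).
assert (H4 : N (vminus (approx j z (extension w x)) (approx j z (approx j w x))) < eps / 2).
{ rewrite <- (lin_minus _ _ _ (lin_approx j z)).
  eapply Rle_lt_trans.
  - apply approx_bound; [easy|]. generalize (good_Re w Hw). simpl in H0. unfold Re in *. lra.
  - rewrite (sn_minus_sym HN). apply (Rlt_div_r _ (eps / 2) C1) in H2; [|lra].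
    rewrite Rmult_comm. exact H2. }
lra.
Qed.

Lemma good_real t : 0 <= t -> good (RtoC t).
Proof. intros Ht. unfold good; simpl. rewrite Rabs_R0. nra. Qed.

(** For [t = 2^-q], [T t] is the [8^j]-th power of [T s] with [s = 2^-(q + 3 j)], and [T s] is
    exactly the Euler step [1 + s Q_s]. As [s] is again dyadic, the Cauchy condition in [smooth]
    compares its quotient with the one at [2^-j]. *)
Lemma extension_dyadic_unit q x : extension (RtoC (/ 2 ^ q)) x = T (/ 2 ^ q) x.
Proof.
assert (Hq := inv_pow_pos_2 q). set (t := / 2 ^ q) in *.
assert (Ht : 0 <= t) by lra.
assert (Hg := good_real t Ht).
assert (HTt := cs_lin N T HT t Ht).
assert (HC := C1_ge_1).
assert (Hsm : forall y, smooth (N := N) (T := T) y -> extension (RtoC t) y = T t y).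
{ intros y Hy. apply (tends_unique HN Hsep _ _ _ (approx_tends (RtoC t) y Hg)).
  apply (tends_near HN (fun _ => T t y)); [|apply (tends_const HN)].
  intros eps He.
  destruct (small_steps (RtoC t)) as [j0 H0].
  destruct (Hy (eps / (C1 * t))) as [j1 H1].
  { apply Rdiv_lt_0_compat; [easy|]. apply Rmult_lt_0_compat; lra. }
  exists (max j0 j1); intros j Hj.
  assert (H8 := pow_pos_8 j). assert (H8i := inv_pow_pos_8 j). assert (H2i := inv_pow_pos_2 j).
  set (s := / 2 ^ (q + 3 * j)).
  assert (Es : s = t * / 8 ^ j).
  { unfold s, t. rewrite pow_add, pow_mult. replace (2 ^ 3) with 8 by ring.
    rewrite Rinv_mult. reflexivity. }
  assert (Hs : 0 < s) by (rewrite Es; now apply Rmult_lt_0_compat).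
  assert (ET : T t y = Nat.iter (8 ^ j) (T s) y).
  { rewrite (cs_iter HT) by lra. f_equal. rewrite INR_pow8, Es. field. lra. }
  rewrite ET. unfold approx.
  eapply Rle_lt_trans.
  { apply (power_minus_le HN _ _ C1 1).
    - apply lin_euler; lra.
    - apply (cs_lin N T HT); lra.
    - intros w. apply euler_T; lra.
    - lra.
    - lra.
    - apply euler_step_bound; [easy|easy|apply H0; lia].
    - intros i w. rewrite Rmult_1_l. apply contraction_iter, (cs_contraction N T HT); lra. }
  rewrite INR_pow8.
  replace (vminus (euler (/ 2 ^ j) (RtoC (/ 8 ^ j) * RtoC t)%C y) (T s y))
    with (vscal (RtoC s) (vminus (Q (/ 2 ^ j) y) (Q s y))).
  2:{ assert (Hs0 : RtoC s <> RtoC 0) by (intros E; apply RtoC_inj in E; lra).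
      rewrite <- RtoC_mult, (Rmult_comm _ t), <- Es.
      unfold euler. unfold quot at 2.
      module_eq; rewrite RtoC_inv by lra; field; easy. }
  rewrite (sn_scal N HN), Cmod_R, (Rabs_pos_eq s) by lra.
  specialize (H1 j (q + 3 * j)%nat ltac:(lia) ltac:(lia)). fold s in H1.
  set (d := N (vminus (Q (/ 2 ^ j) y) (Q s y))) in *.
  apply (Rlt_div_r d eps (C1 * t)) in H1; [|apply Rmult_lt_0_compat; lra].
  replace (8 ^ j * (C1 * 1 * (s * d))) with (d * (C1 * t)); [exact H1|].
  rewrite Es. field. lra. }
apply (tends_unique HN Hsep (fun j => T t x)); [|apply (tends_const HN)].
intros eps He.
destruct (smooth_dense HN HT Hsep Hlim x (eps / (C1 + 1))) as (y & Hy & Hxy).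
{ apply Rdiv_lt_0_compat; lra. }
exists O; intros n _.
apply (Rlt_div_r _ eps (C1 + 1)) in Hxy; [|lra].
eapply Rle_lt_trans; [apply (sn_minus_trans HN _ (T t y))|].
rewrite <- (Hsm y Hy) at 2.
rewrite <- (lin_minus _ _ _ HTt), <- (lin_minus _ _ _ (lin_extension _ Hg)).
generalize (cs_contraction N T HT t Ht (vminus x y)) (extension_bound (RtoC t) (vminus y x) Hg).
rewrite (sn_minus_sym HN y x). lra.
Qed.

Lemma extension_near_0 x eps : 0 < eps ->
  exists d, 0 < d /\ forall z, good z -> Cmod z < d -> N (vminus (extension z x) x) < eps.
Proof.
intros He. assert (HC := C1_ge_1).
destruct (smooth_dense HN HT Hsep Hlim x (eps / 2 / (C1 + 1))) as (y & Hy & Hxy).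
{ repeat apply Rdiv_lt_0_compat; lra. }
apply (Rlt_div_r _ (eps / 2) (C1 + 1)) in Hxy; [|lra].
destruct (Hy 1) as [j1 H1]; [lra|].
set (b := N (Q (/ 2 ^ j1) y) + 1).
assert (Hb : 0 < b) by (unfold b; generalize (sn_ge_0 HN (Q (/ 2 ^ j1) y)); lra).
assert (Hcb : 0 < C1 * b) by (apply Rmult_lt_0_compat; lra).
exists (eps / 2 / (C1 * b)). split; [repeat apply Rdiv_lt_0_compat; lra|].
intros z Hz Hzd. apply (Rlt_div_r _ (eps / 2) (C1 * b)) in Hzd; [|easy].
assert (Hyz : N (vminus (extension z y) y) <= Cmod z * (C1 * b)).
{ apply (tends_bounded HN (fun j => vminus (approx j z y) y)).
  - apply (tends_minus HN); [now apply approx_tends | apply (tends_const HN)].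
  - destruct (small_steps z) as [j0 H0].
    exists (max j0 j1); intros j Hj.
    assert (H8 := pow_pos_8 j). assert (H2i := inv_pow_pos_2 j).
    unfold approx.
    assert (H : N (vminus (Nat.iter (8 ^ j) (euler (/ 2 ^ j) (RtoC (/ 8 ^ j) * z)%C) y)
                    (Nat.iter (8 ^ j) (fun w => w) y))
      <= INR (8 ^ j) * (C1 * 1 * N (vminus (euler (/ 2 ^ j) (RtoC (/ 8 ^ j) * z)%C y) y))).
    { apply (power_minus_le HN).
      - apply lin_euler; lra.
      - apply lin_id.
      - easy.
      - lra.
      - lra.
      - apply euler_step_bound; [easy|easy|apply H0; lia].
      - intros i w. replace (Nat.iter i (fun v : X => v) w) with w by (induction i; simpl; auto). lra. }
    replace (Nat.iter (8 ^ j) (fun w : X => w) y) with y in H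
      by (clear; induction (8 ^ j)%nat; simpl; auto).
    eapply Rle_trans; [exact H|]. rewrite INR_pow8.
    replace (vminus (euler (/ 2 ^ j) (RtoC (/ 8 ^ j) * z)%C y) y)
      with (vscal (RtoC (/ 8 ^ j) * z)%C (Q (/ 2 ^ j) y)) by (unfold euler; module_eq).
    rewrite (sn_scal N HN), Cmod_mult, Cmod_R, Rabs_pos_eq by (left; apply inv_pow_pos_8).
    replace (8 ^ j * (C1 * 1 * (/ 8 ^ j * Cmod z * N (Q (/ 2 ^ j) y))))
      with (Cmod z * (C1 * N (Q (/ 2 ^ j) y))) by (field; lra).
    apply Rmult_le_compat_l; [apply Cmod_ge_0|]. apply Rmult_le_compat_l; [lra|].
    unfold b. specialize (H1 j1 j (Nat.le_refl _) ltac:(lia)).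
    generalize (sn_le_minus HN (Q (/ 2 ^ j) y) (Q (/ 2 ^ j1) y)).
    rewrite (sn_minus_sym HN). lra. }
eapply Rle_lt_trans; [apply (sn_minus_trans HN _ (extension z y))|].
rewrite <- (lin_minus _ _ _ (lin_extension _ Hz)).
generalize (extension_bound z (vminus x y) Hz) (sn_minus_trans HN (extension z y) y x).
rewrite (sn_minus_sym HN y x). lra.
Qed.

Lemma extension_dyadic q k x : extension (RtoC (INR k * / 2 ^ q)) x = T (INR k * / 2 ^ q) x.
Proof.
assert (Hq := inv_pow_pos_2 q).
induction k as [|k IH].
- simpl INR. rewrite Rmult_0_l, (cs_id N T HT). apply extension_0.
- rewrite S_INR, Rmult_plus_distr_r, Rmult_1_l, Rplus_comm, RtoC_plus.
  assert (Hkq : 0 <= INR k * / 2 ^ q) by (apply Rmult_le_pos; [apply pos_INR | lra]).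
  rewrite extension_add by (apply good_real; lra).
  rewrite IH, (cs_add N T HT) by lra. apply extension_dyadic_unit.
Qed.

(** Splits [t] into a dyadic [u] and a small [v]; both families satisfy the semigroup law and are
    close to the identity at [v]. *)
Lemma extension_real t x : 0 <= t -> extension (RtoC t) x = T t x.
Proof.
intros Ht. apply (tends_unique HN Hsep (fun _ => extension (RtoC t) x)); [apply (tends_const HN)|].
assert (HC := C1_ge_1).
intros eps He.
assert (He2 : 0 < eps / 2 / C1) by (repeat apply Rdiv_lt_0_compat; lra).
destruct (extension_near_0 x _ He2) as (d & Hd & Hnear).
destruct (cs_cont N T HT x _ He2) as (d' & Hd' & Hc).
destruct (div_pow2_lt 1 (Rmin d d')) as [q Hq]; [lra|now apply Rmin_glb_lt|].
specialize (Hq q (Nat.le_refl q)).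
assert (H2 := pow_pos_2 q). assert (H2i := inv_pow_pos_2 q).
destruct (nfloor_ex (t * 2 ^ q)) as [k [Hk1 Hk2]]; [apply Rmult_le_pos; lra|].
set (u := INR k * / 2 ^ q).
assert (Hu0 : 0 <= u) by (apply Rmult_le_pos; [apply pos_INR|lra]).
assert (Hu : u <= t).
{ unfold u. apply (Rle_div_l (INR k) t (2 ^ q)); easy. }
assert (Hv : t - u < / 2 ^ q).
{ assert (t < (INR k + 1) / 2 ^ q).
  { apply (Rlt_div_r t (INR k + 1) (2 ^ q)); easy. }
  unfold u. unfold Rdiv in *. lra. }
set (v := t - u) in *.
assert (Hv0 : 0 <= v) by (unfold v; lra).
exists O; intros n _.
replace t with (u + v) by (unfold v; ring).
rewrite RtoC_plus, extension_add, (cs_add N T HT) by (try apply good_real; easy).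
assert (Eu : T u (T v x) = extension (RtoC u) (T v x)) by (symmetry; apply extension_dyadic).
assert (Hgu := good_real u Hu0).
rewrite Eu, <- (lin_minus _ _ _ (lin_extension _ Hgu)).
assert (Hmin1 := Rmin_l d d'). assert (Hmin2 := Rmin_r d d').
eapply Rle_lt_trans; [now apply extension_bound|].
assert (H1 : N (vminus (extension (RtoC v) x) x) < eps / 2 / C1).
{ apply Hnear; [now apply good_real|]. rewrite Cmod_R, Rabs_pos_eq by easy. lra. }
assert (H3 : N (vminus (T v x) x) < eps / 2 / C1) by (apply Hc; lra).
assert (H4 := sn_minus_trans HN (extension (RtoC v) x) x (T v x)).
rewrite (sn_minus_sym HN x (T v x)) in H4.
apply (Rlt_div_r _ (eps / 2) C1) in H1; [|lra].
apply (Rlt_div_r _ (eps / 2) C1) in H3; [|lra].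
apply Rle_lt_trans with (C1 * (N (vminus (extension (RtoC v) x) x) + N (vminus (T v x) x))).
- apply Rmult_le_compat_l; lra.
- lra.
Qed.

(** The derivative at [tau] of the Euler polynomial [z |-> (1 + z A_h / n)^n], namely
    [A_h (1 + tau A_h / n)^(n - 1)]. *)
Definition approx_deriv (tau : R) (j : nat) (x : X) : X :=
  Q (/ 2 ^ j) (Nat.iter (pred (8 ^ j)) (euler (/ 2 ^ j) (RtoC (/ 8 ^ j) * RtoC tau)%C) x).

Lemma lin_approx_deriv tau j : linear_map (approx_deriv tau j).
Proof.
assert (H2i := Rlt_le _ _ (inv_pow_pos_2 j)).
exact (lin_comp _ _ (lin_quot _ H2i) (lin_iter _ _ (lin_euler _ _ H2i))).
Qed.

Lemma approx_taylor tau th j x : 0 < tau -> 540 * Cmod th <= kappa -> 2 * tau <= 4 ^ j ->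
  N (vminus (approx j (RtoC tau * (1 + th))%C x)
       (vplus (approx j (RtoC tau) x) (vscal (RtoC tau * th)%C (approx_deriv tau j x))))
  <= C1 * (270 * Cmod th / kappa) ^ 2 * N x.
Proof.
intros Htau Hth Hj.
assert (H8 := pow_pos_8 j). assert (H2 := pow_pos_2 j). assert (H2i := inv_pow_pos_2 j).
assert (H4 : 0 < 4 ^ j) by (apply pow_lt; lra).
set (s := / 2 ^ j) in *. set (r := tau / 4 ^ j).
assert (Hr : 0 < r <= / 2).
{ unfold r. split; [now apply Rdiv_lt_0_compat|]. apply (Rle_div_l tau (/ 2) (4 ^ j)); lra. }
assert (Ers : RtoC (r * s) = (RtoC (/ 8 ^ j) * RtoC tau)%C).
{ rewrite <- RtoC_mult. f_equal. unfold r, s. rewrite pow_8_split. field. lra. }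
assert (Ec : forall y, euler s (RtoC (/ 8 ^ j) * (RtoC tau * (1 + th)))%C y
                       = shear (V := averaged s r) th y).
{ intros y. rewrite Cmult_assoc, <- Ers. now apply euler_shear. }
assert (EV : forall y, euler s (RtoC (/ 8 ^ j) * RtoC tau)%C y = averaged s r y).
{ intros y. rewrite <- Ers. replace (RtoC (r * s)) with (RtoC (r * s) * (1 + 0))%C by ring.
  rewrite (euler_shear (r := r) H2i). unfold shear. module_eq. }
assert (E8 : (8 ^ j)%nat = S (pred (8 ^ j))).
{ assert (8 ^ j <> 0)%nat by (apply Nat.pow_nonzero; lia). lia. }
unfold approx, approx_deriv. fold s.
rewrite (iter_ext _ _ _ _ Ec), !(iter_ext _ _ _ _ EV).
set (n := pred (8 ^ j)) in *. rewrite E8.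
replace (vscal (RtoC tau * th)%C (Q s (Nat.iter n (averaged s r) x)))
  with (vscal (INR (S n) * th)%C (diff1 (V := averaged s r) (Nat.iter n (averaged s r) x))).
- now apply (shear_power_taylor HN (lin_averaged H2i) (averaged_contraction H2i Hr) Hk (averaged_lower H2i Hr)).
- rewrite <- E8, INR_pow8. generalize (Nat.iter n (averaged s r) x); intros y.
  unfold diff1, averaged, quot.
  assert (Etau : tau = 8 ^ j * (r * s)) by (unfold r, s; rewrite pow_8_split; field; lra).
  assert (Hs0 : RtoC s <> RtoC 0) by (intros E; apply RtoC_inj in E; lra).
  rewrite Etau at 1. rewrite !RtoC_mult, RtoC_inv by lra.
  module_eq; field; easy.
Qed.

(** Twice the constant of [good] makes up for a real part [1 + Re th] that may drop to [1/2]. *)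
Lemma good_shift tau th : 0 < tau -> 1080 * Cmod th <= kappa -> good (RtoC tau * (1 + th))%C.
Proof.
intros Htau Hth. apply good_scal; [lra|]. unfold good. destruct th as [a b]; simpl.
assert (Ha := Rmax_Cmod (a, b)). simpl in Ha.
assert (Ha1 := Rmax_l (Rabs a) (Rabs b)). assert (Ha2 := Rmax_r (Rabs a) (Rabs b)).
rewrite Rplus_0_l. assert (- Rabs a <= a) by (generalize (Rle_abs (- a)); rewrite Rabs_Ropp; lra).
nra.
Qed.

(** At a fixed real [th = t] the difference quotients of the convergent approximants are Cauchy,
    while the Taylor remainder divided by [tau * t] is of order [t] uniformly in [j]. So [t] is
    chosen from [eps] first, and [j] afterwards. *)
Lemma approx_deriv_cauchy tau x : 0 < tau -> sn_cauchy N (fun j => approx_deriv tau j x).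
Proof.
intros Htau eps He.
assert (HC := C1_ge_1). assert (Hx := sn_ge_0 HN x).
set (A := 2 * C1 * (270 / kappa) ^ 2 * N x).
assert (HA : 0 <= A).
{ unfold A. apply Rmult_le_pos; [|easy]. apply Rmult_le_pos; [lra|apply pow2_ge_0]. }
set (t := Rmin (kappa / 1080) (eps * tau / (4 * (A + 1)))).
assert (Ht1 : t <= kappa / 1080) by apply Rmin_l.
assert (Ht2 : t <= eps * tau / (4 * (A + 1))) by apply Rmin_r.
assert (Ht0 : 0 < t).
{ apply Rmin_glb_lt; [lra|]. apply Rdiv_lt_0_compat; [now apply Rmult_lt_0_compat|lra]. }
apply (Rle_div_r t (eps * tau) (4 * (A + 1))) in Ht2; [|lra].
assert (HAt : A * t <= eps * tau / 4) by nra.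
assert (Hct : Cmod (RtoC t) = t) by (rewrite Cmod_R; apply Rabs_pos_eq; lra).
assert (Hd0 : 0 < eps * tau * t / 8) by (repeat apply Rmult_lt_0_compat; lra).
assert (Hg1 := good_shift tau (RtoC t) Htau ltac:(rewrite Hct; lra)).
assert (Hg2 := good_real tau (Rlt_le _ _ Htau)).
destruct (tends_cauchy HN _ _ (approx_tends _ x Hg1) _ Hd0) as [j1 H1].
destruct (tends_cauchy HN _ _ (approx_tends _ x Hg2) _ Hd0) as [j2 H2].
destruct (small_steps (RtoC tau)) as [j0 H0]. simpl in H0.
exists (max j0 (max j1 j2)); intros i j Hi Hij.
specialize (H1 i j ltac:(lia) Hij). specialize (H2 i j ltac:(lia) Hij).
assert (Ti := approx_taylor tau (RtoC t) i x Htau ltac:(rewrite Hct; lra) (H0 i ltac:(lia))).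
assert (Tj := approx_taylor tau (RtoC t) j x Htau ltac:(rewrite Hct; lra) (H0 j ltac:(lia))).
rewrite Hct in Ti, Tj.
set (p := (RtoC tau * (1 + RtoC t))%C) in *.
set (Gi := approx_deriv tau i x) in *. set (Gj := approx_deriv tau j x) in *.
assert (Hsum : tau * t * N (vminus Gi Gj)
  <= N (vminus (approx i p x) (vplus (approx i (RtoC tau) x) (vscal (RtoC tau * RtoC t)%C Gi)))
   + N (vminus (approx j p x) (vplus (approx j (RtoC tau) x) (vscal (RtoC tau * RtoC t)%C Gj)))
   + N (vminus (approx i p x) (approx j p x)) + N (vminus (approx i (RtoC tau) x) (approx j (RtoC tau) x))).
{ replace (tau * t * N (vminus Gi Gj)) with (N (vscal (RtoC tau * RtoC t)%C (vminus Gi Gj))).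
  2:{ rewrite (sn_scal N HN), Cmod_mult, !Cmod_R, !Rabs_pos_eq by lra. reflexivity. }
  replace (vscal (RtoC tau * RtoC t)%C (vminus Gi Gj)) with
    (vminus (vminus (vplus
       (vminus (approx j p x) (vplus (approx j (RtoC tau) x) (vscal (RtoC tau * RtoC t)%C Gj)))
       (vminus (approx i p x) (approx j p x)))
       (vminus (approx i p x) (vplus (approx i (RtoC tau) x) (vscal (RtoC tau * RtoC t)%C Gi))))
       (vminus (approx i (RtoC tau) x) (approx j (RtoC tau) x))) by module_eq.
  eapply Rle_trans; [apply (sn_minus HN)|]. apply Rplus_le_compat_r.
  eapply Rle_trans; [apply (sn_minus HN)|].
  eapply Rle_trans; [apply Rplus_le_compat_r; apply (sn_triangle N HN)|]. lra. }
apply Rmult_lt_reg_l with (tau * t); [now apply Rmult_lt_0_compat|].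
eapply Rle_lt_trans; [exact Hsum|].
assert (EA : C1 * (270 * t / kappa) ^ 2 * N x = A * t * t / 2) by (unfold A; field; lra).
rewrite EA in Ti, Tj.
assert (A * t * t <= eps * tau / 4 * t) by (apply Rmult_le_compat_r; lra).
assert (0 < eps * tau * t) by (repeat apply Rmult_lt_0_compat; lra).
lra.
Qed.

Lemma extension_taylor tau : 0 < tau -> exists L : X -> X,
  linear_map L /\ (exists b, 0 <= b /\ forall x, N (L x) <= b * N x) /\
  forall th x, 1080 * Cmod th <= kappa ->
  N (vminus (extension (RtoC tau * (1 + th))%C x)
       (vplus (extension (RtoC tau) x) (vscal (RtoC tau * th)%C (L x))))
  <= C1 * (270 * Cmod th / kappa) ^ 2 * N x.
Proof.
intros Htau. assert (HC := C1_ge_1).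
set (L := fun x => lim_seq (fun j => approx_deriv tau j x)).
assert (HL' : forall x, tends N (fun j => approx_deriv tau j x) (L x)).
{ intros x. apply Hlim. now apply approx_deriv_cauchy. }
assert (Hg := good_real tau (Rlt_le _ _ Htau)).
assert (Hlin : linear_map L).
{ split; intros.
  - apply (tends_unique HN Hsep _ _ _ (HL' (vplus x y))).
    apply (tends_ext (fun j => vplus (approx_deriv tau j x) (approx_deriv tau j y))).
    + exists O; intros j _. now rewrite (lin_plus _ (lin_approx_deriv tau j)).
    + now apply (tends_plus HN).
  - apply (tends_unique HN Hsep _ _ _ (HL' (vscal c x))).
    apply (tends_ext (fun j => vscal c (approx_deriv tau j x))).
    + exists O; intros j _. now rewrite (lin_scal _ (lin_approx_deriv tau j)).
    + now apply (tends_scal HN). }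
assert (Htay : forall th x, 1080 * Cmod th <= kappa ->
  N (vminus (extension (RtoC tau * (1 + th))%C x)
       (vplus (extension (RtoC tau) x) (vscal (RtoC tau * th)%C (L x))))
  <= C1 * (270 * Cmod th / kappa) ^ 2 * N x).
{ intros th x Hth.
  apply (tends_bounded HN (fun j => vminus (approx j (RtoC tau * (1 + th))%C x)
       (vplus (approx j (RtoC tau) x) (vscal (RtoC tau * th)%C (approx_deriv tau j x))))).
  - apply (tends_minus HN); [now apply approx_tends, good_shift|].
    apply (tends_plus HN); [now apply approx_tends|]. now apply (tends_scal HN).
  - destruct (small_steps (RtoC tau)) as [j0 H0]. simpl in H0.
    exists j0; intros j Hj. apply approx_taylor; auto.
    generalize (Cmod_ge_0 th); lra. }
exists L. split; [exact Hlin|]. split; [|exact Htay].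
(* The expansion at this single [th = t] already bounds [L]: its remainder is [C1 / 16], and the two
   values of the extension contribute [C1] each. *)
set (t := kappa / 1080).
assert (Ht : 0 < t) by (unfold t; lra).
assert (Hct : Cmod (RtoC t) = t) by (rewrite Cmod_R; apply Rabs_pos_eq; lra).
assert (Htt : 0 < tau * t) by (now apply Rmult_lt_0_compat).
exists (3 * C1 / (tau * t)). split; [apply Rdiv_le_0_compat; lra|].
intros x. assert (Hx := sn_ge_0 HN x).
assert (H1 := Htay (RtoC t) x ltac:(rewrite Hct; unfold t; lra)).
rewrite Hct in H1.
replace (270 * t / kappa) with (/ 4) in H1 by (unfold t; field; lra).
assert (H2 := extension_bound (RtoC tau * (1 + RtoC t))%C x
  (good_shift tau (RtoC t) Htau ltac:(rewrite Hct; unfold t; lra))).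
assert (H3 := extension_bound (RtoC tau) x Hg).
set (p := (RtoC tau * (1 + RtoC t))%C) in *.
assert (H4 : tau * t * N (L x) <= N (vminus (extension p x)
       (vplus (extension (RtoC tau) x) (vscal (RtoC tau * RtoC t)%C (L x))))
   + N (extension p x) + N (extension (RtoC tau) x)).
{ replace (tau * t * N (L x)) with (N (vscal (RtoC tau * RtoC t)%C (L x))).
  2:{ rewrite (sn_scal N HN), Cmod_mult, !Cmod_R, !Rabs_pos_eq by lra. reflexivity. }
  replace (vscal (RtoC tau * RtoC t)%C (L x)) with
    (vminus (vminus (extension p x) (vminus (extension p x)
       (vplus (extension (RtoC tau) x) (vscal (RtoC tau * RtoC t)%C (L x)))))
       (extension (RtoC tau) x)) at 1 by module_eq.
  eapply Rle_trans; [apply (sn_minus HN)|]. apply Rplus_le_compat_r.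
  eapply Rle_trans; [apply (sn_minus HN)|]. lra. }
replace (3 * C1 / (tau * t) * N x) with (3 * C1 * N x / (tau * t)) by (field; lra).
apply (Rle_div_r (N (L x)) (3 * C1 * N x) (tau * t)); [easy|].
assert (0 <= C1 * N x) by (apply Rmult_le_pos; lra).
lra.
Qed.

End Approximants.

(** * Renorming *)

Lemma op_norm_le {X : NormedModule C_AbsRing} (A : X -> X) (b : R) :
  0 <= b -> (forall x, norm (A x) <= b * norm x) -> Rbar_le (op_norm A) b.
Proof.
intros Hb H. unfold op_norm. apply (proj2 (Lub_Rbar_correct _)).
intros r [x [Hx ->]]. simpl. eapply Rle_trans; [apply H|]. nra.
Qed.

Lemma norm_vscal_le {X : NormedModule C_AbsRing} (c : C) (x : X) :
  norm (vscal c x) <= Cmod c * norm x.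
Proof. exact (norm_scal c x). Qed.

Lemma norm_le_op_norm {X : NormedModule C_AbsRing} (A : X -> X) (b : R) (x : X) :
  linear_map A -> Rbar_le (op_norm A) b -> norm (A x) <= b * norm x.
Proof.
intros HA H.
destruct (Req_dec (norm x) 0) as [H0|H0].
- assert (E : x = vzero) by (exact (norm_eq_zero x H0)).
  rewrite E, (lin_zero A HA). unfold vzero. rewrite norm_zero. lra.
- assert (Hx : 0 < norm x) by (generalize (norm_ge_0 x); lra).
  set (y := vscal (RtoC (/ norm x)) x).
  assert (Hy : norm y <= 1).
  { eapply Rle_trans; [apply norm_vscal_le|].
    rewrite Cmod_R, Rabs_pos_eq by (left; now apply Rinv_0_lt_compat).
    right. field. lra. }
  assert (Hb : norm (A y) <= b).
  { change (Rbar_le (norm (A y)) b). eapply Rbar_le_trans; [|exact H].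
    apply (proj1 (Lub_Rbar_correct _)). now exists y. }
  replace (A x) with (vscal (RtoC (norm x)) (A y)).
  + eapply Rle_trans; [apply norm_vscal_le|].
    rewrite Cmod_R, Rabs_pos_eq by lra. rewrite Rmult_comm. apply Rmult_le_compat_r; lra.
  + rewrite <- (lin_scal A HA). f_equal. unfold y.
    assert (Hc : RtoC (norm x) <> RtoC 0) by (intros E; apply RtoC_inj in E; lra).
    transitivity (vscal (RtoC 1) x); [|module_eq].
    module_eq. rewrite RtoC_inv by lra. field. exact Hc.
Qed.

Lemma locally_norm_elim {X : NormedModule C_AbsRing} (x : X) (P : X -> Prop) :
  locally x P -> exists eps, 0 < eps /\ forall y, norm (vminus y x) < eps -> P y.
Proof.
intros H. apply locally_norm_le_locally in H.
destruct H as [eps H]. exists eps. split; [apply cond_pos|]. exact H.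
Qed.

Lemma locally_norm_intro {X : NormedModule C_AbsRing} (x : X) (P : X -> Prop) eps :
  0 < eps -> (forall y, norm (vminus y x) < eps -> P y) -> locally x P.
Proof.
intros He H.
assert (HP : locally_norm x P) by (now exists (mkposreal eps He)).
now apply locally_le_locally_norm.
Qed.

Section Renorming.
Context {X : CompleteNormedModule C_AbsRing} {T : R -> X -> X} {M : R}.
Context (HT : C0_semigroup T) (HM : 1 <= M).
Context (Hbound : forall t, 0 <= t -> Rbar_le (op_norm (T t)) M).

Lemma C0_linear_map t : 0 <= t -> linear_map (T t).
Proof.
intros Ht. destruct (C0_bounded T HT t Ht) as [H1 H2 _]. split; [exact H1|exact H2].
Qed.

Lemma orbit_bound t x : 0 <= t -> norm (T t x) <= M * norm x.
Proof. intros Ht. apply norm_le_op_norm; [now apply C0_linear_map|now apply Hbound]. Qed.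

Definition orbit_norm (x : X) : R :=
  real (Lub_Rbar (fun r => exists t, 0 <= t /\ r = norm (T t x))).

Lemma orbit_norm_lub x :
  Finite (orbit_norm x) = Lub_Rbar (fun r => exists t, 0 <= t /\ r = norm (T t x)).
Proof.
unfold orbit_norm. set (E := fun r => exists t, 0 <= t /\ r = norm (T t x)).
destruct (Lub_Rbar_correct E) as [Hub Hleast].
assert (H1 : Rbar_le (norm (T 0 x)) (Lub_Rbar E)) by (apply Hub; exists 0; split; [lra|easy]).
assert (H2 : Rbar_le (Lub_Rbar E) (M * norm x)).
{ apply Hleast. intros r [t [Ht ->]]. now apply orbit_bound. }
destruct (Lub_Rbar E); simpl in *; easy.
Qed.

Lemma orbit_le_norm t x : 0 <= t -> norm (T t x) <= orbit_norm x.
Proof.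
intros Ht. change (Rbar_le (norm (T t x)) (orbit_norm x)). rewrite orbit_norm_lub.
apply (proj1 (Lub_Rbar_correct _)). now exists t.
Qed.

Lemma orbit_norm_least x b : (forall t, 0 <= t -> norm (T t x) <= b) -> orbit_norm x <= b.
Proof.
intros H. change (Rbar_le (orbit_norm x) b). rewrite orbit_norm_lub.
apply (proj2 (Lub_Rbar_correct _)). intros r [t [Ht ->]]. now apply H.
Qed.

Lemma norm_le_orbit_norm x : norm x <= orbit_norm x.
Proof. rewrite <- (C0_id T HT x) at 1. apply orbit_le_norm; lra. Qed.

Lemma orbit_norm_le x : orbit_norm x <= M * norm x.
Proof. apply orbit_norm_least. intros; now apply orbit_bound. Qed.

Lemma orbit_norm_seminorm : seminorm orbit_norm.
Proof.
assert (Hle : forall c x, orbit_norm (vscal c x) <= Cmod c * orbit_norm x).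
{ intros c x. apply orbit_norm_least. intros t Ht.
  rewrite (lin_scal _ (C0_linear_map t Ht)). eapply Rle_trans; [apply norm_vscal_le|].
  apply Rmult_le_compat_l; [apply Cmod_ge_0 | now apply orbit_le_norm]. }
split.
- intros x y. apply orbit_norm_least. intros t Ht.
  rewrite (lin_plus _ (C0_linear_map t Ht)).
  eapply Rle_trans; [apply norm_triangle|]. apply Rplus_le_compat; now apply orbit_le_norm.
- intros c x. apply Rle_antisym; [apply Hle|].
  destruct (Ceq_dec c 0) as [->|Hc].
  + rewrite Cmod_0, Rmult_0_l. eapply Rle_trans; [|apply norm_le_orbit_norm]. apply norm_ge_0.
  + assert (H := Hle (/ c)%C (vscal c x)).
    replace (vscal (/ c)%C (vscal c x)) with x in H.
    2:{ transitivity (vscal (RtoC 1) x); module_eq. field. exact Hc. }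
    rewrite Cmod_inv in H by easy.
    assert (Hc0 := proj1 (Cmod_gt_0 c) Hc).
    apply Rmult_le_reg_l with (/ Cmod c); [now apply Rinv_0_lt_compat|].
    rewrite <- Rmult_assoc, Rinv_l, Rmult_1_l by lra. exact H.
Qed.

Lemma orbit_norm_semigroup : contraction_semigroup orbit_norm T.
Proof.
split.
- exact C0_linear_map.
- intros t Ht x. apply orbit_norm_least. intros s Hs.
  rewrite <- (C0_add T HT) by easy. apply orbit_le_norm; lra.
- apply (C0_id T HT).
- intros t s x Ht Hs. now apply (C0_add T HT).
- intros x eps He.
  assert (He' : 0 < eps / M) by (apply Rdiv_lt_0_compat; lra).
  assert (HP : locally x (fun y => norm (vminus y x) < eps / M)).
  { now apply (locally_norm_intro x _ (eps / M)). }
  destruct (C0_cont T HT x _ HP) as [d Hd].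
  exists d. split; [apply cond_pos|]. intros t Ht.
  eapply Rle_lt_trans; [apply orbit_norm_le|].
  assert (H : norm (vminus (T t x) x) < eps / M).
  { destruct (Req_dec t 0) as [->|Ht0].
    - rewrite (C0_id T HT). replace (vminus x x) with (vzero : X) by module_eq.
      unfold vzero. rewrite norm_zero. exact He'.
    - apply Hd; [|lra]. change (Rabs (t - 0) < d). rewrite Rabs_pos_eq; lra. }
  apply (Rlt_div_r (norm (vminus (T t x) x)) eps M) in H; lra.
Qed.

Lemma orbit_norm_separated x : orbit_norm x = 0 -> x = vzero.
Proof.
intros H. apply (norm_eq_zero x). generalize (norm_le_orbit_norm x) (norm_ge_0 x). lra.
Qed.

(** The hypothesis is applied at every point [T s x] of the orbit; [T s] commutes with [zeta - T t],
    so the constant is unchanged. *)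
Lemma orbit_norm_lower (zeta : C) (K : R) (x : X) t :
  0 < K -> (forall y s, 0 < s -> norm (minus (scal zeta y) (T s y)) >= norm y / K) ->
  0 < t -> orbit_norm x / K <= orbit_norm (vminus (vscal zeta x) (T t x)).
Proof.
intros HK H Ht.
apply (Rle_div_l (orbit_norm x) (orbit_norm (vminus (vscal zeta x) (T t x))) K HK).
apply orbit_norm_least. intros s Hs.
assert (H1 := H (T s x) t Ht). apply Rge_le in H1.
apply (Rle_div_l (norm (T s x)) _ K HK) in H1.
eapply Rle_trans; [exact H1|]. apply Rmult_le_compat_r; [lra|].
eapply Rle_trans; [|apply (orbit_le_norm s _ Hs)].
right. f_equal. assert (HTs := C0_linear_map s Hs).
rewrite (lin_minus _ _ _ HTs), (lin_scal _ HTs).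
rewrite <- (C0_add T HT), Rplus_comm, (C0_add T HT) by lra. reflexivity.
Qed.

Definition banach_limit (u : nat -> X) : X := lim (filtermap u eventually).

Lemma banach_limit_tends u : sn_cauchy orbit_norm u -> tends orbit_norm u (banach_limit u).
Proof.
intros Hu eps He.
assert (HF : ProperFilter (filtermap u eventually)) by (apply filtermap_proper_filter, eventually_filter).
assert (Hc : cauchy (filtermap u eventually)).
{ intros d. destruct (Hu d (cond_pos d)) as [n0 H0]. exists (u n0), n0. intros n Hn.
  apply norm_compat1. eapply Rle_lt_trans; [apply norm_le_orbit_norm|].
  change (orbit_norm (vminus (u n) (u n0)) < d).
  rewrite (sn_minus_sym orbit_norm_seminorm). now apply H0. }
assert (Hnf : 0 < norm_factor (K := C_AbsRing) (V := X)) by apply norm_factor_gt_0.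
(* Uniform balls of [X] are comparable to norm balls only up to [norm_factor], and the orbit norm
   costs a further [M]. *)
assert (He' : 0 < eps / M / norm_factor (K := C_AbsRing) (V := X)) by (repeat apply Rdiv_lt_0_compat; lra).
destruct (complete_cauchy (filtermap u eventually) HF Hc (mkposreal _ He')) as [n0 H0].
exists n0; intros n Hn. specialize (H0 n Hn). apply (norm_compat2 (K := C_AbsRing) (V := X)) in H0. simpl in H0.
fold (banach_limit u) in H0.
assert (H1 : norm (vminus (u n) (banach_limit u)) < eps / M).
{ eapply Rlt_le_trans; [exact H0|]. right. field. lra. }
eapply Rle_lt_trans; [apply orbit_norm_le|].
apply (Rlt_div_r (norm (vminus (u n) (banach_limit u))) eps M) in H1; lra.
Qed.

End Renorming.

(** In [2160 = 540 * 2 * 2], one factor pays for [cos t >= 1/2]. The other gives [kappa / 2], so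
    that half of the real part can be subtracted from [z] without leaving [good]. *)
Lemma narrow_sector (kappa : R) (z : C) :
  0 < kappa <= 1 -> z <> RtoC 0 -> Rabs (Carg z) <= kappa / 2160 ->
  0 < Re z /\ 540 * Rabs (Im z) <= kappa / 2 * Re z.
Proof.
intros Hk Hz Ha. assert (Hp := Carg_polar z Hz).
assert (Hm : 0 < Cmod z) by now apply Cmod_gt_0.
set (m := Cmod z) in *. set (t := Carg z) in *.
assert (HRe : Re z = m * cos t) by (rewrite Hp at 1; reflexivity).
assert (HIm : Im z = m * sin t) by (rewrite Hp at 1; reflexivity).
assert (Hc : / 2 <= cos t).
{ assert (H := Cmod_cis_minus_1 t). assert (H1 := Cmod_cis_minus_1_le t).
  assert (H2 := Cmod_ge_0 (cis t - 1)). nra. }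
assert (Hs := Rabs_sin_le t).
rewrite HRe, HIm, Rabs_mult, (Rabs_pos_eq m) by lra.
split; [nra|].
assert (H1 : 540 * Rabs (sin t) <= kappa / 2 * / 2) by lra.
assert (H2 : kappa / 2 * / 2 <= kappa / 2 * cos t) by (apply Rmult_le_compat_l; lra).
nra.
Qed.

Lemma Cminus_0_eq (w z : C) : (w - z)%C = RtoC 0 -> w = z.
Proof.
intros E. replace w with (z + (w - z))%C by ring. rewrite E. ring.
Qed.

(** * The holomorphic extension in the original norm *)

Section Extension.
Context {X : CompleteNormedModule C_AbsRing} {T : R -> X -> X} {M kappa : R}.
Context (HT : C0_semigroup T) (HM : 1 <= M).
Context (Hbound : forall t, 0 <= t -> Rbar_le (op_norm (T t)) M).
Context (Hk : 0 < kappa <= 1).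
Context (HL : forall s r phi y, 0 < s -> 0 < r <= / 2 -> Rabs phi <= PI ->
  kappa * Rabs phi * @orbit_norm X T y <= @orbit_norm X T
    (vminus (vscal (cis phi) y) (vplus (vscal (1 - r)%C y) (vscal (RtoC r) (T s y))))).

Local Notation N := (@orbit_norm X T).
Local Notation S := (@extension X T (@banach_limit X)).
Local Notation C1 := (21870 / kappa).

Let HN : seminorm N := orbit_norm_seminorm HT Hbound.
Let HcT : contraction_semigroup N T := orbit_norm_semigroup HT HM Hbound.
Let Hsep : forall x, N x = 0 -> x = vzero := orbit_norm_separated HT Hbound.
Let Hlim : forall u, sn_cauchy N u -> tends N u (@banach_limit X u) := banach_limit_tends HT HM Hbound.

Lemma sector_good z : z = RtoC 0 \/ Rabs (Carg z) <= kappa / 2160 -> good (kappa := kappa) z.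
Proof.
intros Hz. destruct (Ceq_dec z 0) as [->|Hz0].
- unfold good; simpl. rewrite Rabs_R0; lra.
- destruct Hz as [Hz|Hz]; [easy|].
  destruct (narrow_sector kappa z Hk Hz0 Hz) as [H1 H2]. unfold good. nra.
Qed.

Lemma extension_norm_bound z x : good (kappa := kappa) z -> norm (S z x) <= C1 * M * norm x.
Proof.
intros Hz. eapply Rle_trans; [apply (norm_le_orbit_norm HT Hbound)|].
eapply Rle_trans; [exact (extension_bound HN HcT Hk HL Hsep Hlim z x Hz)|].
rewrite Rmult_assoc. apply Rmult_le_compat_l; [apply Rdiv_le_0_compat; lra|].
apply (orbit_norm_le HT Hbound).
Qed.

Lemma extension_op_norm z : good (kappa := kappa) z -> Rbar_le (op_norm (S z)) (C1 * M).
Proof.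
intros Hz. apply op_norm_le.
- apply Rmult_le_pos; [apply Rdiv_le_0_compat|]; lra.
- intros x. now apply extension_norm_bound.
Qed.

Lemma extension_is_linear z : good (kappa := kappa) z -> is_linear (S z).
Proof.
intros Hz. assert (H := lin_extension HN HcT Hk HL Hsep Hlim z Hz).
split.
- exact (lin_plus _ H).
- exact (lin_scal _ H).
- exists (C1 * M). split.
  + apply Rmult_lt_0_compat; [apply Rdiv_lt_0_compat|]; lra.
  + intros x. now apply extension_norm_bound.
Qed.

Lemma extension_holomorphic : holomorphic_on (sector (kappa / 2160)) S.
Proof.
intros z [Hz0 Hz]. apply Rlt_le in Hz.
destruct (narrow_sector kappa z Hk Hz0 Hz) as [Hre Him].
(* The Taylor expansion is available at positive reals only. A nearby [w] equals
   [(z - tau) + tau (1 + th)] with [th = (w - z) / tau], so the semigroup law carries the derivative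
   at [tau] to [z] through [S (z - tau)]. *)
set (tau := Re z / 2).
assert (Htau : 0 < tau) by (unfold tau; lra).
assert (Ht0 : RtoC tau <> RtoC 0) by (intros E; apply RtoC_inj in E; lra).
assert (Hg : good (kappa := kappa) (z - RtoC tau)%C).
{ unfold good, tau. unfold Re, Im in *. destruct z as [a b]; simpl in *.
  replace (b + - 0) with b by ring. replace (a + - (a / 2)) with (a / 2) by field. lra. }
destruct (extension_taylor HN HcT Hk HL Hsep Hlim tau Htau) as (L & HLlin & (b & Hb & HLb) & Htay).
assert (HSlin := lin_extension HN HcT Hk HL Hsep Hlim _ Hg).
assert (HC : 0 < C1) by (apply Rdiv_lt_0_compat; lra).
exists (fun x => S (z - RtoC tau)%C (L x)). split.
{ assert (H := lin_comp _ _ HSlin HLlin). split.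
  - exact (lin_plus _ H).
  - exact (lin_scal _ H).
  - exists (C1 * b * M + 1).
    assert (H0 : 0 <= C1 * b * M) by (repeat apply Rmult_le_pos; lra).
    split; [lra|]. intros x.
    eapply Rle_trans; [apply (norm_le_orbit_norm HT Hbound)|].
    eapply Rle_trans; [exact (extension_bound HN HcT Hk HL Hsep Hlim _ _ Hg)|].
    apply Rle_trans with (C1 * (b * (M * norm x))).
    + apply Rmult_le_compat_l; [lra|]. eapply Rle_trans; [apply HLb|].
      apply Rmult_le_compat_l; [easy|]. apply (orbit_norm_le HT Hbound).
    + generalize (norm_ge_0 x). nra. }
set (A := C1 * C1 * (270 / kappa / tau) ^ 2 * M).
assert (HA : 0 <= A).
{ unfold A. apply Rmult_le_pos; [|lra]. apply Rmult_le_pos; [nra|apply pow2_ge_0]. }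
intros eps.
set (d := Rmin (kappa / 1080 * tau) (eps / (A + 1))).
assert (Hd : 0 < d).
{ apply Rmin_glb_lt; [nra|]. apply Rdiv_lt_0_compat; [apply cond_pos|lra]. }
(* Balls of [C] are products of intervals, so each coordinate gets half of [d]. *)
assert (Hd2 : 0 < d / 2) by lra.
exists (mkposreal _ Hd2). intros w. change C in (type of w). intros Hw Hwz.
assert (Hwd : Cmod (w - z) < d).
{ destruct Hw as [H1 H2]. destruct w as [w1 w2], z as [z1 z2]. simpl in H1, H2.
  change (Rabs (w1 - z1) < d / 2) in H1. change (Rabs (w2 - z2) < d / 2) in H2.
  eapply Rle_lt_trans; [apply (Cmod_le_add (w1 - z1) (w2 - z2))|]. lra. }
assert (Hmin1 : d <= kappa / 1080 * tau) by apply Rmin_l.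
assert (Hmin2 : d <= eps / (A + 1)) by apply Rmin_r.
assert (Hne : (w - z)%C <> RtoC 0) 
  by (intros E; exact (Hwz (Cminus_0_eq _ _ E))).
assert (Hpos : 0 < Cmod (w - z)) by (now apply Cmod_gt_0).
set (th := ((w - z) / RtoC tau)%C).
assert (Hth : Cmod th = Cmod (w - z) / tau).
{ unfold th. rewrite Cmod_div, Cmod_R, Rabs_pos_eq by (easy || lra). reflexivity. }
assert (Hth2 : 1080 * Cmod th <= kappa).
{ rewrite Hth. replace (1080 * (Cmod (w - z) / tau)) with (1080 * Cmod (w - z) / tau) by (field; lra).
  apply (Rle_div_l (1080 * Cmod (w - z)) kappa tau); lra. }
assert (Hgt := good_real Hk tau (Rlt_le _ _ Htau)).
assert (Hgs := good_shift Hk tau th Htau Hth2).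
apply op_norm_le; [left; apply cond_pos|]. intros x.
assert (Ew : S w x = S (z - RtoC tau)%C (S (RtoC tau * (1 + th))%C x)).
{ rewrite <- (extension_add HN HcT Hk HL Hsep Hlim _ _ x Hg Hgs). f_equal.
  unfold th. field. exact Ht0. }
assert (Ez : S z x = S (z - RtoC tau)%C (S (RtoC tau) x)).
{ rewrite <- (extension_add HN HcT Hk HL Hsep Hlim _ _ x Hg Hgt). f_equal. ring. }
set (D := vminus (S (RtoC tau * (1 + th))%C x)
       (vplus (S (RtoC tau) x) (vscal (RtoC tau * th)%C (L x)))).
assert (HD := Htay th x Hth2). fold D in HD.
change (norm (vminus (vscal (/ (w - z))%C (vminus (S w x) (S z x))) (S (z - RtoC tau)%C (L x)))
        <= eps * norm x).
replace (vminus (vscal (/ (w - z))%C (vminus (S w x) (S z x))) (S (z - RtoC tau)%C (L x)))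
  with (vscal (/ (w - z))%C (S (z - RtoC tau)%C D)).
2:{ unfold D. rewrite Ew, Ez, (lin_minus _ _ _ HSlin), (lin_plus _ HSlin), (lin_scal _ HSlin).
    replace (RtoC tau * th)%C with (w - z)%C by (unfold th; field; exact Ht0).
    module_eq. field. exact Hne. }
eapply Rle_trans; [apply (norm_le_orbit_norm HT Hbound)|].
rewrite (sn_scal N HN), Cmod_inv by exact Hne.
set (m := Cmod (w - z)) in *.
assert (HSD : N (S (z - RtoC tau)%C D) <= A * m ^ 2 * norm x).
{ eapply Rle_trans; [exact (extension_bound HN HcT Hk HL Hsep Hlim _ _ Hg)|].
  apply Rle_trans with (C1 * (C1 * (270 * Cmod th / kappa) ^ 2 * (M * norm x))).
  - apply Rmult_le_compat_l; [lra|]. eapply Rle_trans; [exact HD|].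
    apply Rmult_le_compat_l; [|apply (orbit_norm_le HT Hbound)].
    apply Rmult_le_pos; [lra|apply pow2_ge_0].
  - right. rewrite Hth. unfold A. field. lra. }
apply Rle_trans with (/ m * (A * m ^ 2 * norm x)).
{ apply Rmult_le_compat_l; [left; now apply Rinv_0_lt_compat|exact HSD]. }
replace (/ m * (A * m ^ 2 * norm x)) with (A * m * norm x) by (field; lra).
apply Rmult_le_compat_r; [apply norm_ge_0|].
apply (Rle_div_r d eps (A + 1)) in Hmin2; [|lra]. nra.
Qed.

Lemma extension_continuous_0 x delta' : 0 < delta' < kappa / 2160 ->
  filterlim (fun z => S z x) (within (closed_sector delta') (locally (RtoC 0))) (locally x).
Proof.
intros Hd' P HP. destruct (locally_norm_elim x P HP) as (eps & He & Heps).
destruct (extension_near_0 HN HcT Hk HL Hsep Hlim x eps He) as (d & Hd & Hnear).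
assert (Hd2 : 0 < d / 2) by lra.
exists (mkposreal _ Hd2). intros z Hz Hsec. apply Heps.
eapply Rle_lt_trans; [apply (norm_le_orbit_norm HT Hbound)|]. apply Hnear.
- apply sector_good. destruct Hsec as [->|Hsec]; [now left|right; lra].
- destruct Hz as [H1 H2]. destruct z as [z1 z2]. simpl in H1, H2.
  change (Rabs (z1 - 0) < d / 2) in H1. change (Rabs (z2 - 0) < d / 2) in H2.
  rewrite Rminus_0_r in H1, H2.
  eapply Rle_lt_trans; [apply Cmod_le_add|]. lra.
Qed.

Lemma extension_semigroup : bounded_holomorphic_semigroup (kappa / 2160) S.
Proof.
assert (Hsec : forall z, sector (kappa / 2160) z -> good (kappa := kappa) z).
{ intros z [_ Hz]. apply sector_good. right; lra. }
split.
- generalize PI2_1. lra.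
- intros z [Hz | ->]; apply extension_is_linear; [now apply Hsec|].
  apply sector_good; now left.
- intros z1 z2 H1 H2 x. apply (extension_add HN HcT Hk HL Hsep Hlim); now apply Hsec.
- exact extension_holomorphic.
- exact extension_continuous_0.
- intros delta' Hd. exists (C1 * M). intros z Hz. apply extension_op_norm, sector_good.
  destruct Hz as [->|Hz]; [now left|right; lra].
Qed.

Lemma extension_extends t x : 0 <= t -> S (RtoC t) x = T t x.
Proof. intros Ht. exact (extension_real HN HcT Hk HL Hsep Hlim t x Ht). Qed.

End Extension.

(** * Choice of the constants and conclusion *)

Lemma ln_2_lt_1 : ln 2 < 1.
Proof.
rewrite <- (ln_exp 1). apply ln_increasing; [lra|].
generalize (exp_ineq1 1 ltac:(lra)). lra.
Qed.

Theorem theorem3p15 :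
  exists c c' : R, 0 < c /\ 0 < c' /\
  forall (X : CompleteNormedModule C_AbsRing) (T : R -> X -> X)
         (M K : R) (zeta : C),
    (exists x : X, x <> zero) ->
    C0_semigroup T ->
    1 <= M ->
    (forall t, 0 <= t -> Rbar_le (op_norm (T t)) M) ->
    Cmod zeta = 1 ->
    0 < K ->
    (forall (x : X) (t : R), 0 < t ->
       norm (minus (scal zeta x) (T t x)) >= norm x / K) ->
    exists (delta : R) (S : C -> X -> X),
      bounded_holomorphic_semigroup delta S /\
      (forall t, 0 <= t -> forall x, S (RtoC t) x = T t x) /\
      (forall z : C, z <> RtoC 0 -> Rabs (Carg z) <= c / (M ^ 2 * K) ->
         sector delta z /\
         Rbar_le (op_norm (S z))
                 (c' * (M ^ 2 * K) * (1 + ln (M ^ 2 * K)))).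
Proof.
assert (Hln2 := ln_2_lt_1).
(* With [kappa = 1 / (12000 K)], the factor [4320 = 2 * 2160] keeps the closed sector inside the
   open one of angle [kappa / 2160]. The bound [C1 * M] is [21870 * 12000 * K * M], and [1 - ln 2]
   bounds [1 + ln (M^2 K)] from below because [M^2 K >= 1/2]. *)
exists (/ (12000 * 4320)), (21870 * 12000 / (1 - ln 2)).
split; [apply Rinv_0_lt_compat; lra|]. split; [apply Rdiv_lt_0_compat; lra|].
intros X T M K zeta [x0 Hx0] HT HM Hbound Hzeta HK Hlow.
assert (HN := orbit_norm_seminorm HT Hbound).
assert (HcT := orbit_norm_semigroup HT HM Hbound).
assert (HlowN : forall y t, 0 < t -> @orbit_norm X T y / K <= @orbit_norm X T (vminus (vscal zeta y) (T t y))).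
{ intros y t Ht. now apply (orbit_norm_lower HT Hbound). }
(* A nonzero [x] satisfies [N x / K <= N (zeta x - T 1 x) <= 2 N x]. *)
assert (HK2 : / 2 <= K).
{ assert (Hx : 0 < @orbit_norm X T x0).
  { destruct (sn_ge_0 HN x0) as [|E]; [easy|]. exfalso. apply Hx0.
    now apply (orbit_norm_separated HT Hbound). }
  assert (H1 := HlowN x0 1 Rlt_0_1).
  assert (H2 := sn_minus HN (vscal zeta x0) (T 1 x0)).
  rewrite (sn_scal _ HN), Hzeta in H2.
  assert (H3 := cs_contraction _ T HcT 1 Rle_0_1 x0).
  assert (H4 : @orbit_norm X T x0 / K <= 2 * @orbit_norm X T x0) by lra.
  apply (Rle_div_l (@orbit_norm X T x0) (2 * @orbit_norm X T x0) K HK) in H4. nra. }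
set (kappa := / (12000 * K)).
assert (Hk : 0 < kappa <= 1).
{ unfold kappa. split; [apply Rinv_0_lt_compat; lra|].
  rewrite <- Rinv_1. apply Rinv_le_contravar; lra. }
assert (HL : forall s r phi y, 0 < s -> 0 < r <= / 2 -> Rabs phi <= PI ->
  kappa * Rabs phi * @orbit_norm X T y <= @orbit_norm X T
    (vminus (vscal (cis phi) y) (vplus (vscal (1 - r)%C y) (vscal (RtoC r) (T s y))))).
{ intros s r phi y Hs Hr Hphi.
  apply (lower_bound HN (cs_lin _ T HcT s (Rlt_le _ _ Hs))
    (cs_contraction _ T HcT s (Rlt_le _ _ Hs)) zeta); try assumption.
  (* The [k]-th power of [T s] is [T (k s)], so the bound at all times covers all powers. *)
  intros k z Hk1. rewrite (cs_iter HcT) by lra. apply HlowN.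
  apply Rmult_lt_0_compat; [apply lt_0_INR; lia | easy]. }
exists (kappa / 2160), (@extension X T (@banach_limit X)).
split; [exact (extension_semigroup HT HM Hbound Hk HL)|].
split; [intros t Ht x; exact (extension_extends HT HM Hbound Hk HL t x Ht)|].
intros z Hz Harg.
assert (HM2 : M <= M ^ 2) by nra.
assert (HCt : / 2 <= M ^ 2 * K) by nra.
assert (Hsmall : / (12000 * 4320) / (M ^ 2 * K) < kappa / 2160).
{ apply Rle_lt_trans with (kappa / 4320); [|lra].
  unfold kappa. replace (/ (12000 * 4320) / (M ^ 2 * K)) with (/ (12000 * 4320) * / (M ^ 2 * K)) by reflexivity.
  replace (/ (12000 * K) / 4320) with (/ (12000 * 4320) * / K) by (field; lra).
  apply Rmult_le_compat_l; [left; apply Rinv_0_lt_compat; lra|].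
  apply Rinv_le_contravar; nra. }
split; [split; [exact Hz|lra]|].
eapply Rbar_le_trans.
{ apply (extension_op_norm HT HM Hbound Hk HL). apply (sector_good Hk). right; lra. }
simpl. unfold kappa.
assert (Hlog : 1 - ln 2 <= 1 + ln (M ^ 2 * K)).
{ unfold Rminus. rewrite <- ln_Rinv by lra. apply Rplus_le_compat_l.
  destruct HCt as [HCt|HCt]; [left; apply ln_increasing; lra | rewrite HCt; lra]. }
replace (21870 / / (12000 * K) * M) with (21870 * 12000 / (1 - ln 2) * (M * K) * (1 - ln 2))
  by (field; lra).
assert (H0 : 0 < 21870 * 12000 / (1 - ln 2)) by (apply Rdiv_lt_0_compat; lra).
set (q := 21870 * 12000 / (1 - ln 2)) in *.
change (M * (M * 1)) with (M ^ 2).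
apply Rmult_le_compat; try lra.
- apply Rmult_le_pos; nra.
- apply Rmult_le_compat_l; [lra|]. apply Rmult_le_compat_r; lra.
Qed.
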